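(* Assume the Hardy--Littlewood conjecture (HL). Let $\alpha$ be a positive integer with $\gcd(\alpha,6)=1$, $r$ a fixed non-zero integer, $\beta\in\{1,\omega,\omega^2\}$, $0\leqslant d\leqslant2$, $0\leqslant k\leqslant3$, $\epsilon\in\{1,-1\}$, $\gamma\in(\mathbb{Z}[\omega]/(2))^\times$ and $\eta\in\mathbb{Z}[\omega]/(3)$. Then as $x\to+\infty$, $$\mathcal{E}_{d,k,\epsilon}(x;r,\alpha,\beta,\gamma,\eta)\sim\frac{h_{3,r}}{216}\cdot\Delta(r,k,\gamma,\beta,\eta)\cdot E_{d,k,\epsilon}(r,\alpha,\beta)\cdot\frac{\sqrt x}{\log x},$$ where $$\Delta(r,k,\gamma,\beta,\eta)=\begin{cases}8,& r\equiv r_1(\beta,\eta)\ (\mathrm{mod}\ 72),\ k\equiv1\ (\mathrm{mod}\ 4),\ \gamma\equiv\beta^2\ (\mathrm{mod}\ 2),\\ 8,& r\equiv r_2(\beta,\eta)\ (\mathrm{mod}\ 72),\ k\equiv3\ (\mathrm{mod}\ 4),\ \gamma\equiv\beta^2\ (\mathrm{mod}\ 2),\\ 4,& r\equiv r_3(\beta,\eta)\ (\mathrm{mod}\ 36),\ 2\mid k,\ \gamma\equiv\beta^2\ (\mathrm{mod}\ 2),\\ 1,& r\equiv r_4(\beta,\eta)\ (\mathrm{mod}\ 18),\ \gamma\equiv\beta^2\omega\text{ or }\beta^2(1+\omega)\ (\mathrm{mod}\ 2),\\ 0,&\text{otherwise,}\end{cases}$$ with $r_j(\beta,\eta)=c_j(\beta)-24\,\mathrm{Tr}(\beta\eta)$,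 where $(c_1,c_2,c_3,c_4)(1)=(40,4,22,13)$ and $(c_1,c_2,c_3,c_4)(\omega)=(c_1,c_2,c_3,c_4)(\omega^2)=(16,52,34,7)$, and $$E_{d,k,\epsilon}(r,\alpha,\beta)=1+\epsilon(-1)^{\frac{k(\alpha-1)}{2}}\Big(\frac3\alpha\Big)\Omega_2(3;\alpha,r)+2\Re\Big(\omega^d\Big(\frac\beta\alpha\Big)_3\Big)\Big\{\Omega_3(3;\alpha,r)+\epsilon(-1)^{\frac{k(\alpha-1)}{2}}\Big(\frac3\alpha\Big)\Omega_6(3;\alpha,r)\Big\}.$$
   Context: $\omega=e^{2\pi i/3}$. $\Pi_3(x)$ is the set of $\pi\in\mathbb{Z}[\omega]$ whose norm $N(\pi)=\pi\bar\pi$ is a rational prime $\leqslant x$, and $$\mathcal{E}_{d,k,\epsilon}(x;r,\alpha,\beta,\gamma,\eta)=\Big|\Big\{\pi\in\Pi_3(x):\ \mathrm{Tr}(\beta\pi)=r,\ \Big(\frac\alpha\pi\Big)_3=\omega^d,\ \Big(\frac{\alpha}{N(\pi)}\Big)=\epsilon,\ N(\pi)\equiv2k+1\ (\mathrm{mod}\ 8),\ \pi\equiv\gamma\ (\mathrm{mod}\ 2),\ \pi\equiv2+3\eta\ (\mathrm{mod}\ 9)\Big\}\Big|.$$ Cubic residue symbol: for a prime $\pi\in\mathbb{Z}[\omega]$ coprime to $3$, $(\frac z\pi)_3\in\{0,1,\omega,\omega^2\}$ with $(\frac z\pi)_3\equiv z^{(N(\pi)-1)/3}\ (\mathrm{mod}\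 \pi)$, extended multiplicatively in the denominator to elements coprime to $3$. $(\frac\cdot\cdot)$ without subscript is the Legendre/Jacobi symbol. (The residue classes $r_j(\beta,\eta)$ are well defined since $\eta$ is given mod $3$.) $\Omega_j(3;q,r)=\prod_{p^\nu\parallel q,\ p\nmid r,\ j\nmid\nu}\frac{-1}{p-1-(\frac{-3}{p})}$ (empty product $=1$). $h_{3,r}=\xi\cdot\frac{\sqrt3}{2}\prod_{p\nmid2r}\big(1-\frac{(\frac{-3}{p})}{p-1}\big)$ with $\xi=1$ if $2\mid r$, $3\nmid r$; $\xi=2$ if $\gcd(6,r)=1$; $\xi=0$ if $3\mid r$ (products over primes in increasing order). If the constant is $0$, the asymptotic formula means the left side is $O(1)$. (HL): for all $a,b,c\in\mathbb{Z}$ with $a>0$, $b^2-4ac$ not a square, $\gcd(a,b,c)=1$, and $a+b$, $c$ not both even, the number $\pi_{a,b,c}(x)$ of primes $p\leqslant x$ of the form $am^2+bm+c$, $m\in\mathbb{Z}_{\geqslant1}$, satisfies $\pi_{a,b,c}(x)\sim\frac{\gcd(2,a+b)}{\sqrt a}\frac{\Delta}{\varphi(\Delta)}\prod_{p\nmid2a}\Big(1-\frac{(\frac{b^2-4ac}{p})}{p-1}\Big)\frac{\sqrt x}{\log x}$, $\Delta$ being the odd part of $\gcd(a,b)$. *)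

(* Defs.v *)
From HB Require Import structures.
From mathcomp Require Import all_boot all_order all_algebra.
From mathcomp Require Import all_classical all_reals all_analysis.
From mathcomp Require Import finmap complex.
From mathcomp Require Import ring lra zify.

Set Implicit Arguments.
Unset Strict Implicit.
Unset Printing Implicit Defensive.

Import Order.TTheory GRing.Theory Num.Theory.
Import numFieldNormedType.Exports.

Local Open Scope classical_set_scope.
Local Open Scope ring_scope.

(* Eisenstein integers: [Eis a b] is a + b omega. *)
Record eis : Type := Eis { ere : int; eim : int }.

Definition pair_of_eis (z : eis) : int * int := (ere z, eim z).
Definition eis_of_pair (u : int * int) : eis := Eis u.1 u.2.
Lemma pair_of_eisK : cancel pair_of_eis eis_of_pair. Proof. by case. Qed.

HB.instance Definition _ := Countable.copy eis (can_type pair_of_eisK).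

Definition eis_zero := Eis 0 0.
Definition eis_one := Eis 1 0.
Definition eis_add x y := Eis (ere x + ere y) (eim x + eim y).
Definition eis_opp x := Eis (- ere x) (- eim x).
(* from omega^2 = - 1 - omega *)
Definition eis_mul x y :=
  Eis (ere x * ere y - eim x * eim y)
      (ere x * eim y + eim x * ere y - eim x * eim y).

Fact eis_addA : associative eis_add.
Proof. by move=> [? ?] [? ?] [? ?]; congr Eis => /=; ring. Qed.
Fact eis_addC : commutative eis_add.
Proof. by move=> [? ?] [? ?]; congr Eis => /=; ring. Qed.
Fact eis_add0 : left_id eis_zero eis_add.
Proof. by move=> [? ?]; congr Eis => /=; ring. Qed.
Fact eis_addN : left_inverse eis_zero eis_opp eis_add.
Proof. by move=> [? ?]; congr Eis => /=; ring. Qed.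
Fact eis_mulA : associative eis_mul.
Proof. by move=> [? ?] [? ?] [? ?]; congr Eis => /=; ring. Qed.
Fact eis_mulC : commutative eis_mul.
Proof. by move=> [? ?] [? ?]; congr Eis => /=; ring. Qed.
Fact eis_mul1 : left_id eis_one eis_mul.
Proof. by move=> [? ?]; congr Eis => /=; ring. Qed.
Fact eis_mulDl : left_distributive eis_mul eis_add.
Proof. by move=> [? ?] [? ?] [? ?]; congr Eis => /=; ring. Qed.
Fact eis_1neq0 : eis_one != eis_zero. Proof. by []. Qed.

HB.instance Definition _ :=
  GRing.isZmodule.Build eis eis_addA eis_addC eis_add0 eis_addN.
HB.instance Definition _ := GRing.Zmodule_isComNzRing.Build eis
  eis_mulA eis_mulC eis_mul1 eis_mulDl eis_1neq0.

Definition omega : eis := Eis 0 1.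

Definition econj (z : eis) : eis := Eis (ere z - eim z) (- eim z).
Definition enorm (z : eis) : nat :=
  absz (ere z ^+ 2 - ere z * eim z + eim z ^+ 2).
Definition etr (z : eis) : int := 2 * ere z - eim z.

Lemma eis_intr (n : int) : n%:~R = Eis n 0.
Proof.
have H (m : nat) : m%:R = Eis m%:Z 0.
  by elim: m => [|m IH]; rewrite ?mulrS // IH; congr Eis => /=; lia.
case: n => m; first by rewrite -pmulrn H.
by rewrite NegzE mulrNz -pmulrn H.
Qed.

Lemma enormE (z : eis) : (enorm z)%:R = z * econj z.
Proof.
rewrite pmulrn eis_intr; case: z => a b; rewrite /enorm /=.
rewrite gez0_abs; last by nia.
by congr Eis => /=; ring.
Qed.

Lemma etrE (z : eis) : (etr z)%:~R = z + econj z.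
Proof. by rewrite eis_intr; case: z => a b; rewrite /etr /=; congr Eis => /=; ring. Qed.

Lemma omega_sq : omega ^+ 2 = - 1 - omega.
Proof. by []. Qed.

Definition edvd (d z : eis) : Prop := exists q, z = q * d.
Definition eeqmod (m z w : eis) : Prop := edvd m (z - w).
Definition eunit (u : eis) : Prop := edvd u 1.
Definition eprime (p : eis) : Prop :=
  [/\ p <> 0, ~ eunit p &
      forall a b, edvd p (a * b) -> edvd p a \/ edvd p b].

(* The element of {0, 1, omega, omega^2} congruent to z^((N(p)-1)/3) modulo
   the prime p; it is unique because p does not divide 3. *)
Definition cubic_prime (z p : eis) : eis :=
  let w := z ^+ ((enorm p).-1 %/ 3) in
  if `[< eeqmod p w 0 >] then 0
  else if `[< eeqmod p w 1 >] then 1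
  else if `[< eeqmod p w omega >] then omega
  else omega ^+ 2.

(* A chosen prime factorization, up to a unit.  By unique factorization
   [cubic] does not depend on the choice, as [cubic_prime z p] depends only
   on the class of p up to units. *)
Definition efactors (n : eis) : seq eis :=
  xget [::] [set s : seq eis | (forall p, p \in s -> eprime p) /\
                     exists2 u, eunit u & n = u * \prod_(p <- s) p].

Definition cubic (z n : eis) : eis := \prod_(p <- efactors n) cubic_prime z p.

(* Legendre symbol, for an odd prime p *)
Definition legendre (a : int) (p : nat) : int :=
  if (p%:Z %| a)%Z then 0
  else if [exists x : 'I_p, (x%:Z ^+ 2 == a %[mod p%:Z])%Z] then 1
  else -1.

(* Jacobi symbol, for an odd n > 0 *)
Definition jacobi (a : int) (n : nat) : int :=
  \prod_(p <- primes n) legendre a p ^+ logn p n.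

Section Real.
Variable R : realType.

(* e^(2 pi i / 3) *)
Definition omegaC : R[i] := Complex (cos (2 * pi / 3)) (sin (2 * pi / 3)).
Definition eisC (z : eis) : R[i] := (ere z)%:~R + (eim z)%:~R * omegaC.

(* f(x) ~ C g(x) as x -> +oo, read as f = O(1) when C = 0 *)
Definition asymp (f : R -> R) (C : R) (g : R -> R) : Prop :=
  if C == 0 then exists M : R, \forall x \near +oo_R, `|f x| <= M
  else f x / (C * g x) @[x --> +oo_R] --> (1 : R).

(* the product, over the primes satisfying P in increasing order, of F *)
Definition prime_prod (P : pred nat) (F : nat -> R) : R :=
  limn (fun n : nat => \prod_(0 <= p < n | prime p && P p) F p).

Definition quad_primes (a b c : int) (x : R) : set nat :=
  [set p | [/\ prime p, p%:R <= x &
     exists2 m : nat, (1 <= m)%N & p%:Z = a * m%:Z ^+ 2 + b * m%:Z + c]].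

Lemma finite_quad_primes (a b c : int) (x : R) :
  finite_set (quad_primes a b c x).
Proof.
apply: (sub_finite_set (B := `I_(Num.truncn x).+1)); last exact: finite_II.
move=> p [_ px _] /=; rewrite ltnS -(@natrK R p).
exact: le_truncn.
Qed.

Definition hl_const (a b c : int) : R :=
  let D := ((gcdn `|a| `|b|)`_2^')%N in
  (gcdz 2 (a + b))%:~R / Num.sqrt a%:~R * (D%:R / (totient D)%:R) *
  prime_prod (fun p => ~~ (p%:Z %| 2 * a)%Z)
    (fun p => 1 - (legendre (b ^+ 2 - 4 * a * c) p)%:~R / (p%:R - 1)).

Definition HardyLittlewood : Prop :=
  forall a b c : int,
    0 < a ->
    ~ (exists n : int, b ^+ 2 - 4 * a * c = n ^+ 2) ->
    gcdz (gcdz a b) c = 1 ->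
    ~ ((2 %| a + b)%Z /\ (2 %| c)%Z) ->
    asymp (fun x => (#|` fset_set (quad_primes a b c x)|)%:R)
          (hl_const a b c) (fun x => Num.sqrt x / ln x).

Definition Pi3 (x : R) : set eis :=
  [set p | prime (enorm p) /\ (enorm p)%:R <= x].

Lemma finite_Pi3 (x : R) : finite_set (Pi3 x).
Proof.
pose n := Num.truncn x.
pose f (u : nat * nat) : eis := Eis (u.1%:Z - n.+1%:Z) (u.2%:Z - n.+1%:Z).
apply: (sub_finite_set (B := f @` (`I_(4 * n + 4) `*` `I_(4 * n + 4)))); last first.
  by apply: finite_image; apply: finite_setX; exact: finite_II.
move=> [a b] [_ px].
have {}px : (enorm (Eis a b) <= n)%N.
  by rewrite -(@natrK R (enorm _)); exact: le_truncn.
rewrite /enorm /= in px.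
have hab : a ^+ 2 - a * b + b ^+ 2 <= n%:Z.
  move: px; rewrite -lez_nat gez0_abs //.
  by have := sqr_ge0 (2 * a - b); have := sqr_ge0 b; lra.
have ha : 3 * a ^+ 2 <= 4 * n%:Z by have := sqr_ge0 (2 * b - a); lra.
have hb : 3 * b ^+ 2 <= 4 * n%:Z by have := sqr_ge0 (2 * a - b); lra.
have bound (c : int) : 3 * c ^+ 2 <= 4 * n%:Z -> - n.+1%:Z <= c <= n.+1%:Z.
  by move=> hc; apply/andP; split; nia.
have /andP[ha1 ha2] := bound _ ha; have /andP[hb1 hb2] := bound _ hb.
exists (absz (a + n.+1%:Z), absz (b + n.+1%:Z)); first by split => /=; lia.
by rewrite /f /=; congr Eis; lia.
Qed.

(* gamma and eta are representatives of classes modulo 2 and modulo 3; only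
   these classes matter, as 3 * eta is used modulo 9. *)
Definition Eset (d k : nat) (eps : int) (x : R) (r : int) (alpha : nat)
    (beta gamma eta : eis) : set eis :=
  [set p | Pi3 x p /\
    [/\ etr (beta * p) = r,
        cubic_prime alpha%:R p = omega ^+ d &
        legendre alpha%:Z (enorm p) = eps] /\
    [/\ enorm p = (2 * k + 1)%N %[mod 8],
        eeqmod 2 p gamma &
        eeqmod 9 p (2 + 3 * eta)]].

Definition Ecount (d k : nat) (eps : int) (x : R) (r : int) (alpha : nat)
    (beta gamma eta : eis) : nat :=
  #|` fset_set (Eset d k eps x r alpha beta gamma eta)|.

Definition Omega3 (j q : nat) (r : int) : R :=
  \prod_(p <- primes q | ~~ (p%:Z %| r)%Z && ~~ (j %| logn p q)%N)
    (-1 / (p%:R - 1 - (legendre (-3) p)%:~R)).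

Definition xi3 (r : int) : R :=
  if (3 %| r)%Z then 0 else if (2 %| r)%Z then 1 else 2.

Definition h3 (r : int) : R :=
  xi3 r * (Num.sqrt 3 / 2) *
  prime_prod (fun p => ~~ (p%:Z %| 2 * r)%Z)
    (fun p => 1 - (legendre (-3) p)%:~R / (p%:R - 1)).

Definition c1 (beta : eis) : int := if beta == 1 then 40 else 16.
Definition c2 (beta : eis) : int := if beta == 1 then 4 else 52.
Definition c3 (beta : eis) : int := if beta == 1 then 22 else 34.
Definition c4 (beta : eis) : int := if beta == 1 then 13 else 7.

Definition rj (c : eis -> int) (beta eta : eis) : int :=
  c beta - 24 * etr (beta * eta).

Definition Delta (r : int) (k : nat) (gamma beta eta : eis) : nat :=
  let gammaP w := `[< eeqmod 2 gamma w >] in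
  if [&& (r == rj c1 beta eta %[mod 72])%Z, (k == 1 %[mod 4])%N
       & gammaP (beta ^+ 2)] then 8%N
  else if [&& (r == rj c2 beta eta %[mod 72])%Z, (k == 3 %[mod 4])%N
       & gammaP (beta ^+ 2)] then 8%N
  else if [&& (r == rj c3 beta eta %[mod 36])%Z, (2 %| k)%N
       & gammaP (beta ^+ 2)] then 4%N
  else if (r == rj c4 beta eta %[mod 18])%Z &&
          (gammaP (beta ^+ 2 * omega) || gammaP (beta ^+ 2 * (1 + omega)))
       then 1%N
  else 0%N.

Definition Econst (d k : nat) (eps r : int) (alpha : nat) (beta : eis) : R :=
  let s : int := eps * (-1) ^+ ((k * (alpha - 1)) %/ 2) * jacobi 3 alpha in
  1 + s%:~R * Omega3 2 alpha r +
  2 * complex.Re (omegaC ^+ d * eisC (cubic beta alpha%:R)) *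
  (Omega3 3 alpha r + s%:~R * Omega3 6 alpha r).

End Real.

(* Main.v *)
(** Write beta p = (r + B sqrt(-3)) / 2. The elements p with Tr(beta p) = r
    correspond to the integers B of the parity of r, and 4 N(p) = r^2 + 3 B^2.
    The conditions on p modulo 2 and 9 and on N(p) modulo 8 are conditions on B
    modulo 16 and 9. By quadratic and cubic reciprocity (proved with Gauss sums
    in an algebraic closure of F_q; only the cubic law (q / p)_3 for rational
    primes q is needed) the symbols of alpha are products of characters of
    r + B sqrt(-3) modulo the primes q dividing alpha. Hence the set of B is, up
    to a bounded number of elements, a union of classes modulo 144 rad(alpha),
    each of which gives a quadratic polynomial covered by (HL), with one and the
    same constant. The classes are counted by orthogonality of the six
    characters: those modulo q are trivial on the integers, so a nontrivial one
    sums over B to minus its value at sqrt(-3), which produces the factors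
    Omega_j. *)
From HB Require Import structures.
Require Import Defs.
From mathcomp Require Import all_boot all_order all_algebra.
From mathcomp Require Import all_solvable all_field.
From mathcomp Require Import all_classical all_reals all_analysis.
From mathcomp Require Import finmap complex.
From mathcomp Require Import ring lra zify.

Set Implicit Arguments.
Unset Strict Implicit.
Unset Printing Implicit Defensive.

Import Order.TTheory GRing.Theory Num.Theory.
Import numFieldNormedType.Exports.

Local Open Scope ring_scope.

(** * Gauss sums over a prime field *)

(** The Gauss sum g is compared with its power q^2 because q^2 is 1 modulo 3 for split and inert q
    alike, so that cubic character values are fixed. This yields (q / pi)_3 = (pi N(pi))^((q^2 - 1)
    / 3) once the Jacobi sum is known to be pi itself and not just an associate, which is where the
    class 2 modulo 3 of pi enters. (HL) counts only m >= 1, so a class is taken with a sign s, B = s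
    (c + M m), where M is the modulus; the values |B| < M are the bounded error. The signs double
    the classes, and xi Delta is twice the number of classes modulo 16 times that modulo 9. The
    factor 1/216: with Q = rad(alpha), (HL) gives 2 / (72 Q sqrt 3) from the leading coefficient 3
    (72 Q)^2, and a factor 3/2 at the prime 3 from the totient ratio; the six characters give 1/6;
    and 3 / (72 . 6 . sqrt 3) = (sqrt 3 / 2) / 216. The asserted constant is thus exactly the
    constant of one class times the number of classes, so the vanishing cases need no separate
    analysis of the formula. *)

Lemma sum_nontrivial_char (T : finType) (F : idomainType) (f : T -> F)
    (h : T -> T) (c : F) :
  injective h -> (forall t, f (h t) = c * f t) -> c != 1 -> \sum_t f t = 0.
Proof.
move=> hI fh c1.
have : \sum_t f t = c * \sum_t f t.
  by rewrite {1}(reindex_inj hI) mulr_sumr; apply: eq_bigr.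
move/eqP; rewrite -subr_eq0 -{1}[\sum_t _]mul1r -mulrBl mulf_eq0 subr_eq0.
by rewrite eq_sym (negPf c1) => /eqP.
Qed.

Section GaussSum.
Variables (F : fieldType) (p : nat) (z : F).
Hypotheses (p_pr : prime p) (zP : p.-primitive_root z).

Definition addchar (t : 'F_p) : F := z ^+ t.

Lemma addcharD s t : addchar (s + t) = addchar s * addchar t.
Proof.
rewrite /addchar -exprD -(prim_expr_mod zP (s + t)%N) /=.
by rewrite {3}Fp_cast.
Qed.

Lemma addchar0 : addchar 0 = 1. Proof. by []. Qed.

Lemma addchar_nat (n : nat) : addchar n%:R = z ^+ n.
Proof. by rewrite /addchar val_Fp_nat // (prim_expr_mod zP). Qed.

Lemma addcharX t (n : nat) : addchar t ^+ n = addchar (n%:R * t).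
Proof.
elim: n => [|n IH]; first by rewrite mul0r addchar0.
by rewrite exprS IH mulrS mulrDl mul1r addcharD.
Qed.

Lemma sum_addchar : \sum_t addchar t = 0.
Proof.
apply: (sum_nontrivial_char (h := +%R 1) (c := addchar 1)).
- exact: addrI.
- by move=> t; rewrite addcharD.
have -> : addchar 1 = z ^+ 1 by rewrite -addchar_nat.
rewrite -(prim_order_dvd zP) dvdn1.
by apply: contraTneq p_pr => ->.
Qed.

Lemma sum_addcharM (u : 'F_p) :
  \sum_t addchar (u * t) = if u == 0 then p%:R else 0.
Proof.
case: eqP => [->|/eqP u0].
  under eq_bigr do rewrite mul0r addchar0.
  by rewrite sumr_const card_Fp.
rewrite -{2}sum_addchar [RHS](reindex_inj (mulfI u0)).
by [].
Qed.

Section MultiplicativeCharacter.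
Variable chi : 'F_p -> F.
Hypotheses (chiM : {morph chi : s t / s * t}) (chi0 : chi 0 = 0)
  (chi1 : chi 1 = 1).

Definition gauss_sum (f : 'F_p -> F) : F := \sum_t f t * addchar t.
Definition jacobi_sum (f g : 'F_p -> F) : F := \sum_t f t * g (1 - t).

Lemma mchar_neq0 t : t != 0 -> chi t != 0.
Proof.
move=> t0; apply: contra_neq (oner_neq0 F) => ct.
by rewrite -chi1 -(mulfV t0) chiM ct mul0r.
Qed.

Lemma mcharV t : chi t^-1 = (chi t)^-1.
Proof.
have [->|t0] := eqVneq t 0; first by rewrite invr0 chi0 invr0.
by apply: (mulfI (mchar_neq0 t0)); rewrite -chiM !mulfV ?mchar_neq0.
Qed.

Lemma mcharX t n : chi (t ^+ n) = chi t ^+ n.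
Proof. by elim: n => [|n IH]; rewrite ?expr0 // !exprS chiM IH. Qed.

Lemma sum_mchar u : u != 0 -> chi u != 1 -> \sum_t chi t = 0.
Proof.
move=> u0 cu; apply: (sum_nontrivial_char (h := *%R u) (c := chi u)) => //.
exact: mulfI.
Qed.

(** Substituting s t for s leaves the sum over s of chi(s) times the sum of [addchar ((s + 1) * t)]
    over t <> 0. The inner sum is p - 1 at s = -1 and -1 elsewhere, and the terms -chi(s) add up to
    0. *)
Lemma gauss_sum_inv u : u != 0 -> chi u != 1 ->
  gauss_sum chi * gauss_sum (fun t => (chi t)^-1) = chi (-1) * p%:R.
Proof.
move=> u0 cu; rewrite /gauss_sum mulr_sumr.
have step t : (\sum_s chi s * addchar s) * ((chi t)^-1 * addchar t) =
    \sum_s (if t == 0 then 0 else chi s * addchar ((s + 1) * t)).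
  have [->|t0] := eqVneq t 0.
    by rewrite chi0 invr0 mul0r mulr0 big1.
  rewrite (reindex_inj (mulIf t0)) mulr_suml; apply: eq_bigr => s _.
  rewrite chiM mulrDl mul1r addcharD.
  by rewrite !mulrA; congr (_ * _); rewrite mulrAC mulfK ?mchar_neq0.
under eq_bigr do rewrite step.
rewrite exchange_big /=.
have step2 s : \sum_t (if t == 0 then 0 else chi s * addchar ((s + 1) * t)) =
    chi s * (if s == -1 then p%:R else 0) - chi s.
  rewrite -addr_eq0 -sum_addcharM mulr_sumr.
  rewrite [RHS](_ : _ = \sum_(t | t != 0) chi s * addchar ((s + 1) * t)).
    by rewrite [RHS]big_mkcond; apply: eq_bigr => t _; case: eqP.
  by rewrite (bigD1 0) //= mulr0 addchar0 mulr1 addrAC subrr add0r.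
under eq_bigr do rewrite step2.
rewrite sumrB (sum_mchar u0 cu) subr0 (bigD1 (-1)) //= eqxx big1 ?addr0 //.
by move=> s /negPf ->; rewrite mulr0.
Qed.

(** Collect the terms with s + t = n. For n <> 0, scaling by n factors out chi(n)^2 and leaves the
    Jacobi sum; for n = 0 the sum of chi^2 vanishes because chi(u)^2 <> 1. *)
Lemma gauss_sum_sqr u : u != 0 -> chi u ^+ 2 != 1 ->
  gauss_sum chi ^+ 2 =
  jacobi_sum chi chi * gauss_sum (fun t => chi t ^+ 2).
Proof.
move=> u0 cu; rewrite expr2 /gauss_sum mulr_suml.
have -> : \sum_s chi s * addchar s * (\sum_t chi t * addchar t) =
    \sum_s \sum_n chi s * chi (n - s) * addchar n.
  apply: eq_bigr => s _; rewrite mulr_sumr.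
  rewrite [RHS](reindex_inj (addrI s)); apply: eq_bigr => t _.
  by rewrite [s + t]addrC addrK addcharD; ring.
rewrite exchange_big /= mulr_sumr; apply: eq_bigr => n _.
rewrite -mulr_suml mulrA; congr (_ * _).
have [->|n0] := eqVneq n 0.
  rewrite chi0 expr0n mulr0.
  have E s : chi s * chi (0 - s) = chi (-1) * chi s ^+ 2.
    by rewrite sub0r -[- s]mulN1r (chiM (-1)) expr2 mulrCA.
  under eq_bigr do rewrite E.
  rewrite -mulr_sumr.
  rewrite (sum_nontrivial_char (h := *%R u) (c := chi u ^+ 2)) ?mulr0 //.
    exact: mulfI.
  by move=> t; rewrite chiM exprMn.
rewrite (reindex_inj (mulfI n0)) /jacobi_sum mulr_suml.
apply: eq_bigr => t _.
have -> : n - n * t = n * (1 - t) by rewrite mulrBr mulr1.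
by rewrite !chiM; ring.
Qed.

(** In characteristic q the power q^j is additive. It fixes the values of chi and multiplies the
    argument of the additive character by q^j, a factor that reindexing moves into chi. *)
Lemma gauss_sum_Frobenius q j : q \in [pchar F] -> q%:R != 0 :> 'F_p ->
  (forall t, chi t ^+ (q ^ j) = chi t) ->
  gauss_sum chi ^+ (q ^ j) = (chi (q ^ j)%:R)^-1 * gauss_sum chi.
Proof.
move=> qF q0 chiq.
have qjN : [pchar F].-nat (q ^ j)%N by rewrite pnatX pnatE ?(pcharf_prime qF) ?qF.
have qj0 : (q ^ j)%:R != 0 :> 'F_p by rewrite natrX expf_neq0.
have -> : gauss_sum chi ^+ (q ^ j) = \sum_t (chi t * addchar t) ^+ (q ^ j).
  rewrite /gauss_sum; apply: (big_morph (fun x => x ^+ (q ^ j))).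
    by move=> x y; exact: exprDn_pchar.
  by rewrite expr0n expn_eq0 -leqn0 leqNgt prime_gt0 ?(pcharf_prime qF).
rewrite -(mcharV) /gauss_sum mulr_sumr.
rewrite [RHS](reindex_inj (mulfI qj0)); apply: eq_bigr => t _.
by rewrite exprMn chiq addcharX mulrA -chiM mulKf.
Qed.

End MultiplicativeCharacter.
End GaussSum.

(** * Prime fields and the Legendre symbol *)

(** Since n is invertible in K, X^n - 1 is separable, and among its n distinct roots there is one of
    exact order n. *)
Lemma closed_field_prim_root (K : closedFieldType) (n : nat) :
  n%:R != 0 :> K -> exists z : K, n.-primitive_root z.
Proof.
move=> nK; have n0 : (0 < n)%N by rewrite lt0n; apply: contraNneq nK => ->.
have [rs] := closed_field_poly_normal ('X^n - 1 : {poly K}).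
have /eqP -> : ('X^n - 1 : {poly K}) \is monic by rewrite monicXnsubC.
rewrite scale1r => Ers.
have /hasP[z _ zP] : has n.-primitive_root rs.
  apply: has_prim_root => //.
  - apply/allP => x xrs; rewrite /root_of_unity Ers.
    by rewrite root_prod_XsubC.
  - by rewrite -separable_prod_XsubC -Ers separable_Xn_sub_1.
  - by rewrite -ltnS -(size_prod_XsubC rs id) -Ers size_XnsubC.
by exists z.
Qed.

Definition Fpbar (q : nat) : countClosedFieldType :=
  projT1 (countable_algebraic_closure 'F_q).

Lemma pchar_Fpbar q : prime q -> q \in [pchar Fpbar q].
Proof.
move=> q_pr; have [f _] := projT2 (countable_algebraic_closure 'F_q).
exact: (rmorph_pchar f (pchar_Fp q_pr)).
Qed.

Section PrimeField.
Variable p : nat.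
Hypothesis p_pr : prime p.

Lemma Fp_expE (x : 'F_p) : x != 0 -> x ^+ p.-1 = 1.
Proof.
move=> x0; apply: (mulfI x0); have := expf_card x; rewrite card_Fp // => xp.
by rewrite mulr1 -exprS prednK ?prime_gt0.
Qed.

Lemma Fp_prim_root : exists g : 'F_p, p.-1.-primitive_root g.
Proof.
have p1 : (0 < p.-1)%N by rewrite -ltnS prednK ?prime_gt0 ?prime_gt1.
pose rs := [seq x <- enum 'F_p | x != 0].
have /hasP[z _ zP] : has p.-1.-primitive_root rs.
  apply: has_prim_root => //.
  - apply/allP => x; rewrite mem_filter => /andP[x0 _].
    by rewrite unity_rootE Fp_expE.
  - by rewrite filter_uniq ?enum_uniq.
  - rewrite size_filter.
    have := count_predC (predC1 0) (enum 'F_p); rewrite -cardE card_Fp //.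
    rewrite -[X in _ = X](prednK (prime_gt0 p_pr)).
    rewrite [X in (_ + X)%N](_ : _ = 1%N); last first.
      rewrite (eq_count (a2 := pred1 0)); last by move=> x /=; rewrite negbK.
      by rewrite count_uniq_mem ?enum_uniq // mem_enum.
    by rewrite addn1 => -[<-].
by exists z.
Qed.

Lemma Fp_unit_prim (g x : 'F_p) :
  p.-1.-primitive_root g -> x != 0 -> exists i, x = g ^+ i.
Proof.
by move=> gP /Fp_expE/(prim_rootP gP)[i ->]; exists i.
Qed.

Lemma Fp_nontrivial_power n : ~~ (p.-1 %| n)%N ->
  exists2 u : 'F_p, u != 0 & u ^+ n != 1.
Proof.
move=> pn; have [g gP] := Fp_prim_root; exists g.
  apply/eqP => g0; have := prim_expr_order gP; have := prime_gt1 p_pr.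
  by rewrite g0 expr0n; case: eqP => [|_ _ /eqP]; [lia | rewrite eq_sym oner_eq0].
by rewrite -(prim_order_dvd gP).
Qed.

Lemma Fp_int_eq0 (a : int) : (a%:~R == 0 :> 'F_p) = (p%:Z %| a)%Z.
Proof. by rewrite (dvdz_pcharf (pchar_Fp p_pr)). Qed.

Lemma Fp_int_eq (a b : int) : (a%:~R == b%:~R :> 'F_p) = (a == b %[mod p%:Z])%Z.
Proof. by rewrite eqz_mod_dvd -Fp_int_eq0 rmorphB subr_eq0. Qed.

Lemma Fp_intP (x : 'F_p) : exists a : 'I_p, x = (a%:Z)%:~R.
Proof.
have xp : (x < p)%N by have := ltn_ord x; rewrite [X in (_ < X)%N -> _]Fp_cast.
by exists (Ordinal xp); rewrite /= -pmulrn natr_Zp.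
Qed.

Lemma sum_Fp_pow m : (m < p.-1)%N -> \sum_(t : 'F_p) t ^+ m = 0.
Proof.
case: m => [|m] mp.
  by under eq_bigr do rewrite expr0; rewrite sumr_const card_Fp // pchar_Fp_0.
have [|u u0 um] := @Fp_nontrivial_power m.+1.
  by apply/negP => /(dvdn_leq (ltn0Sn m)); rewrite leqNgt mp.
apply: (sum_nontrivial_char (h := *%R u) (c := u ^+ m.+1)) => //.
  exact: mulfI.
by move=> t; rewrite exprMn.
Qed.

End PrimeField.

(** The condition [sgz a = a] says that a is -1, 0 or 1. Identities between symbols are proved in a
    field where 2 <> 0 and lifted back to the integers in this way. *)
Lemma sgz_intr_inj (F : fieldType) (a b : int) : 2%:R != 0 :> F ->
  sgz a = a -> sgz b = b -> a%:~R = b%:~R :> F -> a = b.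
Proof.
move=> F2 <- <-; have n1 : (-1 : F) != 1.
  by rewrite -subr_eq0 -opprD oppr_eq0.
case: (sgzP a) => _; case: (sgzP b) => _ // /eqP;
  rewrite ?rmorph0 ?rmorph1 ?rmorphN1 ?oppr_eq0 ?oner_eq0 ?(negPf n1) //;
  rewrite eq_sym ?oppr_eq0 ?oner_eq0 ?(negPf n1) //.
Qed.

Section Legendre.
Variable p : nat.
Hypotheses (p_pr : prime p) (p_odd : odd p).

Lemma legendre_Fp (a : int) :
  (legendre a p)%:~R = a%:~R ^+ p.-1./2 :> 'F_p.
Proof.
have p2 : (2 < p)%N by rewrite odd_prime_gt2.
have h0 : (0 < p.-1./2)%N by lia.
have hh : p.-1 = (p.-1./2 + p.-1./2)%N by lia.
rewrite /legendre -Fp_int_eq0 //.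
have [->|a0] := eqVneq; first by rewrite expr0n gtn_eqF.
have [g gP] := Fp_prim_root p_pr.
case: ifPn => [/existsP[x]|nex].
  rewrite -Fp_int_eq // rmorphXn /= => /eqP xa.
  have x0 : (x%:Z)%:~R != 0 :> 'F_p.
    by apply: contra_neq a0 => x0; rewrite -xa x0 expr0n.
  by rewrite -xa -exprM mul2n -addnn -hh Fp_expE.
have [i ai] := Fp_unit_prim p_pr gP a0.
have iodd : odd i.
  apply: contraNT nex => ie; apply/existsP.
  have [x gx] := Fp_intP p_pr (g ^+ i./2); exists x.
  by rewrite -Fp_int_eq // rmorphXn /= -gx ai -exprM muln2 even_halfK.
(* The half power of a generator squares to 1 without being 1, so it is -1; with i odd this is
   Euler's criterion for a nonsquare. *)
rewrite ai; have gh : g ^+ p.-1./2 = -1.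
  have : (g ^+ p.-1./2 - 1) * (g ^+ p.-1./2 + 1) = 0.
    by rewrite -subr_sqr expr1n -exprM muln2 -addnn -hh (prim_expr_order gP) subrr.
  move/eqP; rewrite mulf_eq0 subr_eq0 addr_eq0 -(prim_order_dvd gP).
  case/orP => [/dvdn_leq|/eqP //]; lia.
by rewrite exprAC gh -signr_odd iodd.
Qed.

Lemma legendre_sgz (a : int) : sgz (legendre a p) = legendre a p.
Proof. by rewrite /legendre; case: ifP => // _; case: ifP. Qed.

Lemma Fp_two : 2%:R != 0 :> 'F_p.
Proof.
rewrite -(dvdn_pcharf (pchar_Fp p_pr)).
by apply/negP => /(@dvdn_leq p 2 isT); rewrite leqNgt odd_prime_gt2.
Qed.

Lemma legendreM (a b : int) : legendre (a * b) p = legendre a p * legendre b p.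
Proof.
apply: (sgz_intr_inj Fp_two); rewrite ?sgzM ?legendre_sgz //.
by rewrite intrM !legendre_Fp intrM exprMn.
Qed.

Lemma legendre_mod (a b : int) : (a == b %[mod p%:Z])%Z ->
  legendre a p = legendre b p.
Proof.
rewrite -Fp_int_eq // => /eqP ab.
by apply: (sgz_intr_inj Fp_two); rewrite ?legendre_sgz // !legendre_Fp ab.
Qed.

Lemma legendre_eq0 (a : int) : (legendre a p == 0) = (p%:Z %| a)%Z.
Proof. by rewrite /legendre; case: ifP => // _; case: ifP. Qed.

Lemma legendre1 : legendre 1 p = 1.
Proof.
apply: (sgz_intr_inj Fp_two); rewrite ?legendre_sgz //.
by rewrite legendre_Fp rmorph1 expr1n.
Qed.

Lemma legendreX (a : int) n : legendre (a ^+ n) p = legendre a p ^+ n.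
Proof. by elim: n => [|n IH]; rewrite ?legendre1 // !exprS legendreM IH. Qed.

Lemma legendre_sqr (a : int) : ~~ (p%:Z %| a)%Z -> legendre a p ^+ 2 = 1.
Proof. by rewrite /legendre => /negPf ->; case: ifP. Qed.

Lemma legendreN1 : legendre (-1) p = (-1) ^+ p.-1./2.
Proof.
apply: (sgz_intr_inj Fp_two); rewrite ?legendre_sgz //.
  by rewrite -signr_odd; case: odd.
by rewrite legendre_Fp rmorphXn rmorphN1.
Qed.

End Legendre.

(** * Quadratic reciprocity *)

Lemma legendre_pchar (K : fieldType) q (a : int) : prime q -> odd q ->
  q \in [pchar K] -> (legendre a q)%:~R = a%:~R ^+ q.-1./2 :> K.
Proof.
move=> q_pr q_odd qK; apply/eqP; rewrite -subr_eq0 -rmorphXn -rmorphB /=.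
rewrite -(dvdz_pcharf qK) -Fp_int_eq0 // rmorphB rmorphXn /= subr_eq0.
by rewrite legendre_Fp.
Qed.

Lemma expr_odd (A : pzSemiRingType) (x : A) n : odd n ->
  x ^+ n = (x ^+ 2) ^+ n.-1./2 * x.
Proof. by move=> n_odd; rewrite -exprM -exprSr; congr (_ ^+ _); lia. Qed.

Section QuadraticReciprocity.
Variables (p q : nat).
Hypotheses (p_pr : prime p) (p_odd : odd p) (q_pr : prime q) (q_odd : odd q)
  (pq : p != q).
Let K := Fpbar q.

Let qK : q \in [pchar K]. Proof. exact: pchar_Fpbar. Qed.
Let pK : p%:R != 0 :> K.
Proof. by rewrite -(dvdn_pcharf qK) dvdn_prime2 // eq_sym. Qed.
Let K2 : 2%:R != 0 :> K.
Proof.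
rewrite -(dvdn_pcharf qK).
by apply/negP => /(@dvdn_leq q 2 isT); rewrite leqNgt odd_prime_gt2.
Qed.

Let chi (t : 'F_p) : K := (legendre (t : nat)%:Z p)%:~R.

Let FpE (t : 'F_p) : ((t : nat)%:Z)%:~R = t.
Proof. by rewrite -pmulrn natr_Zp. Qed.

Let chi_int (a : int) : chi a%:~R = (legendre a p)%:~R.
Proof.
congr (_ %:~R); apply: legendre_mod => //; rewrite -Fp_int_eq //.
by rewrite FpE.
Qed.

Let chiM : {morph chi : s t / s * t}.
Proof.
by move=> s t; rewrite -{1}(FpE s) -{1}(FpE t) -intrM chi_int legendreM // intrM.
Qed.

Let chi0 : chi 0 = 0.
Proof. by rewrite /chi /legendre dvdz0. Qed.

Let chi1 : chi 1 = 1.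
Proof. by rewrite -[1]/(1%:~R) chi_int legendre1. Qed.

Let chiV t : (chi t)^-1 = chi t.
Proof.
rewrite /chi; move: (legendre_sgz p (t : nat)%:Z); case: (sgzP (legendre _ _)) => _ <-.
- by rewrite invr0.
- by rewrite invr1.
- by rewrite rmorphN1 invrN1.
Qed.

Lemma quadratic_reciprocity :
  legendre q%:Z p = (-1) ^+ (p.-1./2 * q.-1./2) * legendre p%:Z q.
Proof.
have [z zP] := closed_field_prim_root pK.
have [|u u0 un] := @Fp_nontrivial_power p p_pr p.-1./2.
  apply/negP => /dvdn_leq; have := odd_prime_gt2 p_odd p_pr; lia.
have cu : chi u != 1.
  apply: contra_neq un => cu.
  have : legendre (u : nat)%:Z p = 1 by apply: (sgz_intr_inj K2); rewrite ?legendre_sgz.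
  by move/(congr1 (fun a : int => a%:~R : 'F_p)); rewrite legendre_Fp // FpE.
have qF : q%:R != 0 :> 'F_p by rewrite -(dvdn_pcharf (pchar_Fp p_pr)) dvdn_prime2.
set g := gauss_sum z chi.
have gg : g ^+ 2 = chi (-1) * p%:R.
  rewrite -(gauss_sum_inv p_pr zP chiM chi0 chi1 u0 cu) expr2; congr (_ * _).
  by apply: eq_bigr => t _; rewrite chiV.
have cN1 : chi (-1) = (-1) ^+ p.-1./2.
  by rewrite -[-1]/((-1)%:~R) chi_int legendreN1 // rmorphXn /= rmorphN1.
have g0 : g != 0.
  apply/eqP => g0; move/esym/eqP: gg; rewrite g0 expr0n mulf_eq0 (negPf pK) orbF.
  by rewrite cN1 signr_eq0.
have chiq t : chi t ^+ (q ^ 1) = chi t.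
  rewrite expn1 /chi; have := legendre_sgz p (t : nat)%:Z.
  case: (sgzP (legendre _ _)) => _ <-; rewrite ?expr0n ?expr1n //.
    by rewrite gtn_eqF ?prime_gt0.
  by rewrite rmorphN1 -signr_odd q_odd.
have := gauss_sum_Frobenius p_pr zP chiM chi0 chi1 qK qF chiq.
rewrite expn1 -/g chiV.
(* For odd q, g^q = (g^2)^((q - 1) / 2) g with g^2 = (-1 / p) p. Cancelling g leaves Euler's
   criterion for p modulo q. *)
rewrite expr_odd // gg => /(mulIf g0).
rewrite exprMn cN1 -exprM => H.
have Eq : (q%:R : 'F_p) = (q%:Z)%:~R by [].
have Ep : (p%:R : K) = (p%:Z)%:~R by [].
rewrite Eq Ep chi_int -legendre_pchar // in H.
apply: (sgz_intr_inj K2); rewrite ?sgzM ?legendre_sgz //.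
  by rewrite -signr_odd; case: odd.
by rewrite -H intrM rmorphXn /= rmorphN1.
Qed.

End QuadraticReciprocity.

(** * Eisenstein integers *)

Lemma eisP (x y : eis) : ere x = ere y -> eim x = eim y -> x = y.
Proof. by case: x => ? ?; case: y => ? ? /= -> ->. Qed.

Lemma ereD x y : ere (x + y) = ere x + ere y. Proof. by []. Qed.
Lemma eimD x y : eim (x + y) = eim x + eim y. Proof. by []. Qed.
Lemma ereN x : ere (- x) = - ere x. Proof. by []. Qed.
Lemma eimN x : eim (- x) = - eim x. Proof. by []. Qed.
Lemma ereM x y : ere (x * y) = ere x * ere y - eim x * eim y. Proof. by []. Qed.
Lemma eimM x y : eim (x * y) = ere x * eim y + eim x * ere y - eim x * eim y.
Proof. by []. Qed.

Definition eisE := (ereD, eimD, ereN, eimN, ereM, eimM).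

Lemma eis_natr n : n%:R = Eis n%:Z 0.
Proof. by rewrite -eis_intr -pmulrn. Qed.

Lemma econjM x y : econj (x * y) = econj x * econj y.
Proof. by apply: eisP; rewrite /econj ?eisE /= ?eisE; ring. Qed.

Lemma enormZ z : (enorm z)%:Z = ere z ^+ 2 - ere z * eim z + eim z ^+ 2.
Proof.
rewrite /enorm gez0_abs //; have := sqr_ge0 (2 * ere z - eim z).
have := sqr_ge0 (eim z); lra.
Qed.

Lemma enormM x y : enorm (x * y) = (enorm x * enorm y)%N.
Proof.
apply/eqP; rewrite -eqz_nat PoszM !enormZ !eisE; apply/eqP; ring.
Qed.

Lemma enorm1 : enorm 1 = 1%N. Proof. by []. Qed.

Lemma enormX x n : enorm (x ^+ n) = (enorm x ^ n)%N.
Proof. by elim: n => [|n IH] //; rewrite exprS expnS enormM IH. Qed.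

Lemma enorm_intr (a : int) : enorm a%:~R = (`|a| ^ 2)%N.
Proof.
rewrite eis_intr; have -> : enorm (Eis a 0) = `|(a ^+ 2 - a * 0 + 0 ^+ 2 : int)|%N by [].
by rewrite !mulr0 subr0 addr0 abszX.
Qed.

Lemma enorm_natr n : enorm n%:R = (n ^ 2)%N.
Proof. by rewrite -(enorm_intr n%:Z). Qed.

Lemma enorm_eq0 z : (enorm z == 0%N) = (z == 0).
Proof.
apply/eqP/eqP => [z0|-> //].
have := enormZ z; rewrite z0 => /esym nz.
have h1 : 3 * eim z ^+ 2 + (2 * ere z - eim z) ^+ 2 = 0 by lra.
have e2 := sqr_ge0 (eim z); have e1 := sqr_ge0 (2 * ere z - eim z).
have /eqP : eim z ^+ 2 = 0 by lia.
have /eqP : (2 * ere z - eim z) ^+ 2 = 0 by lia.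
rewrite !sqrf_eq0 => /eqP h2 /eqP h3; apply: eisP; rewrite //=; lia.
Qed.

(** The units are the elements of norm 1, inverted by conjugation. The integral domain structure is
    required by the vanishing of character sums with values in [eis]. *)
Definition eisunit : pred eis := fun z => enorm z == 1%N.
Definition eisinv (z : eis) : eis := if eisunit z then econj z else z.

Fact eis_mulVz : {in eisunit, left_inverse 1 eisinv *%R}.
Proof.
move=> z zu; have z1 : enorm z = 1%N := eqP zu.
by rewrite /eisinv ifT // mulrC -enormE z1.
Qed.

Fact eis_unitPl x y : y * x = 1 -> eisunit x.
Proof.
move/(congr1 enorm); rewrite enormM enorm1 => /eqP.
by rewrite muln_eq1 => /andP[].
Qed.

Fact eis_inv_out : {in [predC eisunit], eisinv =1 id}.
Proof. by move=> z /negPf zu; rewrite /eisinv -[eisunit z]/(z \in eisunit) zu. Qed.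

HB.instance Definition _ := GRing.ComNzRing_hasMulInverse.Build eis
  eis_mulVz eis_unitPl eis_inv_out.

Fact eis_idomain (x y : eis) : x * y = 0 -> (x == 0) || (y == 0).
Proof.
move=> xy; have : enorm (x * y) == 0%N by rewrite xy.
by rewrite enormM muln_eq0 !enorm_eq0.
Qed.

HB.instance Definition _ := GRing.ComUnitRing_isIntegral.Build eis eis_idomain.

Definition mu03 : seq eis := [:: 0; 1; omega; omega ^+ 2].

Lemma mu03M x y : x \in mu03 -> y \in mu03 -> x * y \in mu03.
Proof.
by rewrite !inE => /or4P[] /eqP -> /or4P[] /eqP ->.
Qed.

Lemma mu03X x n : x \in mu03 -> x ^+ n \in mu03.
Proof. by move=> xm; elim: n => // n IH; rewrite exprS mu03M. Qed.

Lemma mu03_cube x : x \in mu03 -> x != 0 -> x ^+ 3 = 1.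
Proof. by rewrite !inE => /or4P[] /eqP ->. Qed.

(** * Evaluation of Eisenstein integers at a cube root of unity *)

Section Evaluation.
Variables (F : comNzRingType) (w : F).

(** Depending on F and w this is reduction modulo a prime of Z[omega] or a complex embedding; it is
    a ring morphism once w^2 + w + 1 = 0. *)
Definition ev (z : eis) : F := (ere z)%:~R + (eim z)%:~R * w.

Lemma evD x y : ev (x + y) = ev x + ev y.
Proof. by rewrite /ev !eisE !rmorphD /=; ring. Qed.

Lemma evN x : ev (- x) = - ev x.
Proof. by rewrite /ev !eisE !rmorphN /=; ring. Qed.

Lemma evB x y : ev (x - y) = ev x - ev y.
Proof. by rewrite evD evN. Qed.

Lemma ev0 : ev 0 = 0. Proof. by rewrite /ev /= mul0r addr0. Qed.
Lemma ev1 : ev 1 = 1. Proof. by rewrite /ev /= mul0r addr0. Qed.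

Lemma ev_intr (a : int) : ev a%:~R = a%:~R.
Proof. by rewrite eis_intr /ev /= mul0r addr0. Qed.

Lemma ev_natr n : ev n%:R = n%:R.
Proof. by rewrite pmulrn ev_intr. Qed.

Lemma ev_omega : ev omega = w.
Proof. by rewrite /ev /= add0r mul1r. Qed.

Lemma ev_sum I (r : seq I) P (f : I -> eis) :
  ev (\sum_(i <- r | P i) f i) = \sum_(i <- r | P i) ev (f i).
Proof. by apply: big_morph; [exact: evD|exact: ev0]. Qed.

Hypothesis w_root : w ^+ 2 = - 1 - w.

Lemma evM x y : ev (x * y) = ev x * ev y.
Proof.
rewrite /ev !eisE !rmorphB !rmorphD !rmorphM /=.
have -> : forall a b c e : F, (a + b * w) * (c + e * w) =
  a * c + b * e * w ^+ 2 + (a * e + b * c) * w by move=> *; ring.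
by rewrite w_root; ring.
Qed.

Lemma evX x n : ev (x ^+ n) = ev x ^+ n.
Proof. by elim: n => [|n IH]; rewrite ?expr0 ?ev1 // !exprS evM IH. Qed.

Lemma ev_norm z : (enorm z)%:R = ev z * ev (econj z).
Proof. by rewrite -evM -enormE ev_natr. Qed.

Lemma ev_root3 : w ^+ 3 = 1.
Proof. by rewrite exprS w_root mulrBr mulrN1 -expr2 w_root; ring. Qed.

End Evaluation.

Section CubeRootLift.
Variables (F : fieldType) (w : F).
Hypotheses (w_root : w ^+ 2 = - 1 - w) (F3 : 3%:R != 0 :> F).

(* The inverse of ev on 0 and the cube roots of unity; any other u is sent to
   omega^2. *)
Definition lift3 (u : F) : eis :=
  if u == 0 then 0 else if u == 1 then 1 else if u == w then omega
  else omega ^+ 2.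

Lemma w_neq1 : w != 1.
Proof.
apply: contra_neq F3 => w1; have := w_root; rewrite w1 expr1n => /eqP.
by rewrite -subr_eq0 => /eqP <-; ring.
Qed.

Lemma w_neq0 : w != 0.
Proof.
apply: contra_eq_neq (ev_root3 w_root) => ->.
by rewrite expr0n /= eq_sym oner_neq0.
Qed.

Lemma lift3_mu03 u : lift3 u \in mu03.
Proof. by rewrite /lift3; do 3?case: ifP => //. Qed.

Lemma lift3K u : u = 0 \/ u ^+ 3 = 1 -> ev w (lift3 u) = u.
Proof.
rewrite /lift3; case: eqVneq => [-> _|u0]; first by rewrite ev0.
case: eqVneq => [-> _|u1]; first by rewrite ev1.
case: eqVneq => [-> _|uw]; first by rewrite ev_omega.
case=> [uz|u3]; first by rewrite uz eqxx in u0.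
rewrite evX // ev_omega w_root.
have : (u - 1) * (u - w) * (u - (-1 - w)) = 0.
  have -> : (u - 1) * (u - w) * (u - (-1 - w)) =
    (u ^+ 3 - 1) - (w ^+ 2 + 1 + w) * (u - 1) by ring.
  by rewrite u3 w_root; ring.
by move/eqP; rewrite !mulf_eq0 !subr_eq0 (negPf u1) (negPf uw) => /eqP.
Qed.

Lemma ev_lift3K c : c \in mu03 -> lift3 (ev w c) = c.
Proof.
have w1 := w_neq1; have w0 := w_neq0; rewrite /lift3.
rewrite !inE => /or4P[] /eqP ->; rewrite ?ev0 ?ev1 ?evX // ?ev_omega ?eqxx
  ?oner_eq0 ?(negPf w0) ?(negPf w1) //.
have w3 := ev_root3 w_root; rewrite sqrf_eq0 (negPf w0).
case: eqP => [w2|_]; first by move: w3 w1; rewrite exprSr w2 mul1r => ->; rewrite eqxx.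
case: eqP => // w2; move: w3 w1; rewrite exprSr w2 -expr2 w2 => ->.
by rewrite eqxx.
Qed.

Lemma lift3M u v : u = 0 \/ u ^+ 3 = 1 -> v = 0 \/ v ^+ 3 = 1 ->
  lift3 (u * v) = lift3 u * lift3 v.
Proof.
move=> u3 v3; rewrite -{1}(lift3K u3) -{1}(lift3K v3) -evM // ev_lift3K //.
by apply: mu03M; exact: lift3_mu03.
Qed.

Lemma lift3_eq0 u : (lift3 u == 0) = (u == 0).
Proof. by rewrite /lift3; do 3?case: ifP => //. Qed.

Lemma lift30 : lift3 0 = 0. Proof. by rewrite /lift3 eqxx. Qed.
Lemma lift31 : lift3 1 = 1. Proof. by rewrite /lift3 oner_eq0 eqxx. Qed.

End CubeRootLift.

(** * Cubic reciprocity for a rational prime *)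

(** Congruent to 2 modulo 3, as the condition modulo 9 forces; every element prime to 3 has exactly
    one such associate. *)
Definition primary (z : eis) : Prop := (3 %| ere z - 2)%Z /\ (3 %| eim z)%Z.

Lemma closed_cube_root (K : closedFieldType) : exists w : K, w ^+ 2 = - 1 - w.
Proof.
have [w Ew] := @solve_monicpoly K 2 (fun=> -1) isT; exists w.
by rewrite Ew big_ord_recl big_ord1 /= expr0 expr1 mulr1 mulN1r.
Qed.

Lemma ev_conj (F : comNzRingType) (w : F) z : ev (- 1 - w) z = ev w (econj z).
Proof. by rewrite /ev /econj /= rmorphB rmorphN /=; ring. Qed.

(** The six units are pairwise incongruent modulo 3. The norm equation bounds the coordinates of u,
    and the congruences decide among the remaining cases. *)
Lemma eunit_primary (u z : eis) : enorm u = 1%N -> primary z ->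
  (3 %| ere (u * z) - 2)%Z -> (3 %| eim (u * z))%Z -> u = 1.
Proof.
move=> u1 [z2 z0]; rewrite !eisE => h1 h2.
have := enormZ u; rewrite u1; case: u {u1} h1 h2 => x y /=.
case: z z2 z0 => a b /= z2 z0 h1 h2 N.
have hy3 : 3 * y ^+ 2 <= 4 by have := sqr_ge0 (2 * x - y); lra.
have hy : y ^+ 2 <= 1 by lia.
have y_le1 : y <= 1 by nia.
have y_geN1 : -1 <= y by nia.
have [y0|[y1|y1]] : y = 0 \/ (y = 1 \/ y = -1) by lia.
- rewrite y0 in N h1 h2 *.
  have /eqP : (x - 1) * (x + 1) = 0 by lra.
  by rewrite mulf_eq0 => /orP[] /eqP hx; [congr Eis|exfalso]; lia.
- exfalso; rewrite y1 in N h1 h2; have /eqP : x * (x - 1) = 0 by lra.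
  rewrite mulf_eq0 => /orP[] /eqP hx.
    by rewrite hx in h2; lia.
  by have hx' : x = 1; [lia | rewrite hx' in h2; lia].
- exfalso; rewrite y1 in N h1 h2; have /eqP : x * (x + 1) = 0 by lra.
  rewrite mulf_eq0 => /orP[] /eqP hx.
    by rewrite hx in h2; lia.
  by have hx' : x = -1; [lia | rewrite hx' in h2; lia].
Qed.

(** The left side is (u - 1)(v - 1); both factors are multiples of 1 - omega, and (1 - omega)^2 = -3
    omega. *)
Lemma mu03_mulN1 u v : u \in mu03 -> v \in mu03 -> u != 0 -> v != 0 ->
  exists c, u * v - (u + v - 1) = 3%:R * c.
Proof.
rewrite !inE => /or4P[] /eqP -> /or4P[] /eqP -> // _ _.
- by exists 0.
- by exists 0.
- by exists 0.
- by exists 0.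
- by exists (- omega).
- by exists 1.
- by exists 0.
- by exists 1.
- by exists (- omega ^+ 2).
Qed.

Lemma enorm_primary z : primary z -> (enorm z %% 3 = 1)%N.
Proof.
have := enormZ z; case: z => a b /= h [/= /dvdzP[x hx] /dvdzP[y hy]].
have ha : a = x * 3 + 2 by lia.
move: h; rewrite ha hy => h.
have {}h : (enorm (Eis (x * 3 + 2) (y * 3)))%:Z =
    1 + 3 * (3 * x ^+ 2 + 4 * x + 1 - (x * 3 + 2) * y + 3 * y ^+ 2).
  by rewrite h; ring.
by move: (enorm _) (3 * x ^+ 2 + _ + _ - _ + _) h => n m; lia.
Qed.

Section CubicReciprocity.
Variable pi : eis.
Let p := enorm pi.
Hypotheses (p_pr : prime p) (pi_primary : primary pi).

Let n := (p.-1 %/ 3)%N.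
Let p3n : p = (3 * n).+1.
Proof. by have := enorm_primary pi_primary; rewrite -/p /n; lia. Qed.
Let n0 : (0 < n)%N.
Proof. by have := prime_gt1 p_pr; rewrite {1}p3n; lia. Qed.

Let a := ere pi.
Let b := eim pi.
Let Ep : p%:Z = a ^+ 2 - a * b + b ^+ 2. Proof. exact: enormZ. Qed.

Let Fp3 : 3%:R != 0 :> 'F_p.
Proof.
rewrite -(dvdn_pcharf (pchar_Fp p_pr)) dvdn_prime2 //.
by apply/negP => /eqP p3; have := enorm_primary pi_primary; rewrite -/p p3.
Qed.

Let b0 : b%:~R != 0 :> 'F_p.
Proof.
rewrite Fp_int_eq0 //; apply/negP => pb.
(* If p divided b it would also divide a, and then p = a^2 - a b + b^2 would be a multiple of
   p^2. *)
have pa : (p%:Z %| a ^+ 2)%Z.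
  have -> : a ^+ 2 = p%:Z + b * (a - b) by rewrite Ep; ring.
  by rewrite rpredD ?dvdzz // dvdz_mulr.
have {}pa : (p%:Z %| a)%Z.
  by move: pa; rewrite !dvdzE /= abszX Euclid_dvdX // andbT.
case/dvdzP: pa => x Ea; case/dvdzP: pb => y Eb.
have : (p%:Z %| 1)%Z.
  apply/dvdzP; exists (x ^+ 2 - x * y + y ^+ 2).
  apply: (@mulIf _ p%:Z); first by rewrite eqz_nat -lt0n prime_gt0.
  by rewrite mul1r {1}Ep Ea Eb; ring.
by rewrite dvdzE dvdn1 => /eqP p1; move: p_pr; rewrite -[p]/(`|p%:Z|)%N p1.
Qed.

(* The image of omega under the residue map modulo pi. *)
Definition res_omega : 'F_p := - ((ere pi)%:~R / (eim pi)%:~R).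
Let w0 := res_omega.

Lemma res_omega_root : w0 ^+ 2 = - 1 - w0.
Proof.
have : (a%:~R : 'F_p) ^+ 2 - a%:~R * b%:~R + b%:~R ^+ 2 = 0.
  rewrite -!rmorphXn -rmorphM -rmorphB -rmorphD /= -Ep.
  by apply/eqP; rewrite Fp_int_eq0.
rewrite /w0 /res_omega -/a -/b => h; apply/eqP; rewrite -subr_eq0; apply/eqP.
have -> : (- (a%:~R / b%:~R)) ^+ 2 - (-1 - - (a%:~R / b%:~R)) =
   ((a%:~R : 'F_p) ^+ 2 - a%:~R * b%:~R + b%:~R ^+ 2) / b%:~R ^+ 2 by field.
by rewrite h mul0r.
Qed.

Let wr := res_omega_root.

Lemma ev_res_pi : ev w0 pi = 0.
Proof.
rewrite /ev /w0 /res_omega -/a -/b mulrN mulrCA divff // mulr1 subrr //.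
Qed.

(** The quotient is z conj(pi) / p; [d2] and [d1] state that p divides the two coordinates of z
    conj(pi). *)
Lemma ev_res_eq0 z : ev w0 z = 0 <-> edvd pi z.
Proof.
split=> [|[q ->]]; last by rewrite evM // ev_res_pi mulr0.
rewrite /ev /w0 /res_omega -/a -/b => h.
have h1 : ((ere z)%:~R : 'F_p) * b%:~R = (eim z)%:~R * a%:~R.
  move/eqP: h; rewrite mulrN subr_eq0 => /eqP ->.
  by rewrite mulrA mulfVK.
have d1 : (p%:Z %| eim z * a - ere z * b)%Z.
  by rewrite -Fp_int_eq0 // rmorphB !rmorphM /= h1 subrr.
have d2 : (p%:Z %| ere z * (a - b) + eim z * b)%Z.
  rewrite -Fp_int_eq0 // -(inj_eq (mulfI b0)) mulr0 -rmorphM /= .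
  have -> : b * (ere z * (a - b) + eim z * b) =
    (ere z * b) * (a - b) + eim z * b ^+ 2 by ring.
  rewrite rmorphD rmorphM /= [(ere z * b)%:~R]rmorphM /= h1 -rmorphM -rmorphM -rmorphD /=.
  have -> : eim z * a * (a - b) + eim z * b ^+ 2 = eim z * p%:Z by rewrite Ep; ring.
  by rewrite Fp_int_eq0 // dvdz_mull.
case/dvdzP: d1 => y hy; case/dvdzP: d2 => x hx.
exists (Eis x y); have p0 : (p%:R : eis) != 0.
  by rewrite -enorm_eq0 enorm_natr -lt0n expn_gt0 prime_gt0.
apply: (mulIf (x := econj pi)).
  apply: contra_neq p0 => cp; by rewrite enormE cp mulr0.
rewrite -mulrA -enormE -/p eis_natr; apply: eisP; rewrite !eisE /= -/a -/b.
  by rewrite mulr0 subr0 -hx; ring.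
by rewrite !mulr0 add0r subr0 -hy; ring.
Qed.

Lemma eeqmod_res x y : eeqmod pi x y <-> ev w0 x = ev w0 y.
Proof.
rewrite /eeqmod -ev_res_eq0 evB; split => [/eqP|->]; last by rewrite subrr.
by rewrite subr_eq0 => /eqP.
Qed.

Lemma cubic_primeE z : cubic_prime z pi = lift3 w0 (ev w0 z ^+ n).
Proof.
rewrite /cubic_prime /lift3 -/p -/n -evX //.
have E c : `[< eeqmod pi (z ^+ n) c >] = (ev w0 (z ^+ n) == ev w0 c).
  by apply/asboolP/eqP; rewrite eeqmod_res.
by rewrite !E ev0 ev1 ev_omega.
Qed.

Definition cubic_char (t : 'F_p) : eis := lift3 w0 (t ^+ n).
Let chi := cubic_char.

Lemma Fp_pow_mu3 (t : 'F_p) : t ^+ n = 0 \/ (t ^+ n) ^+ 3 = 1.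
Proof.
have [->|t0] := eqVneq t 0; first by left; rewrite expr0n gtn_eqF.
by right; rewrite -exprM mulnC -[(3 * n)%N]/((3 * n).+1.-1) -p3n Fp_expE.
Qed.

Lemma cubic_charM : {morph chi : s t / s * t}.
Proof. by move=> s t; rewrite /chi /cubic_char exprMn lift3M //; exact: Fp_pow_mu3. Qed.

Lemma cubic_char0 : chi 0 = 0.
Proof. by rewrite /chi /cubic_char expr0n gtn_eqF // lift30. Qed.

Lemma cubic_char1 : chi 1 = 1.
Proof. by rewrite /chi /cubic_char expr1n lift31. Qed.

Lemma cubic_char_mu03 t : chi t \in mu03. Proof. exact: lift3_mu03. Qed.

Lemma cubic_char_eq0 t : (chi t == 0) = (t == 0).
Proof. by rewrite lift3_eq0 expf_eq0 n0. Qed.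

Lemma cubic_char_cube t : t != 0 -> chi t ^+ 3 = 1.
Proof.
by move=> t0; apply: mu03_cube; rewrite ?cubic_char_mu03 ?cubic_char_eq0.
Qed.

Lemma ev_cubic_char t : ev w0 (chi t) = t ^+ n.
Proof. by rewrite lift3K //; exact: Fp_pow_mu3. Qed.

(** The value has order dividing 3, and also dividing 2 because (-1)^2 = 1. *)
Lemma cubic_charN1 : chi (-1) = 1.
Proof.
have c3 : chi (-1) ^+ 3 = 1 by rewrite cubic_char_cube // oppr_eq0 oner_eq0.
have c2 : chi (-1) ^+ 2 = 1 by rewrite expr2 -cubic_charM mulrNN mulr1 cubic_char1.
by rewrite -[LHS]mul1r -[X in X * _]c2 -exprSr.
Qed.

Lemma cubic_char_nontrivial : exists2 u, u != 0 & chi u != 1.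
Proof.
have [|u u0 un] := @Fp_nontrivial_power p p_pr n.
  apply/negP => /(dvdn_leq n0); rewrite p3n /=; lia.
exists u => //; apply: contra_neq un => /(congr1 (ev w0)).
by rewrite ev_cubic_char ev1.
Qed.

Lemma sum_cubic_char : \sum_t chi t = 0.
Proof.
have [u u0 cu] := cubic_char_nontrivial.
apply: (sum_nontrivial_char (h := *%R u) (c := chi u)) => //.
  exact: mulfI.
by move=> t; rewrite cubic_charM.
Qed.

Definition cubic_jacobi_sum : eis := \sum_t chi t * chi (1 - t).
Let J := cubic_jacobi_sum.

(* Modulo pi, J is the sum of the t^n (1 - t)^n with 2n < p - 1. *)
Lemma dvd_cubic_jacobi_sum : edvd pi J.
Proof.
apply/ev_res_eq0; rewrite /J /cubic_jacobi_sum ev_sum.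
under eq_bigr do rewrite evM // !ev_cubic_char exprDn mulr_sumr.
rewrite exchange_big /= big1 // => i _.
have E t : t ^+ n * (1 ^+ (n - i) * (- t) ^+ i *+ 'C(n, i)) =
    (-1) ^+ i * 'C(n, i)%:R * t ^+ (n + i) :> 'F_p.
  by rewrite expr1n mul1r -mulr_natl exprNn exprD; ring.
under eq_bigr do rewrite E.
rewrite -mulr_sumr sum_Fp_pow ?mulr0 // p3n /=.
have := ltn_ord i; lia.
Qed.

(* For cube roots of unity u and v, uv = u + v - 1 modulo 3. *)
Lemma cubic_jacobi_sum_mod3 : exists c, J = - p%:R + 3%:R * c.
Proof.
suff [c Ec] : exists c, \sum_t (chi t * chi (1 - t) - (chi t + chi (1 - t) - 1)) = 3%:R * c.
  exists c; move: Ec; rewrite sumrB => /eqP.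
  rewrite subr_eq /J /cubic_jacobi_sum => /eqP ->.
  rewrite sumrB big_split /= sum_cubic_char.
  have -> : \sum_i chi (1 - i) = \sum_i chi i.
    rewrite [RHS](reindex_inj (h := fun t => 1 - t)) //.
    by move=> s t /addrI/oppr_inj.
  by rewrite sum_cubic_char sumr_const card_Fp // addr0 sub0r addrC.
apply: (big_ind (fun x : eis => exists c, x = 3%:R * c)).
- by exists 0; rewrite mulr0.
- by move=> _ _ [c ->] [d ->]; exists (c + d); rewrite mulrDr.
move=> t _; have [->|t0] := eqVneq t 0.
  by exists 0; rewrite subr0 cubic_char0 cubic_char1.
have [->|t1] := eqVneq t 1.
  by exists 0; rewrite subrr cubic_char0 cubic_char1.
apply: mu03_mulN1; rewrite ?cubic_char_mu03 ?cubic_char_eq0 //.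
by rewrite subr_eq0 eq_sym.
Qed.

(** * The cubic Gauss sum in a field where 3 is invertible *)

Section GaussSumInField.
Variables (F : fieldType) (w z : F).
Hypotheses (w_root : w ^+ 2 = - 1 - w) (F3 : 3%:R != 0 :> F)
  (zP : p.-primitive_root z).
Let chiF t := ev w (chi t).

Let chiFM : {morph chiF : s t / s * t}.
Proof. by move=> s t; rewrite /chiF cubic_charM evM. Qed.
Let chiF0 : chiF 0 = 0. Proof. by rewrite /chiF cubic_char0 ev0. Qed.
Let chiF1 : chiF 1 = 1. Proof. by rewrite /chiF cubic_char1 ev1. Qed.

Let chiF3 t : t != 0 -> chiF t ^+ 3 = 1.
Proof. by move=> t0; rewrite /chiF -evX // cubic_char_cube // ev1. Qed.

Let chiFV t : (chiF t)^-1 = chiF t ^+ 2.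
Proof.
have [->|t0] := eqVneq t 0; first by rewrite chiF0 invr0 expr0n.
have c3 := chiF3 t0; have c0 : chiF t != 0.
  by apply: contra_eq_neq c3 => ->; rewrite expr0n /= eq_sym oner_neq0.
by apply: (mulfI c0); rewrite -exprS c3 mulfV.
Qed.

Let nontriv : exists2 u, u != 0 & chiF u != 1.
Proof.
have [u u0 cu] := cubic_char_nontrivial; exists u => //.
apply: contra_neq cu => cu.
by rewrite -[LHS](ev_lift3K w_root F3) ?cubic_char_mu03 // [ev _ _]cu lift31.
Qed.

Let g := gauss_sum z chiF.

Lemma gauss_sum_cubic_inv : g * gauss_sum z (fun t => (chiF t)^-1) = p%:R.
Proof.
have [u u0 cu] := nontriv.
rewrite (gauss_sum_inv p_pr zP chiFM chiF0 chiF1 u0 cu).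
by rewrite /chiF cubic_charN1 ev1 mul1r.
Qed.

(** Here g^2 is J times the Gauss sum of chi^2, which is the inverse character, so a further factor
    g gives J p. The field is arbitrary because the identity serves over [algC] for the norm of J
    and over [Fpbar q] for reciprocity. *)
Lemma gauss_sum_cubic_cube : g ^+ 3 = ev w J * p%:R.
Proof.
have [u u0 cu] := nontriv.
have cu2 : chiF u ^+ 2 != 1.
  apply: contra_neq cu => cu2.
  by rewrite -[LHS]mul1r -[X in X * _]cu2 -exprSr chiF3.
rewrite exprSr (gauss_sum_sqr p_pr zP chiFM chiF0 u0 cu2) -mulrA.
rewrite -gauss_sum_cubic_inv [g * gauss_sum _ (fun t => _^-1)]mulrC; congr (_ * _).
  by rewrite /J /cubic_jacobi_sum ev_sum; apply: eq_bigr => t _; rewrite evM.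
by congr (_ * _); apply: eq_bigr => t _; rewrite chiFV.
Qed.

End GaussSumInField.
(** The evaluations at w and at its conjugate -1 - w give inverse characters, with Gauss sums g and
    g' such that g g' = p. Cubing gives N(J) p^2 = p^3. *)
Lemma enorm_cubic_jacobi_sum : enorm J = p.
Proof.
have [w w_root] := closed_cube_root algC.
have w'_root : (- 1 - w) ^+ 2 = - 1 - (- 1 - w).
  have -> : (- 1 - w) ^+ 2 = 1 + 2 * w + w ^+ 2 by ring.
  by rewrite w_root; ring.
have [z zP] := C_prim_root_exists (prime_gt0 p_pr).
have C3 : 3%:R != 0 :> algC by rewrite pnatr_eq0.
have p0 : p%:R != 0 :> algC by rewrite pnatr_eq0 -lt0n prime_gt0.
have E1 := gauss_sum_cubic_cube w_root C3 zP.
have := gauss_sum_cubic_cube w'_root C3 zP.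
rewrite (_ : gauss_sum z (fun t => ev (-1 - w) (chi t)) =
             gauss_sum z (fun t => (ev w (chi t))^-1)); last first.
  apply: eq_bigr => t _; congr (_ * _); rewrite ev_conj.
  have [->|c0] := eqVneq (chi t) 0; first by rewrite [econj 0](_ : _ = 0) // ev0 invr0.
  have n1 : enorm (chi t) = 1%N.
    by move: (cubic_char_mu03 t) c0; rewrite !inE => /or4P[] /eqP ->.
  have /esym := ev_norm w_root (chi t); rewrite n1 => h.
  have e0 : ev w (chi t) != 0.
    by apply: contra_eq_neq h => ->; rewrite mul0r eq_sym oner_neq0.
  by apply: (mulfI e0); rewrite h mulfV.
rewrite ev_conj => E2; have := gauss_sum_cubic_inv w_root C3 zP.
move/(congr1 (fun x => x ^+ 3)); rewrite exprMn E1 E2.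
rewrite mulrACA -ev_norm // => E3; apply/eqP; rewrite -(eqr_nat algC).
by apply/eqP/(mulIf p0)/(mulIf p0); rewrite -!mulrA E3 -/p; ring.
Qed.

(** Divisibility and equality of norms leave a unit factor. As J is -p modulo 3 and p is 1 modulo 3,
    J is primary too, and the unit is 1. *)
Lemma cubic_jacobi_sumE : J = pi.
Proof.
have [u Ju] := dvd_cubic_jacobi_sum.
have u1 : enorm u = 1%N.
  have := enorm_cubic_jacobi_sum; rewrite Ju enormM -/p => /eqP.
  by rewrite -[X in _ == X]mul1n eqn_pmul2r ?prime_gt0 // => /eqP.
have [c Jc] := cubic_jacobi_sum_mod3; have p3 := enorm_primary pi_primary; rewrite -/p in p3.
rewrite Ju (eunit_primary u1 pi_primary) ?mul1r // -Ju Jc !eis_natr !eisE /=; lia.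
Qed.

(** With N = (q^2 - 1) / 3, the power g^(q^2) equals (g^3)^N g = (pi p)^N g, and by Frobenius it
    equals chi(q^2)^-1 g = chi(q) g. *)
Lemma cubic_prime_reciprocity q : prime q -> q != 3%N -> q != p ->
  forall w : Fpbar q, w ^+ 2 = - 1 - w ->
  cubic_prime q%:R pi =
  lift3 w ((ev w pi * (ev w pi * ev w (econj pi))) ^+ ((q ^ 2).-1 %/ 3)).
Proof.
move=> q_pr q3 qp w w_root; have qK := pchar_Fpbar q_pr.
have K3 : 3%:R != 0 :> Fpbar q by rewrite -(dvdn_pcharf qK) dvdn_prime2.
have pK : p%:R != 0 :> Fpbar q by rewrite -(dvdn_pcharf qK) dvdn_prime2.
have qF : q%:R != 0 :> 'F_p.
  by rewrite -(dvdn_pcharf (pchar_Fp p_pr)) dvdn_prime2 // eq_sym.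
have [z zP] := closed_field_prim_root pK.
have q2 : (q ^ 2 = (3 * ((q ^ 2).-1 %/ 3)).+1)%N.
  have : (q %% 3 != 0)%N by rewrite -/(3 %| q)%N dvdn_prime2 // eq_sym.
  rewrite -mulnn; have := divn_eq q 3; set m := (q %/ 3)%N.
  have : (q %% 3 < 3)%N by rewrite ltn_mod.
  by case: (q %% 3)%N => [|[|[|//]]] // _ -> _; nia.
rewrite -ev_norm // -/p; set N := (_ %/ 3)%N in q2 *.
pose chiF t := ev w (chi t).
have chiFM : {morph chiF : s t / s * t}.
  by move=> s t; rewrite /chiF cubic_charM evM.
have chiF0 : chiF 0 = 0 by rewrite /chiF cubic_char0 ev0.
have chiF1 : chiF 1 = 1 by rewrite /chiF cubic_char1 ev1.
have chiFq t : chiF t ^+ (q ^ 2) = chiF t.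
  have [->|t0] := eqVneq t 0; first by rewrite chiF0 q2 expr0n.
  by rewrite q2 exprS exprM -evX // cubic_char_cube // ev1 expr1n mulr1.
have := gauss_sum_Frobenius p_pr zP chiFM chiF0 chiF1 qK qF chiFq.
have g3 := gauss_sum_cubic_cube w_root K3 zP.
rewrite {1}q2 exprSr exprM g3 cubic_jacobi_sumE => /(mulIf _) ->; last first.
  apply/eqP => g0; move: (gauss_sum_cubic_inv w_root K3 zP).
  by rewrite g0 mul0r => /esym/eqP; rewrite (negPf pK).
rewrite cubic_primeE ev_natr.
have -> : chiF (q ^ 2)%:R = (chiF q%:R)^-1.
  have c3 : chiF q%:R ^+ 3 = 1 by rewrite /chiF -evX // cubic_char_cube // ev1.
  have c0 : chiF q%:R != 0.
    by apply: contra_eq_neq c3 => ->; rewrite expr0n /= eq_sym oner_neq0.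
  by apply: (mulfI c0); rewrite natrX (mcharX chiFM chiF1) -exprS c3 mulfV.
by rewrite invrK ev_lift3K // cubic_char_mu03.
Qed.

End CubicReciprocity.

(** * Local character sums *)

Definition Fpbar_omega (q : nat) : Fpbar q :=
  sval (cid (closed_cube_root (Fpbar q))).

Lemma Fpbar_omega_root q : Fpbar_omega q ^+ 2 = - 1 - Fpbar_omega q.
Proof. by rewrite /Fpbar_omega; case: cid. Qed.

(* By cubic reciprocity this is (q / z)_3 for a primary z of prime norm; using
   N(z) z and the exponent (q^2 - 1) / 3 covers inert and split q uniformly. *)
Definition cubic_dual (q : nat) (z : eis) : eis :=
  let w := Fpbar_omega q in
  lift3 w ((ev w z * (ev w z * ev w (econj z))) ^+ ((q ^ 2).-1 %/ 3)).

Definition sqrtm3 : eis := Eis 1 2.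
(* r + B sqrt(-3): twice the element of trace r with omega-coordinate B. *)
Definition lattice_point (r B : int) : eis := Eis (r + B) (2 * B).

Lemma enorm_lattice_point r B :
  (enorm (lattice_point r B))%:Z = r ^+ 2 + 3 * B ^+ 2.
Proof. by rewrite enormZ /=; ring. Qed.

Lemma third_sqr_split q m : q = (3 * m).+1 -> ((q ^ 2).-1 %/ 3 = m * q.+1)%N.
Proof.
by move=> ->; rewrite -mulnn [X in (X %/ _)%N](_ : _ = (m * (3 * m).+2) * 3)%N ?mulnK //; nia.
Qed.

Lemma third_sqr_inert q : (q %% 3 = 2)%N ->
  ((q ^ 2).-1 %/ 3 = q.-1 * (q.+1 %/ 3))%N.
Proof.
move=> q2; have [k ->] : exists k, (q = 3 * k + 2)%N by exists (q %/ 3)%N; lia.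
have -> : ((3 * k + 2).+1 %/ 3 = k.+1)%N by lia.
by rewrite -mulnn [X in (X %/ _)%N](_ : _ = ((3 * k + 2).-1 * k.+1) * 3)%N ?mulnK //; nia.
Qed.

Section LocalSums.
Variable q : nat.
Hypotheses (q_pr : prime q) (q_odd : odd q) (q3 : q != 3%N).
Let K := Fpbar q.
Let w := Fpbar_omega q.
Let wr : w ^+ 2 = - 1 - w := Fpbar_omega_root q.
Let n := ((q ^ 2).-1 %/ 3)%N.

Let qK : q \in [pchar K]. Proof. exact: pchar_Fpbar. Qed.
Let K3 : 3%:R != 0 :> K.
Proof. by rewrite -(dvdn_pcharf qK) dvdn_prime2. Qed.
Let q3n : (q ^ 2 = (3 * n).+1)%N.
Proof.
have : (q %% 3 != 0)%N by rewrite -/(3 %| q)%N dvdn_prime2 // eq_sym.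
rewrite /n -mulnn; have := divn_eq q 3; set m := (q %/ 3)%N.
have : (q %% 3 < 3)%N by rewrite ltn_mod.
by case: (q %% 3)%N => [|[|[|//]]] // _ -> _; nia.
Qed.
Let n0 : (0 < n)%N.
Proof. by have := prime_gt1 q_pr; move: q3n; rewrite -mulnn; nia. Qed.

Lemma Fpbar_int_eq0 (a : int) : (a%:~R == 0 :> K) = (q%:Z %| a)%Z.
Proof. by rewrite (dvdz_pcharf qK). Qed.

Lemma Fp_Fpbar (a b : int) : (a%:~R == b%:~R :> 'F_q) = (a%:~R == b%:~R :> K).
Proof.
by rewrite -subr_eq0 -rmorphB -[RHS]subr_eq0 -rmorphB /= Fpbar_int_eq0 Fp_int_eq0.
Qed.

Lemma Fpbar_int_Frobenius (a : int) : (a%:~R : K) ^+ q = a%:~R.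
Proof. by rewrite -(pFrobenius_autE qK) rmorph_int. Qed.

Lemma Fpbar_int_expE (a : int) : a%:~R != 0 :> K -> (a%:~R : K) ^+ q.-1 = 1.
Proof.
move=> a0; apply: (mulfI a0).
by rewrite -exprS prednK ?prime_gt0 // Fpbar_int_Frobenius mulr1.
Qed.

Lemma ev_Frobenius z : ev w z ^+ q = (ere z)%:~R + (eim z)%:~R * w ^+ q.
Proof.
rewrite -(pFrobenius_autE qK) rmorphD rmorphM /= !rmorph_int.
by rewrite pFrobenius_autE.
Qed.

(** The values of [ev] lie in the field with q^2 elements: Frobenius fixes integers, and w^(q^2) = w
    because q^2 is 1 modulo 3. *)
Lemma ev_Frobenius2 z : ev w z ^+ (q ^ 2) = ev w z.
Proof.
rewrite -mulnn exprM ev_Frobenius -(pFrobenius_autE qK) rmorphD rmorphM /=.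
rewrite !rmorph_int pFrobenius_autE -exprM mulnn q3n exprS exprM ev_root3 //.
by rewrite expr1n mulr1.
Qed.

Lemma enorm_Fpbar z : ((enorm z)%:Z)%:~R = ev w z * ev w (econj z) :> K.
Proof. by rewrite -pmulrn (ev_norm wr). Qed.

Let base z := (ev w z * (ev w z * ev w (econj z))) ^+ n.

Let base_eq0 z : (base z == 0) = (q %| enorm z)%N.
Proof.
rewrite (dvdn_pcharf qK) (ev_norm wr) expf_eq0 n0 /= !mulf_eq0.
by case: (ev w z == 0).
Qed.

Let base_mu3 z : base z = 0 \/ base z ^+ 3 = 1.
Proof.
have [/eqP|] := boolP (base z == 0); first by left.
rewrite /base expf_eq0 n0 /= => b0; right; rewrite -exprM mulnC.
apply: (mulfI b0); rewrite -exprS -q3n mulr1 !exprMn.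
by rewrite !ev_Frobenius2.
Qed.

Lemma cubic_dualM x y : cubic_dual q (x * y) = cubic_dual q x * cubic_dual q y.
Proof.
rewrite -(lift3M wr K3 (base_mu3 x) (base_mu3 y)); congr lift3.
by rewrite /base -exprMn econjM !evM //; congr (_ ^+ _); ring.
Qed.

Lemma cubic_dual_mu03 x : cubic_dual q x \in mu03.
Proof. exact: lift3_mu03. Qed.

Lemma cubic_dual_eq0 z : (cubic_dual q z == 0) = (q %| enorm z)%N.
Proof. by rewrite lift3_eq0 base_eq0. Qed.

Lemma cubic_dual_eq1 z : (cubic_dual q z == 1) = (base z == 1).
Proof.
apply/eqP/eqP => [z1|b1]; last by rewrite /cubic_dual -/w -/n [X in lift3 w X]b1 lift31.
by rewrite -(lift3K wr (base_mu3 z)) [lift3 _ _]z1 ev1.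
Qed.

(** At an integer a the base of the power is a^3, and 3 n = (q - 1)(q + 1). *)
Lemma cubic_dual_int (a : int) : ~~ (q%:Z %| a)%Z -> cubic_dual q a%:~R = 1.
Proof.
rewrite -Fpbar_int_eq0 => a0; apply/eqP; rewrite cubic_dual_eq1 /base.
have -> : econj a%:~R = a%:~R by rewrite eis_intr; apply: eisP; rewrite /= ?subr0.
rewrite !ev_intr -expr2 -exprS -exprM.
have -> : (3 * n = q.-1 * q.+1)%N.
  by move: q3n (prime_gt0 q_pr); case: (q) => // m; rewrite -mulnn /=; nia.
by rewrite exprM Fpbar_int_expE // expr1n.
Qed.

Lemma cubic_dual_congr x y :
  (ere x)%:~R = (ere y)%:~R :> 'F_q -> (eim x)%:~R = (eim y)%:~R :> 'F_q ->
  cubic_dual q x = cubic_dual q y.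
Proof.
move=> /eqP hre /eqP him.
have hx : ev w x = ev w y.
  by move: hre him; rewrite !Fp_Fpbar /ev => /eqP -> /eqP ->.
have hc : ev w (econj x) = ev w (econj y).
  by move: hre him; rewrite !Fp_Fpbar /ev /econj /= !rmorphB !rmorphN /= => /eqP -> /eqP ->.
by rewrite /cubic_dual -/w hx hc.
Qed.

Definition legendre_norm (z : eis) : int := legendre (enorm z)%:Z q.

Lemma legendre_normM x y : legendre_norm (x * y) = legendre_norm x * legendre_norm y.
Proof. by rewrite /legendre_norm enormM PoszM legendreM. Qed.

Lemma legendre_norm_congr x y :
  (ere x)%:~R = (ere y)%:~R :> 'F_q -> (eim x)%:~R = (eim y)%:~R :> 'F_q ->
  legendre_norm x = legendre_norm y.
Proof.
move=> hre him; apply: legendre_mod => //; rewrite -Fp_int_eq // !enormZ.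
by rewrite !(rmorphD, rmorphN, rmorphM) /= hre him.
Qed.

Lemma legendre_norm_eq0 z : (legendre_norm z == 0) = (q %| enorm z)%N.
Proof. by rewrite /legendre_norm legendre_eq0. Qed.

Lemma legendre_norm_sqr z : ~~ (q %| enorm z)%N -> legendre_norm z ^+ 2 = 1.
Proof. by move=> qz; apply: legendre_sqr; rewrite dvdzE. Qed.

Lemma legendreP (a : int) : legendre a q != -1 ->
  exists x : int, a%:~R = x%:~R ^+ 2 :> 'F_q.
Proof.
rewrite /legendre; case: ifPn => [qa _|_].
  by exists 0; rewrite expr0n /=; apply/eqP; rewrite Fp_int_eq0.
case: ifP => // /existsP[x] ; rewrite -Fp_int_eq // rmorphXn /= => /eqP xa _.
by exists x%:Z.
Qed.

(** If no norm were a nonresidue, 3 = t^2 would be a square, hence x^2 + 3 (1 / t)^2 = x^2 + 1 would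
    be a square for every x, and by induction all residues would be squares. *)
Lemma legendre_norm_nontrivial : exists z, legendre_norm z = -1.
Proof.
apply: contrapT => /forallNP noz.
have sq (x y : int) : exists t : int, (x ^+ 2 + 3 * y ^+ 2)%:~R = t%:~R ^+ 2 :> 'F_q.
  apply: legendreP; apply/eqP; rewrite -enorm_lattice_point; exact: noz.
have [t] := sq 0 1; rewrite expr0n add0r expr1n mulr1 => t3.
have t0 : t%:~R != 0 :> 'F_q.
  apply: contraNneq q3 => t0; move/eqP: t3; rewrite t0 expr0n Fp_int_eq0 //.
  by rewrite dvdzE /= dvdn_prime2.
have [s st] := Fp_intP q_pr (t%:~R)^-1.
have allsq m : exists x : int, m%:R = x%:~R ^+ 2 :> 'F_q.
  elim: m => [|m [x mx]]; first by exists 0; rewrite expr0n.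
  have [y] := sq x s%:Z; rewrite rmorphD rmorphM !rmorphXn /= t3 -st.
  by rewrite -exprMn mulfV // expr1n -mx natr1 => Ey; exists y.
have [|u u0 un] := @Fp_nontrivial_power q q_pr q.-1./2.
  apply/negP => /dvdn_leq; have := odd_prime_gt2 q_odd q_pr; lia.
have [x ux] := allsq (u : nat); rewrite natr_Zp in ux.
case/eqP: un; rewrite ux -exprM.
have -> : (2 * q.-1./2 = q.-1)%N by lia.
rewrite Fp_expE //; apply: contra_neq u0 => x0.
by rewrite ux x0 expr0n.
Qed.

(** The chosen root w of the closure must be one of c and -1 - c, so it is the image of an integer
    when q splits. *)
Lemma Fp_root_omega (c : int) : (c%:~R : 'F_q) ^+ 2 = - 1 - c%:~R ->
  exists c' : int, c'%:~R = w /\ (c'%:~R : 'F_q) ^+ 2 = - 1 - c'%:~R.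
Proof.
move=> c2; have : (c ^+ 2)%:~R == (- 1 - c)%:~R :> K.
  by rewrite -Fp_Fpbar rmorphXn rmorphB rmorphN1 /= c2.
rewrite rmorphXn rmorphB rmorphN1 /= => /eqP ck.
have /eqP : ((c%:~R : K) - w) * (c%:~R + 1 + w) = 0.
  have -> : ((c%:~R : K) - w) * (c%:~R + 1 + w) = c%:~R ^+ 2 + c%:~R - w ^+ 2 - w by ring.
  by rewrite ck wr; ring.
rewrite mulf_eq0 subr_eq0 => /orP[/eqP cw|/eqP cw]; first by exists c.
exists (- 1 - c); rewrite !rmorphB !rmorphN1 /=; split.
  by rewrite (_ : w = - (c%:~R + 1)); [ring | apply/eqP; rewrite -addr_eq0 addrC cw].
by apply/eqP; rewrite -subr_eq0; move/eqP: c2; rewrite -subr_eq0 => /eqP <-; apply/eqP; ring.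
Qed.

(** For split q the values at w and at its conjugate can be prescribed independently. Take 1 and u
    with u^m <> 1: since n = m (3 m + 2) and u^(3 m) = 1, the power is u^(2 m), which is not 1. *)
Lemma cubic_dual_nontrivial_split : (q %% 3 = 1)%N ->
  exists z, ~~ (q %| enorm z)%N /\ cubic_dual q z != 1.
Proof.
move=> q1; pose m := (q.-1 %/ 3)%N.
have qm : q = (3 * m).+1 by rewrite /m; lia.
have m0 : (0 < m)%N by move: (prime_gt1 q_pr); rewrite {1}qm; lia.
have [|u u0 um] := @Fp_nontrivial_power q q_pr m.
  by apply/negP => /(dvdn_leq m0); rewrite qm /=; lia.
have [U uU] := Fp_intP q_pr u; set V := U%:Z in uU.
have u3 : (u ^+ m) ^+ 3 = 1.
  by rewrite -exprM mulnC -[(3 * m)%N]/((3 * m).+1.-1) -qm Fp_expE.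
have c2 : ((V ^+ m)%:~R : 'F_q) ^+ 2 = - 1 - (V ^+ m)%:~R.
  rewrite rmorphXn /= -uU; apply/eqP; rewrite -subr_eq0; apply/eqP.
  apply: (@mulIf _ (u ^+ m - 1)); first by rewrite subr_eq0.
  have -> : (u ^+ m ^+ 2 - (-1 - u ^+ m)) * (u ^+ m - 1) = (u ^+ m) ^+ 3 - 1.
    by move: (u ^+ m) => v; rewrite !exprS expr0; ring.
  by rewrite u3 subrr mul0r.
have [c [cw cF]] := Fp_root_omega c2.
pose dl : 'F_q := 2 * c%:~R + 1.
have dl0 : dl != 0.
  have d2 : dl ^+ 2 = - 3%:R.
    have -> : dl ^+ 2 = 4 * (c%:~R ^+ 2) + 4 * c%:~R + 1 by rewrite /dl; ring.
    by rewrite cF; ring.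
  apply/eqP => d0; move: d2; rewrite d0 expr0n /= => /esym/eqP.
  by rewrite oppr_eq0 -(dvdn_pcharf (pchar_Fp q_pr)) dvdn_prime2 // (negPf q3).
(* The equations are a + b c = 1 and a + b (-1 - c) = u; their difference is b (2 c + 1) = 1 - u,
   where 2 c + 1 is a square root of -3. *)
have [b bE] := Fp_intP q_pr ((1 - u) / dl).
pose a := 1 - b%:Z * c.
have z1 : ev w (Eis a b%:Z) = 1.
  by rewrite /ev /= /a -cw rmorphB rmorphM /=; ring.
have z2 : ev w (econj (Eis a b%:Z)) = V%:~R.
  rewrite -ev_conj /ev /= -cw.
  have -> : - 1 - c%:~R = (- 1 - c)%:~R :> K by rewrite rmorphB rmorphN1.
  rewrite -rmorphM -rmorphD /=; apply/eqP; rewrite -Fp_Fpbar /a.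
  rewrite !(rmorphB, rmorphD, rmorphM, rmorphN1, rmorph1) /= -uU.
  have bdl : (b%:Z)%:~R * dl = 1 - u by rewrite -bE divfK.
  have -> : u = 1 - (b%:Z)%:~R * dl by rewrite bdl; ring.
  by apply/eqP; rewrite /dl; ring.
have uK : V%:~R != 0 :> K.
  by rewrite -[0]/(0%:~R) -Fp_Fpbar -uU.
exists (Eis a b%:Z); rewrite -base_eq0 /base z1 z2 !mul1r expf_eq0 (negPf uK) andbF.
split=> //; rewrite cubic_dual_eq1 /base z1 z2 !mul1r.
have -> : n = (m * (3 * m) + m * 2)%N.
  by rewrite /n (third_sqr_split qm) {1}qm -mulnDr addn2.
have -> : (V%:~R : K) ^+ (m * (3 * m) + m * 2) = (V ^+ (m * (3 * m) + m * 2))%:~R.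
  by rewrite rmorphXn.
rewrite -[1]/(1%:~R) -Fp_Fpbar rmorphXn /= -uU exprD exprM !exprM.
rewrite [u ^+ m ^+ 3]u3 expr1n mul1r rmorph1.
apply: contra_neq um => u2.
by rewrite -[LHS]mul1r -[X in X * _]u2 -exprSr.
Qed.

(** For inert q, [ev] is injective on pairs of residues and has q^2 - 1 nonzero values. If the
    symbol were trivial, all of them would be roots of X^n - 1 with n = (q^2 - 1) / 3. *)
Lemma cubic_dual_nontrivial_inert : (q %% 3 = 2)%N ->
  exists z, ~~ (q %| enorm z)%N /\ cubic_dual q z != 1.
Proof.
move=> q2; apply: contrapT => /forallNP noz.
have evI (a b : int) : ev w (Eis a b) = 0 -> a%:~R = 0 :> 'F_q /\ b%:~R = 0 :> 'F_q.
  rewrite /ev /= => ab.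
  have [b0|b0] := eqVneq (b%:~R : K) 0.
    move: ab; rewrite b0 mul0r addr0 => a0; split; apply/eqP;
    by rewrite -[0]/(0%:~R) Fp_Fpbar ?b0 ?a0.
  exfalso; have bF : b%:~R != 0 :> 'F_q by rewrite -[0]/(0%:~R) Fp_Fpbar.
  (* With b <> 0 the relation a + b w = 0 puts w in F_q, so w^(q - 1) = 1; as q - 1 is 1 modulo 3,
     this means w = 1. *)
  have [c cE] := Fp_intP q_pr (- a%:~R / b%:~R).
  have cw : (c%:Z)%:~R = w.
    apply: (mulfI b0); rewrite -rmorphM /=.
    have -> : b%:~R * w = (- a)%:~R by rewrite rmorphN; apply/eqP; rewrite -addr_eq0 addrC ab.
    apply/eqP; rewrite -Fp_Fpbar rmorphM rmorphN /= -cE mulrC divfK //.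
  have c0 : (c%:Z)%:~R != 0 :> K by rewrite cw (w_neq0 wr).
  have := Fpbar_int_expE c0; rewrite cw.
  have -> : q.-1 = (3 * (q.-1 %/ 3) + 1)%N by lia.
  rewrite exprD exprM (ev_root3 wr) expr1n mul1r expr1 => w1.
  by have := w_neq1 wr K3; rewrite w1 eqxx.
pose f (u : 'F_q * 'F_q) := ev w (Eis (u.1 : nat)%:Z (u.2 : nat)%:Z).
have fI : injective f.
  move=> [a b] [c d]; rewrite /f /= => /eqP; rewrite -subr_eq0 -evB.
  move/eqP/evI; rewrite !eisE /= !rmorphB /= -!pmulrn !natr_Zp.
  by case=> /eqP; rewrite subr_eq0 => /eqP -> /eqP; rewrite subr_eq0 => /eqP ->.
have q1 := prime_gt1 q_pr.
suff: (#|predC1 ((0%R, 0%R) : 'F_q * 'F_q)| <= n)%N.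
  have := cardC1 ((0%R, 0%R) : 'F_q * 'F_q); rewrite card_prod card_Fp // => ->.
  by rewrite mulnn q3n /=; lia.
rewrite -(fintype.size_image f); apply: max_unity_roots => //.
  apply/allP => _ /fintype.imageP[[a b] /= ab0 ->]; rewrite unity_rootE /f /=.
  set z := Eis _ _; have z0 : ev w z != 0.
    apply: contra ab0 => /eqP/evI; rewrite -!pmulrn !natr_Zp => -[-> ->].
    by [].
  have zc0 : ev w (econj z) != 0.
    apply: contra z0 => /eqP/evI[] /= h1 h2; apply/eqP.
    have {}h2 : ((b : nat)%:Z)%:~R = 0 :> 'F_q.
      by move/eqP: h2; rewrite rmorphN oppr_eq0 => /eqP.
    move: h1; rewrite rmorphB /= h2 subr0 => h1; move/eqP: h1; move/eqP: h2.
    rewrite -[0 : 'F_q]/(0%:~R) !Fp_Fpbar => /eqP bz /eqP az.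
    by rewrite /ev /z /= bz az mul0r addr0.
  have zN : ~~ (q %| enorm z)%N.
    by rewrite -base_eq0 /base expf_eq0 !mulf_eq0 (negPf z0) (negPf zc0) andbF.
  have /eqP : cubic_dual q z = 1.
    by apply: contrapT => z1; apply: (noz z); split=> //; apply/eqP.
  (* The norm is a nonzero integer modulo q and q - 1 divides n, so its n-th power is 1 and only
     ev(z)^n remains. *)
  rewrite cubic_dual_eq1 /base exprMn -enorm_Fpbar.
  have -> : n = (q.-1 * (q.+1 %/ 3))%N by rewrite /n third_sqr_inert.
  rewrite [(_%:~R) ^+ _]exprM Fpbar_int_expE ?expr1n ?mulr1 //.
  by rewrite Fpbar_int_eq0 dvdzE.
by rewrite map_inj_uniq // enum_uniq.
Qed.
End LocalSums.

(** * Sums over a line of characters modulo q that are trivial on the integers *)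

Section ProjectiveCharacterSum.
Variable q : nat.
Hypotheses (q_pr : prime q) (q_odd : odd q) (q3 : q != 3%N).
Variable psi : eis -> eis.
Hypotheses (psiM : {morph psi : x y / x * y})
  (psi_congr : forall x y, (ere x)%:~R = (ere y)%:~R :> 'F_q ->
     (eim x)%:~R = (eim y)%:~R :> 'F_q -> psi x = psi y)
  (psi_int : forall a : int, ~~ (q%:Z %| a)%Z -> psi a%:~R = 1)
  (psi_eq0 : forall z, (psi z == 0) = (q %| enorm z)%N).

Let s (x y : 'F_q) : eis := lattice_point (x : nat)%:Z (y : nat)%:Z.
Let S (x : 'F_q) : eis := \sum_y psi (s x y).

Let FpE (t : 'F_q) : ((t : nat)%:Z)%:~R = t.
Proof. by rewrite -pmulrn natr_Zp. Qed.

Let s_re x y : (ere (s x y))%:~R = x + y.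
Proof. by rewrite /= rmorphD /= !FpE. Qed.
Let s_im x y : (eim (s x y))%:~R = 2 * y.
Proof. by rewrite /= rmorphM /= !FpE. Qed.

Let reM x y : (ere (x * y))%:~R =
  (ere x)%:~R * (ere y)%:~R - (eim x)%:~R * (eim y)%:~R :> 'F_q.
Proof. by rewrite eisE rmorphB !rmorphM. Qed.
Let imM x y : (eim (x * y))%:~R = (ere x)%:~R * (eim y)%:~R +
  (eim x)%:~R * (ere y)%:~R - (eim x)%:~R * (eim y)%:~R :> 'F_q.
Proof. by rewrite eisE rmorphB rmorphD !rmorphM. Qed.
Let re_int (t : 'F_q) : (ere ((t : nat)%:Z)%:~R)%:~R = t.
Proof. by rewrite eis_intr /= FpE. Qed.
Let im_int (t : 'F_q) : (eim ((t : nat)%:Z)%:~R)%:~R = 0 :> 'F_q.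
Proof. by rewrite eis_intr. Qed.

Let psi_lattice (r B : int) : psi (lattice_point r B) = psi (s r%:~R B%:~R).
Proof.
apply: psi_congr; rewrite ?s_re ?s_im /=.
  by rewrite rmorphD.
by rewrite rmorphM.
Qed.

Let psi_scale x y : x != 0 -> psi (s x (x * y)) = psi (s 1 y).
Proof.
move=> x0; have qx : ~~ (q%:Z %| (x : nat)%:Z)%Z by rewrite -Fp_int_eq0 // FpE.
rewrite -[RHS]mul1r -(psi_int qx) -psiM; apply: psi_congr.
  by rewrite reM re_int im_int !s_re s_im; ring.
by rewrite imM re_int im_int !s_im s_re; ring.
Qed.

Let psi_sqrtm3 : psi sqrtm3 = psi (s 0 1).
Proof. by rewrite -[sqrtm3]/(lattice_point 0 1) psi_lattice. Qed.

Let S_scale x : x != 0 -> S x = S 1.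
Proof.
move=> x0; rewrite /S (reindex_inj (mulfI x0)).
by apply: eq_bigr => y _; rewrite psi_scale.
Qed.

Let S0 : S 0 = (q.-1)%:R * psi sqrtm3.
Proof.
rewrite /S (bigD1 0) //=.
have -> : psi (s 0 0) = 0.
  by apply/eqP; rewrite psi_eq0 (_ : enorm _ = 0%N).
rewrite add0r (eq_bigr (fun=> psi sqrtm3)); last first.
  move=> y y0; rewrite psi_sqrtm3.
  have qy : ~~ (q%:Z %| (y : nat)%:Z)%Z by rewrite -Fp_int_eq0 // FpE.
  rewrite -[RHS]mul1r -(psi_int qy) -psiM; apply: psi_congr.
    by rewrite reM re_int im_int !s_re s_im; ring.
  by rewrite imM re_int im_int !s_im s_re; ring.
by rewrite sumr_const cardC1 card_Fp // mulr_natl.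
Qed.

Lemma sum_lattice_F (r : int) :
  \sum_(B < q) psi (lattice_point r B%:Z) = S r%:~R.
Proof.
rewrite /S.
have -> : \sum_(y : 'F_q) psi (s r%:~R y) =
    \sum_(0 <= i < (Zp_trunc (pdiv q)).+2) psi (lattice_point r i%:Z).
  rewrite big_mkord; apply: eq_bigr => y _; rewrite [RHS]psi_lattice.
  by rewrite FpE.
by rewrite Fp_cast // big_mkord.
Qed.

Lemma sum_lattice_dvd (r : int) : (q%:Z %| r)%Z ->
  \sum_(B < q) psi (lattice_point r B%:Z) = (q.-1)%:R * psi sqrtm3.
Proof. by rewrite sum_lattice_F -Fp_int_eq0 // => /eqP ->. Qed.

(* The sum of psi over all x + y sqrt(-3) vanishes; since psi is trivial on the
   integers, each of the q - 1 lines x <> 0 contributes the left side, and the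
   line x = 0 contributes (q - 1) psi(sqrt(-3)). *)
Lemma sum_lattice_nontrivial (r : int) (z0 : eis) :
  ~~ (q%:Z %| r)%Z -> psi z0 != 0 -> psi z0 != 1 ->
  \sum_(B < q) psi (lattice_point r B%:Z) = - psi sqrtm3.
Proof.
move=> qr pz0 pz1; rewrite sum_lattice_F S_scale ?Fp_int_eq0 //.
(* These are the coordinates of 2 z0 = x0 + y0 sqrt(-3), and psi(2) = 1. *)
pose x0 : 'F_q := (2 * ere z0 - eim z0)%:~R; pose y0 : 'F_q := (eim z0)%:~R.
have q2 : ~~ (q%:Z %| 2)%Z.
  rewrite dvdzE /=; apply/negP => /(@dvdn_leq q 2 isT).
  by rewrite leqNgt odd_prime_gt2.
have z0E : psi z0 = psi (s x0 y0).
  rewrite -psi_lattice -[LHS]mul1r -(psi_int q2) -psiM; congr psi.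
  by rewrite eis_intr; apply: eisP; rewrite !eisE /=; ring.
pose D := x0 ^+ 2 + 3 * y0 ^+ 2.
have D0 : D != 0.
  apply: contra_neq pz0 => D0; apply/eqP; rewrite z0E psi_eq0.
  have -> : (q %| enorm (s x0 y0))%N = (q%:Z %| (enorm (s x0 y0))%:Z)%Z by [].
  rewrite -Fp_int_eq0 // enorm_lattice_point rmorphD rmorphM !rmorphXn /= !FpE.
  by rewrite -[X in X == _]/(_ + _) -[3%:~R]/(3 : 'F_q) -/D D0.
(* Multiplication by x0 + y0 sqrt(-3), a linear map with determinant D, the norm of that element. *)
pose h (u : 'F_q * 'F_q) := (u.1 * x0 - 3 * u.2 * y0, u.1 * y0 + u.2 * x0).
have hI : injective h.
  move=> [x y] [x' y'] hh.
  have h1 : x * x0 - 3 * y * y0 = x' * x0 - 3 * y' * y0 := congr1 fst hh.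
  have h2 : x * y0 + y * x0 = x' * y0 + y' * x0 := congr1 snd hh.
  congr pair; apply: (mulIf D0).
    have E a b : a * D = (a * x0 - 3 * b * y0) * x0 + 3 * (a * y0 + b * x0) * y0.
      by rewrite /D; ring.
    by rewrite (E x y) (E x' y') h1 h2.
  have E a b : b * D = (a * y0 + b * x0) * x0 - (a * x0 - 3 * b * y0) * y0.
    by rewrite /D; ring.
  by rewrite (E x y) (E x' y') h1 h2.
have T0 : \sum_u psi (s u.1 u.2) = 0.
  apply: (sum_nontrivial_char hI (c := psi z0)) => // -[x y].
  rewrite z0E -psiM; apply: psi_congr.
    by rewrite reM !s_re !s_im /=; ring.
  by rewrite imM !s_re !s_im /=; ring.
have : \sum_x S x = 0.
  by rewrite -[RHS]T0 /S pair_big.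
rewrite (bigD1 0) //= S0 (eq_bigr (fun=> S 1)); last by move=> x /S_scale.
rewrite sumr_const cardC1 card_Fp // -[S 1 *+ _]mulr_natl -mulrDr => /eqP.
rewrite mulf_eq0 addr_eq0 => /orP[|/eqP ->]; last by rewrite opprK.
by rewrite -enorm_eq0 enorm_natr -leqn0 leqNgt expn_gt0 /= orbF -ltnS prednK ?prime_gt0 ?prime_gt1.
Qed.

End ProjectiveCharacterSum.

(* The number of B modulo q such that r + B sqrt(-3) is prime to q. *)
Definition admissible (q : nat) (r : int) : int :=
  q%:Z - 1 - (if (q%:Z %| r)%Z then 0 else legendre (- 3) q).

(** The explicit zero makes trivial exponents give the principal character, supported on the
    elements prime to q, instead of the constant 1. *)
Definition local_char (q m n : nat) (z : eis) : eis :=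
  if (q %| enorm z)%N then 0
  else (legendre_norm q z)%:~R ^+ m * cubic_dual q z ^+ n.

Section LocalCharacterSum.
Variable q : nat.
Hypotheses (q_pr : prime q) (q_odd : odd q) (q3 : q != 3%N).

Lemma cubic_dual_cube z : ~~ (q %| enorm z)%N -> cubic_dual q z ^+ 3 = 1.
Proof. by move=> qz; rewrite mu03_cube ?cubic_dual_mu03 // cubic_dual_eq0. Qed.

(** The square of sqrt(-3) is an integer, so the value has order dividing both 2 and 3. Hence
    sqrt(-3) contributes only its quadratic value (3 / q), the source of (3 / alpha) in the
    theorem. *)
Lemma cubic_dual_sqrtm3 : cubic_dual q sqrtm3 = 1.
Proof.
have q_3 : ~~ (q%:Z %| - 3)%Z by rewrite dvdzE /= dvdn_prime2.
have s2 : cubic_dual q sqrtm3 ^+ 2 = 1.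
  by rewrite expr2 -cubic_dualM // -(cubic_dual_int q_pr q_odd q3 q_3) eis_intr.
have s3 : cubic_dual q sqrtm3 ^+ 3 = 1 by rewrite cubic_dual_cube // dvdn_prime2.
by rewrite -[LHS]mul1r -[X in X * _]s2 -exprSr.
Qed.

Lemma local_charM m n :
  {morph local_char q m n : x y / x * y}.
Proof.
move=> x y; rewrite /local_char enormM Euclid_dvdM //.
case: ifP => /=; last first.
  by move/negbT; rewrite negb_or => /andP[/negPf -> /negPf ->];
    rewrite legendre_normM // cubic_dualM // rmorphM !exprMn mulrACA.
by case/orP => ->; rewrite ?mul0r ?mulr0.
Qed.

Lemma enorm_congr x y :
  (ere x)%:~R = (ere y)%:~R :> 'F_q -> (eim x)%:~R = (eim y)%:~R :> 'F_q ->
  (q %| enorm x)%N = (q %| enorm y)%N.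
Proof.
move=> hre him; have E z : (q %| enorm z)%N = (((enorm z)%:Z)%:~R == 0 :> 'F_q).
  by rewrite Fp_int_eq0.
by rewrite !E !enormZ !(rmorphD, rmorphN, rmorphM) /= hre him.
Qed.

Lemma local_char_congr m n x y :
  (ere x)%:~R = (ere y)%:~R :> 'F_q -> (eim x)%:~R = (eim y)%:~R :> 'F_q ->
  local_char q m n x = local_char q m n y.
Proof.
move=> hre him; rewrite /local_char (enorm_congr hre him).
by rewrite (legendre_norm_congr q_pr q_odd hre him) (cubic_dual_congr q_pr hre him).
Qed.

Lemma local_char_int m n (a : int) : ~~ (q%:Z %| a)%Z -> local_char q m n a%:~R = 1.
Proof.
move=> qa; rewrite /local_char enorm_intr Euclid_dvdX // andbT.
rewrite ifN // cubic_dual_int // expr1n mulr1 /legendre_norm enorm_intr.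
by rewrite -mulnn PoszM -expr2 legendreX // legendre_sqr ?dvdzE // expr1n.
Qed.

Lemma local_char_eq0 m n z : (local_char q m n z == 0) = (q %| enorm z)%N.
Proof.
rewrite /local_char; case: ifP; first by rewrite eqxx.
move=> qz; rewrite mulf_eq0 !expf_eq0 cubic_dual_eq0 // qz andbF orbF.
by rewrite -enorm_eq0 enorm_intr expn_eq0 absz_eq0 legendre_norm_eq0 qz andbF.
Qed.

Lemma local_char_nontrivial m n : ~~ ((2 %| m) && (3 %| n))%N ->
  exists2 z, local_char q m n z != 0 & local_char q m n z != 1.
Proof.
move=> mn; apply: contrapT => noz.
have triv z : ~~ (q %| enorm z)%N -> local_char q m n z = 1.
  move=> qz; apply: contrapT => z1; apply: noz; exists z; last exact/eqP.
  by rewrite local_char_eq0.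
move: mn; rewrite negb_and => /orP[m2|n3].
  have [z zN] := legendre_norm_nontrivial q_pr q_odd q3.
  have qz : ~~ (q %| enorm z)%N by rewrite -legendre_norm_eq0 // zN.
  (* Cubing removes the cubic factor and keeps the sign. *)
  move: (triv z qz) => /(congr1 (fun x => x ^+ 3)).
  rewrite /local_char (negPf qz) zN exprMn -[_ ^+ n ^+ 3]exprM mulnC exprM.
  rewrite cubic_dual_cube // !expr1n mulr1 rmorphN1 -exprM -signr_odd oddM.
  by move: m2; rewrite dvdn2 negbK => ->.
have [z [qz z1]] : exists z, ~~ (q %| enorm z)%N /\ cubic_dual q z != 1.
  have : (q %% 3 != 0)%N by rewrite -/(3 %| q)%N dvdn_prime2 // eq_sym.
  have : (q %% 3 < 3)%N by rewrite ltn_mod.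
  case E : (q %% 3)%N => [|[|[|//]]] // _ _.
    exact: cubic_dual_nontrivial_split.
  exact: cubic_dual_nontrivial_inert.
(* The fourth power removes the sign and keeps the cubic factor, as 4 is 1 modulo 3. *)
move: (triv z qz) => /(congr1 (fun x => x ^+ 4)).
rewrite /local_char (negPf qz) exprMn expr1n.
have -> : ((legendre_norm q z)%:~R ^+ m) ^+ 4 =
    ((legendre_norm q z ^+ 2)%:~R) ^+ (2 * m) :> eis.
  by rewrite rmorphXn -!exprM; congr (_ ^+ _); lia.
rewrite legendre_norm_sqr // rmorph1 expr1n mul1r.
have c3 := cubic_dual_cube qz.
rewrite -exprM mulnC [(4 * n)%N](_ : _ = (3 * n + n)%N); last by rewrite mulSn addnC.
rewrite exprD exprM c3 expr1n mul1r (divn_eq n 3) exprD mulnC exprM c3 expr1n mul1r.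
have : (n %% 3 < 3)%N by rewrite ltn_mod.
move: n3; rewrite /dvdn; case: (n %% 3)%N => [|[|[|//]]] // _ _.
  by rewrite expr1 => /eqP; rewrite (negPf z1).
by move=> z2; case/eqP: z1; rewrite -[LHS]mul1r -[X in X * _]z2 -exprSr.
Qed.

Lemma count_lattice_zeros (r : int) : ~~ (q%:Z %| r)%Z ->
  \sum_(B < q) (q %| enorm (lattice_point r B%:Z))%N%:R = 1 + legendre (- 3) q :> int.
Proof.
move=> qr.
have r0 : r%:~R != 0 :> 'F_q by rewrite Fp_int_eq0.
have F3 : 3%:R != 0 :> 'F_q by rewrite -(dvdn_pcharf (pchar_Fp q_pr)) dvdn_prime2.
pose P : pred 'F_q := fun y => r%:~R ^+ 2 + 3%:R * y ^+ 2 == 0.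
have -> : \sum_(B < q) (q %| enorm (lattice_point r B%:Z))%N%:R =
   \sum_(y : 'F_q) (P y)%:R :> int.
  transitivity (\sum_(0 <= i < (Zp_trunc (pdiv q)).+2)
      (q %| enorm (lattice_point r i%:Z))%N%:R : int).
    by rewrite Fp_cast // big_mkord.
  rewrite big_mkord; apply: eq_bigr => y _; congr (_ %:R); congr nat_of_bool.
  have -> : (q %| enorm (lattice_point r (y : nat)%:Z))%N =
     (((enorm (lattice_point r (y : nat)%:Z))%:Z)%:~R == 0 :> 'F_q).
    by rewrite Fp_int_eq0.
  rewrite enorm_lattice_point rmorphD rmorphM !rmorphXn /=.
  by rewrite -[((y : nat)%:Z)%:~R]pmulrn natr_Zp.
have -> : \sum_(y : 'F_q) (P y)%:R = #|P|%:R :> int.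
  by rewrite -sum1_card natr_sum [RHS]big_mkcond; apply: eq_bigr => y _; rewrite [y \in P]/(P y) /P; case: eqP.
have [/eqP L1|LN1] := boolP (legendre (-3) q == -1).
  rewrite L1 subrr; apply/eqP; rewrite pnatr_eq0; apply/eqP/eq_card0 => y.
  rewrite [y \in P]/(P y); apply/negP => /eqP y0.
  move: L1; have := legendre_Fp q_pr q_odd (-3) => + L1; rewrite L1.
  (* A zero y of r^2 + 3 y^2 exhibits -3 as a square, which contradicts Euler's criterion. *)
  have -> : (-3)%:~R = (3%:R * y / r%:~R) ^+ 2 :> 'F_q.
    rewrite exprMn exprVn; apply: (mulIf (x := r%:~R ^+ 2)); first by rewrite expf_eq0.
    rewrite mulfVK ?expf_eq0 //; move/eqP: y0; rewrite addr_eq0 => /eqP ->.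
    by rewrite rmorphN /=; ring.
  have y1 : 3%:R * y / r%:~R != 0.
    rewrite !mulf_eq0 invr_eq0 (negPf r0) (negPf F3) orbF /=.
    apply/eqP => yz; move: y0; rewrite yz expr0n mulr0 addr0 => /eqP.
    by rewrite expf_eq0 (negPf r0).
  have hq : (2 * q.-1./2 = q.-1)%N by have := prime_gt1 q_pr; lia.
  rewrite -exprM hq Fp_expE // rmorphN1 => /eqP; rewrite -subr_eq0 -opprD oppr_eq0.
  by rewrite (negPf (Fp_two q_pr q_odd)).
have q_3 : ~~ (q%:Z %| - 3)%Z by rewrite dvdzE /= dvdn_prime2.
have -> : legendre (-3) q = 1.
  move: LN1; rewrite /legendre (negPf q_3); by case: ifP.
have [t tE] := legendreP q_pr LN1.
have t0 : t%:~R != 0 :> 'F_q.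
  apply: contra_neq F3 => t0; move: tE; rewrite t0 expr0n rmorphN /=.
  by move/eqP; rewrite oppr_eq0 => /eqP.
(* The zeros of r^2 + 3 y^2 are c and -c, since c^2 = - r^2 / 3. *)
pose c : 'F_q := t%:~R * r%:~R / 3%:R.
have c0 : c != 0 by rewrite !mulf_eq0 invr_eq0 (negPf t0) (negPf r0) (negPf F3).
have -> : #|P| = 2%N.
  rewrite (eq_card (B := pred2 c (- c))).
    rewrite card2 -subr_eq0 opprK -mulr2n -mulr_natl mulf_eq0 (negPf c0).
    by rewrite (negPf (Fp_two q_pr q_odd)).
  move=> y; rewrite [y \in P]/(P y) /P !inE -[y == c]subr_eq0 -addr_eq0 -mulf_eq0 -subr_sqr.
  rewrite -[RHS](inj_eq (mulfI F3)) mulr0; congr (_ == _).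
  have -> : c ^+ 2 = (-3)%:~R * r%:~R ^+ 2 / 3%:R ^+ 2.
    by rewrite tE /c !exprMn exprVn.
  by rewrite rmorphN /=; field; rewrite (natrM _ 3 3) mulf_neq0.
by [].
Qed.

(** If q divides r, every B nonzero modulo q gives a multiple of sqrt(-3), hence the same value.
    Otherwise the character is nontrivial, or it is the indicator of the elements prime to q, whose
    support is counted. *)
Lemma sum_local_char m n (r : int) :
  \sum_(B < q) local_char q m n (lattice_point r B%:Z) =
  (legendre 3 q ^+ m *
    (if (q%:Z %| r)%Z || ((2 %| m) && (3 %| n))%N then admissible q r else -1))%:~R.
Proof.
have ps : local_char q m n sqrtm3 = (legendre 3 q ^+ m)%:~R.
  rewrite /local_char cubic_dual_sqrtm3 expr1n mulr1.
  by rewrite (_ : enorm sqrtm3 = 3%N) // dvdn_prime2 // (negPf q3) rmorphXn.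
have [qr|qr] := boolP (q%:Z %| r)%Z.
  rewrite (sum_lattice_dvd q_pr (@local_charM m n) (@local_char_congr m n)
     (@local_char_int m n) (@local_char_eq0 m n) qr) ps /admissible qr subr0.
  rewrite intrM mulrC; congr (_ * _); rewrite pmulrn; congr (_ %:~R).
  by have := prime_gt0 q_pr; lia.
rewrite orFb; have [mn|mn] := boolP ((2 %| m) && (3 %| n))%N; last first.
  have [z z0 z1] := local_char_nontrivial mn.
  rewrite (sum_lattice_nontrivial q_pr q_odd (@local_charM m n) (@local_char_congr m n)
     (@local_char_int m n) (@local_char_eq0 m n) qr z0 z1) ps.
  by rewrite mulrN1 rmorphN.
case/andP: mn => /dvdnP[m' ->] /dvdnP[n' ->].
have L3 : legendre 3 q ^+ 2 = 1 by rewrite legendre_sqr // dvdzE /= dvdn_prime2.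
rewrite [(m' * 2)%N]mulnC exprM L3 expr1n mul1r /admissible (negPf qr) /=.
transitivity ((\sum_(B < q) (1 - (q %| enorm (lattice_point r B%:Z))%N%:R : int))%:~R : eis).
  rewrite rmorph_sum; apply: eq_bigr => B _; rewrite /local_char; case: ifPn => qz /=.
    by rewrite subrr.
  rewrite exprM -rmorphXn legendre_norm_sqr // expr1n mulnC exprM.
  by rewrite cubic_dual_cube // expr1n subr0 mulr1.
rewrite sumrB count_lattice_zeros // sumr_const card_ord; congr (_ %:~R).
by rewrite pmulrn intz; ring.
Qed.

End LocalCharacterSum.

(** * Counting residue classes *)

Lemma sum_crt (A : pzSemiRingType) m n (f g : nat -> A) : coprime m n ->
  (0 < m)%N -> (0 < n)%N ->
  (forall i, f (i %% m)%N = f i) -> (forall i, g (i %% n)%N = g i) ->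
  \sum_(i < m * n) f i * g i = (\sum_(i < m) f i) * (\sum_(i < n) g i).
Proof.
case: m => // m; case: n => // n mn _ _ fm gn.
pose h (i : 'I_(m.+1 * n.+1)) : 'I_m.+1 * 'I_n.+1 := (inord (i %% m.+1), inord (i %% n.+1)).
have hI : injective h.
  move=> i j hij.
  have h1 : inord (i %% m.+1) = inord (j %% m.+1) :> 'I_m.+1 := congr1 fst hij.
  have h2 : inord (i %% n.+1) = inord (j %% n.+1) :> 'I_n.+1 := congr1 snd hij.
  move/(congr1 val): h1; move/(congr1 val): h2; rewrite /= !inordK ?ltn_mod // => h2 h1.
  have /eqP : i = j %[mod m.+1 * n.+1].
    by apply/eqP; rewrite chinese_remainder // h1 h2 !eqxx.
  by rewrite !modn_small // => /eqP/val_inj.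
have hB : bijective h by apply: inj_card_bij => //; rewrite card_prod !card_ord.
rewrite big_distrlr /= pair_big /= (reindex h); last exact: onW_bij.
by apply: eq_bigr => i _; rewrite /= !inordK ?ltn_mod // fm gn.
Qed.

Lemma sum_crt_primes (A : comPzSemiRingType) (s : seq nat) (f : nat -> nat -> A) :
  uniq s -> all prime s ->
  (forall q i, q \in s -> f q (i %% q)%N = f q i) ->
  \sum_(i < \prod_(q <- s) q) \prod_(q <- s) f q i =
  \prod_(q <- s) \sum_(i < q) f q i.
Proof.
elim: s => [|p s IH].
  by rewrite !big_nil big_ord1 big_nil.
rewrite cons_uniq => /andP[ps us] /andP[p_pr s_pr] fper.
have s0 : (0 < \prod_(q <- s) q)%N.
  by rewrite big_seq prodn_cond_gt0 // => q /(allP s_pr)/prime_gt0.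
rewrite !big_cons -IH //; last by move=> q i qs; rewrite fper // inE qs orbT.
have cop : coprime p (\prod_(q <- s) q).
  rewrite big_seq; apply: (big_ind (coprime p)) => [|x y px py|q qs].
  - exact: coprimen1.
  - by rewrite coprimeMr px.
  have q_pr := allP s_pr q qs.
  by rewrite prime_coprime // dvdn_prime2 //; apply: contraNneq ps => ->.
have fp i : f p (i %% p)%N = f p i by rewrite fper ?mem_head.
pose g i := \prod_(q <- s) f q i.
have gp i : g (i %% \prod_(q <- s) q)%N = g i.
  apply: eq_big_seq => q qs.
  have qd : (q %| \prod_(q <- s) q)%N by rewrite (big_rem q) //= dvdn_mulr.
  have qs' : q \in p :: s by rewrite inE qs orbT.
  by rewrite -(fper _ _ qs') modn_dvdm // fper.
rewrite -(sum_crt cop (prime_gt0 p_pr) s0 fp gp).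
by apply: eq_bigr => i _; rewrite big_cons.
Qed.

Definition lattice_sgn (alpha : nat) (r B : int) : int :=
  \prod_(q <- primes alpha) legendre_norm q (lattice_point r B) ^+ logn q alpha.

Definition lattice_cub (alpha : nat) (r B : int) : eis :=
  \prod_(q <- primes alpha) cubic_dual q (lattice_point r B) ^+ logn q alpha.

(** Up to a power of (3 / alpha), the sum over B modulo the radical of the character of formal order
    j: principal for j = 1, quadratic for 2, cubic for 3, mixed for 6. Its component at q is
    principal exactly when j divides [logn q alpha]. *)
Definition local_weight (j alpha : nat) (r : int) : int :=
  \prod_(q <- primes alpha)
    (if (q%:Z %| r)%Z || (j %| logn q alpha)%N then admissible q r else -1).

Definition radical (alpha : nat) : nat := \prod_(q <- primes alpha) q.

Section CountGood.
Variables (alpha : nat) (r : int).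
Hypotheses (alpha_gt0 : (0 < alpha)%N) (alpha6 : coprime alpha 6).

Lemma prime_factor6 q : q \in primes alpha -> [/\ prime q, odd q & q != 3%N].
Proof.
rewrite mem_primes alpha_gt0 => /andP[q_pr qa].
have q6 : coprime q 6 by apply: coprime_dvdl qa alpha6.
split=> //; first by move: q6; rewrite -[6%N]/(2 * 3)%N coprimeMr coprimen2 => /andP[].
by apply: contraTneq q6 => ->.
Qed.

Let ptwise (i j : nat) (B : int) : eis :=
  \prod_(q <- primes alpha)
     local_char q (i * logn q alpha) (j * logn q alpha) (lattice_point r B).

Lemma lattice_point_mod q (i : nat) : prime q ->
  (ere (lattice_point r (i %% q)%N))%:~R = (ere (lattice_point r i))%:~R :> 'F_q /\
  (eim (lattice_point r (i %% q)%N))%:~R = (eim (lattice_point r i))%:~R :> 'F_q.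
Proof.
move=> q_pr; have E : ((i %% q)%N%:Z)%:~R = (i%:Z)%:~R :> 'F_q.
  by apply/eqP; rewrite Fp_int_eq // -modz_nat modz_mod.
by rewrite /= !rmorphD !rmorphM /= E.
Qed.

Lemma sum_ptwise i j :
  \sum_(B < radical alpha) ptwise i j B%:Z =
  (jacobi 3 alpha ^+ i * \prod_(q <- primes alpha)
    (if (q%:Z %| r)%Z || ((2 %| i * logn q alpha) && (3 %| j * logn q alpha))%N
     then admissible q r else -1))%:~R.
Proof.
rewrite /ptwise /radical.
rewrite (@sum_crt_primes _ (primes alpha) (fun q i' => local_char q (i * logn q alpha)
  (j * logn q alpha) (lattice_point r i'%:Z))) ?primes_uniq //; last 2 first.
- by apply/allP => q /prime_factor6[].
- move=> q m /prime_factor6[q_pr q_odd q3]; have [h1 h2] := lattice_point_mod m q_pr.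
  by apply: local_char_congr.
rewrite /jacobi -prodrXl -big_split /= rmorph_prod; apply: eq_big_seq => q /prime_factor6[q_pr q_odd q3].
by rewrite sum_local_char //= mulnC exprM.
Qed.

Let unramified (B : int) : bool :=
  all (fun q => ~~ (q %| enorm (lattice_point r B))%N) (primes alpha).

Let ptwise0 i j B : ~~ unramified B -> ptwise i j B = 0.
Proof.
rewrite -has_predC => /hasP[q qs /=]; rewrite negbK => qN.
by rewrite /ptwise (big_rem q) //= /local_char qN mul0r.
Qed.

Let ptwiseE i j B : unramified B ->
  ptwise i j B = (lattice_sgn alpha r B)%:~R ^+ i * lattice_cub alpha r B ^+ j.
Proof.
move=> /allP uB; rewrite /ptwise /lattice_sgn /lattice_cub rmorph_prod -!prodrXl -big_split.
apply: eq_big_seq => q qs; rewrite /local_char (negPf (uB q qs)) /=.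
by rewrite rmorphXn /= -!exprM [(i * _)%N]mulnC [(j * _)%N]mulnC.
Qed.

Let lattice_sgn_range B : unramified B ->
  lattice_sgn alpha r B = 1 \/ lattice_sgn alpha r B = -1.
Proof.
move=> /allP uB; have /eqP : lattice_sgn alpha r B ^+ 2 = 1.
  rewrite /lattice_sgn -prodrXl big_seq big1 // => q qs.
  have [q_pr q_odd q3] := prime_factor6 qs.
  by rewrite -exprM mulnC exprM legendre_norm_sqr ?expr1n // uB.
by rewrite sqrf_eq1 => /orP[] /eqP ->; [left|right].
Qed.

Let lattice_sgn0 B : ~~ unramified B -> lattice_sgn alpha r B = 0.
Proof.
rewrite -has_predC => /hasP[q qs /=]; rewrite negbK => qN.
have [q_pr q_odd q3] := prime_factor6 qs.
rewrite /lattice_sgn (big_rem q) //=.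
move: qN; rewrite -legendre_norm_eq0 => /eqP ->.
by rewrite expr0n gtn_eqF ?mul0r // logn_gt0.
Qed.

Let lattice_cub_mu03 B : lattice_cub alpha r B \in mu03.
Proof.
rewrite /lattice_cub; apply: (big_ind (fun x : eis => x \in mu03)) => // [x y|q _].
  exact: mu03M.
by rewrite mu03X ?cubic_dual_mu03.
Qed.

Let lattice_cub_neq0 B : unramified B -> lattice_cub alpha r B != 0.
Proof.
move=> /allP uB; rewrite /lattice_cub prodf_seq_neq0; apply/allP => q qs /=.
have [q_pr q_odd q3] := prime_factor6 qs.
by rewrite expf_neq0 // cubic_dual_eq0 // uB.
Qed.

(* Orthogonality of the six characters (sgn, cub) |-> sgn^i cub^j. *)
Let indicator (e : int) (tau : eis) B : e = 1 \/ e = -1 ->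
  tau \in mu03 -> tau != 0 ->
  (6 * ((lattice_sgn alpha r B == e) && (lattice_cub alpha r B == tau))%:R)%:~R =
  ptwise 0 0 B + e%:~R * ptwise 1 0 B
  + tau ^+ 2 * (ptwise 0 1 B + e%:~R * ptwise 1 1 B)
  + tau * (ptwise 0 2 B + e%:~R * ptwise 1 2 B).
Proof.
move=> he ht t0; have [uB|uB] := boolP (unramified B); last first.
  rewrite !ptwise0 // lattice_sgn0 //.
  by case: he => ->; rewrite /= !(mulr0, addr0).
rewrite !ptwiseE //.
have := lattice_cub_mu03 B; have := lattice_cub_neq0 uB.
move: t0 ht; rewrite !inE.
case: (lattice_sgn_range uB) => ->; case: he => -> t0 /or4P[] /eqP tE;
  rewrite ?tE in t0 *; rewrite ?eqxx // in t0 * => h0 /or4P[] /eqP hE;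
  rewrite ?hE // in h0 *.
Qed.

(** The two conjugate cubic characters have equal sums, and so have the two mixed ones; their
    coefficients tau^2 and tau therefore combine into the trace of tau. *)
Lemma count_good (e : int) (tau : eis) : e = 1 \/ e = -1 ->
  tau \in mu03 -> tau != 0 ->
  6 * \sum_(B < radical alpha)
     ((lattice_sgn alpha r B%:Z == e) && (lattice_cub alpha r B%:Z == tau))%:R =
  local_weight 1 alpha r + e * jacobi 3 alpha * local_weight 2 alpha r
  + etr tau * (local_weight 3 alpha r + e * jacobi 3 alpha * local_weight 6 alpha r).
Proof.
move=> he ht t0.
have W i j k : (forall n, ((2 %| i * n) && (3 %| j * n))%N = (k %| n)%N) ->
    \sum_(B < radical alpha) ptwise i j B%:Z =
    (jacobi 3 alpha ^+ i * local_weight k alpha r)%:~R.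
  move=> ijk; rewrite sum_ptwise; congr ((_ * _)%:~R).
  by apply: eq_bigr => q _; rewrite ijk.
suff E : (6 * \sum_(B < radical alpha)
     ((lattice_sgn alpha r B%:Z == e) && (lattice_cub alpha r B%:Z == tau))%:R)%:~R =
  (local_weight 1 alpha r + e * jacobi 3 alpha * local_weight 2 alpha r
  + etr tau * (local_weight 3 alpha r + e * jacobi 3 alpha * local_weight 6 alpha r))%:~R :> eis.
  by move: E; rewrite !eis_intr => -[].
have tr_tau : (etr tau)%:~R = tau ^+ 2 + tau.
  by move: t0 ht; rewrite !inE => t0 /or4P[] /eqP tE; rewrite tE // in t0 *.
rewrite mulr_sumr rmorph_sum /=.
under eq_bigr do rewrite indicator //.
rewrite !big_split /= -!mulr_sumr !big_split /= -!mulr_sumr.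
rewrite (W 0%N 0%N 1%N) ?(W 1%N 0%N 2%N) ?(W 0%N 1%N 3%N) ?(W 1%N 1%N 6%N)
  ?(W 0%N 2%N 3%N) ?(W 1%N 2%N 6%N).
- by move: (etr tau) tr_tau => T tr_tau; rewrite expr0 expr1 !mul1r !(intrD, intrM) tr_tau; ring.
all: move=> n; lia.
Qed.

End CountGood.

(** * Factorization and symbols of composite integers *)

Lemma eunitE u : eunit u <-> enorm u = 1%N.
Proof.
split=> [[v]|u1]; last by exists (econj u); rewrite mulrC -enormE u1.
move/(congr1 enorm); rewrite enormM enorm1 => /esym/eqP.
by rewrite muln_eq1 => /andP[_ /eqP].
Qed.

Lemma int_round (u n : int) : 0 < n -> exists x : int, - n <= 2 * (u - x * n) <= n.
Proof.
move=> n0; exists ((2 * u + n) %/ (2 * n))%Z.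
have h : 2 * n != 0 by lia.
have := divz_eq (2 * u + n) (2 * n); have := modz_ge0 (2 * u + n) h.
have : ((2 * u + n) %% (2 * n))%Z < 2 * n by apply: ltz_pmod; lia.
move: (_ %/ _)%Z (_ %% _)%Z => x y h1 h2 h3; nia.
Qed.

(** Rounding the coordinates of a conj(b) / N(b) leaves, after multiplication by n = N(b), errors s
    and t with |s|, |t| <= n / 2, so that s^2 - s t + t^2 <= 3 n^2 / 4. *)
Lemma eis_div (a b : eis) : b != 0 -> exists q, (enorm (a - q * b)%R < enorm b)%N.
Proof.
move=> b0; pose n := enorm b.
have n0 : (0 < n)%N by rewrite lt0n enorm_eq0.
have n0' : 0 < n%:Z by rewrite ltz_nat.
pose U := a * econj b.
have [x hx] := int_round (ere U) n0'; have [y hy] := int_round (eim U) n0'.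
exists (Eis x y).
pose c := a - Eis x y * b.
have Ec : c * econj b = U - Eis x y * n%:R.
  by rewrite /c mulrBl -mulrA -enormE.
have N1 : (enorm c * n = enorm (U - Eis x y * n%:R)%R)%N.
  rewrite -Ec enormM; congr (_ * _)%N; apply/eqP; rewrite -eqz_nat !enormZ /econj /=.
  by apply/eqP; ring.
have N2 : (enorm (U - Eis x y * n%:R))%:Z =
    (ere U - x * n%:Z) ^+ 2 - (ere U - x * n%:Z) * (eim U - y * n%:Z) + (eim U - y * n%:Z) ^+ 2.
  by rewrite enormZ eis_natr !eisE /=; congr (_ - _ * _ + _); ring.
suff : (enorm c)%:Z * n%:Z < n%:Z * n%:Z by rewrite ltr_pM2r // ltz_nat.
rewrite -PoszM N1 N2; move: (ere U - _) (eim U - _) hx hy => s t hs ht.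
have {}hs : 4 * s ^+ 2 <= n%:Z ^+ 2 by nia.
have {}ht : 4 * t ^+ 2 <= n%:Z ^+ 2 by nia.
have hst : - 2 * (s * t) <= s ^+ 2 + t ^+ 2 by have := sqr_ge0 (s + t); lra.
have nn : 0 < n%:Z ^+ 2 by rewrite exprn_gt0.
by rewrite -expr2; lra.
Qed.

Lemma eis_irreducible_prime (p : eis) : p != 0 -> enorm p != 1%N ->
  (forall a b, p = a * b -> enorm a = 1%N \/ enorm b = 1%N) -> eprime p.
Proof.
move=> p0 p1 irr; split; [exact/eqP|by rewrite eunitE; exact/eqP|].
move=> a b [c pab]; case: (pselect (edvd p a)) => [|npa]; [by left|right].
(* A nonzero element of least norm in the ideal (a, p) generates it. *)
pose I (k : nat) := `[< exists x y, x * a + y * p != 0 /\ enorm (x * a + y * p) = k >].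
have exI : exists k, I k.
  by exists (enorm p); apply/asboolP; exists 0, 1; rewrite mul0r add0r mul1r.
case: (ex_minnP exI) => m /asboolP[x [y [g0 gm]]] minm.
set g := x * a + y * p in g0 gm.
have gdvd x' y' : edvd g (x' * a + y' * p).
  have [q qlt] := eis_div (x' * a + y' * p) g0; exists q.
  apply/eqP; rewrite -subr_eq0; apply: contraT => h.
  suff /minm : I (enorm (x' * a + y' * p - q * g)) by rewrite -gm leqNgt qlt.
  apply/asboolP; exists (x' - q * x), (y' - q * y).
  have -> : (x' - q * x) * a + (y' - q * y) * p = x' * a + y' * p - q * g.
    by rewrite /g; ring.
  by [].
have [u up] : edvd g p by have := gdvd 0 1; rewrite mul0r add0r mul1r.
have [v va] : edvd g a by have := gdvd 1 0; rewrite mul0r addr0 mul1r.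
(* If the cofactor u is a unit, p divides a, which is excluded; otherwise g is a unit, and b g = x a
   b + y b p is a multiple of p. *)
case: (irr u g up) => [u1|g1].
  case: npa; exists (v * econj u); rewrite up -mulrA [econj u * _]mulrA.
  by rewrite [econj u * u]mulrC -enormE u1 mul1r.
exists (econj g * (x * c + y * b)).
rewrite -[LHS]mul1r -[1]/(1%:R) -g1 enormE.
have -> : econj g * (x * c + y * b) * p = econj g * (x * (c * p) + y * b * p) by ring.
by rewrite -pab /g; ring.
Qed.

(** Existence ensures that [efactors] returns an actual factorization and not its default [[::]]. *)
Lemma eis_factorization (n : eis) : n != 0 ->
  exists2 s : seq eis, (forall p, p \in s -> eprime p) &
    exists2 u, eunit u & n = u * \prod_(p <- s) p.
Proof.
have [k] := ubnP (enorm n); elim: k => // k IH in n *; rewrite ltnS => nk n0.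
have [n1|n1] := eqVneq (enorm n) 1%N.
  by exists [::] => //; exists n; rewrite ?eunitE // big_nil mulr1.
case: (pselect (exists a b, [/\ n = a * b, enorm a != 1%N & enorm b != 1%N])); last first.
  move=> irr; exists [:: n]; last by exists 1; rewrite ?eunitE // big_seq1 mul1r.
  move=> p; rewrite inE => /eqP ->; apply: eis_irreducible_prime => // a b nab.
  have [a1|a1] := eqVneq (enorm a) 1%N; first by left.
  have [b1|b1] := eqVneq (enorm b) 1%N; first by right.
  by case: irr; exists a, b.
move=> [a [b [nab a1 b1]]].
have a0 : a != 0 by apply: contra_neq n0 => a0; rewrite nab a0 mul0r.
have b0 : b != 0 by apply: contra_neq n0 => b0; rewrite nab b0 mulr0.
have na : (0 < enorm a)%N by rewrite lt0n enorm_eq0.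
have nb : (0 < enorm b)%N by rewrite lt0n enorm_eq0.
have nn : enorm n = (enorm a * enorm b)%N by rewrite nab enormM.
have [s1 ps1 [u u1 Ea]] : exists2 s : seq eis, (forall p, p \in s -> eprime p) &
    exists2 u, eunit u & a = u * \prod_(p <- s) p by apply: IH; rewrite // nn in nk *; nia.
have [s2 ps2 [v v1 Eb]] : exists2 s : seq eis, (forall p, p \in s -> eprime p) &
    exists2 u, eunit u & b = u * \prod_(p <- s) p by apply: IH; rewrite // nn in nk *; nia.
exists (s1 ++ s2).
  by move=> p; rewrite mem_cat => /orP[/ps1|/ps2].
exists (u * v); last by rewrite nab Ea Eb big_cat /=; ring.
by move: u1 v1; rewrite !eunitE enormM => -> ->.
Qed.

Lemma enorm_mod3 z : (enorm z %% 3 != 2)%N.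
Proof.
have := enormZ z; case: z => a b /= h.
have [x [i [ha hi]]] : exists x i : int, a = 3 * x + i /\ (i = 0 \/ i = 1 \/ i = 2).
  by exists (a %/ 3)%Z, (a %% 3)%Z; lia.
have [y [j [hb hj]]] : exists y j : int, b = 3 * y + j /\ (j = 0 \/ j = 1 \/ j = 2).
  by exists (b %/ 3)%Z, (b %% 3)%Z; lia.
rewrite ha hb in h *.
set N := enorm _ in h *.
have {}h : N%:Z = 3 * (3 * x ^+ 2 + 2 * x * i - 3 * x * y - x * j - y * i + 3 * y ^+ 2
   + 2 * y * j) + (i ^+ 2 - i * j + j ^+ 2) by rewrite h; ring.
move: (_ - _ + _ + _) h => T h.
by case: hi h => [->|[->|->]]; case: hj => [->|[->|->]] h; lia.
Qed.

(* For a cube root of unity beta, its cubic residue symbol modulo an element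
   of norm N. *)
Definition third_pow (beta : eis) (N : nat) : eis := beta ^+ (N.-1 %/ 3).

Lemma third_powM beta N M : beta ^+ 3 = 1 -> (N %% 3 = 1)%N -> (M %% 3 = 1)%N ->
  third_pow beta (N * M) = third_pow beta N * third_pow beta M.
Proof.
move=> b3 N1 M1.
have [a ->] : exists a, N = (3 * a).+1 by exists (N %/ 3)%N; lia.
have [b ->] : exists b, M = (3 * b).+1 by exists (M %/ 3)%N; lia.
rewrite /third_pow -exprD -![_.+1.-1]/(3 * _)%N !mulKn //.
have -> : (((3 * a).+1 * (3 * b).+1).-1 %/ 3 = 3 * (a * b) + (a + b))%N by lia.
by rewrite exprD exprM b3 expr1n mul1r.
Qed.

Lemma third_pow_prod beta (I : eqType) (s : seq I) (f : I -> nat) : beta ^+ 3 = 1 ->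
  (forall i, i \in s -> (f i %% 3 = 1)%N) ->
  \prod_(i <- s) third_pow beta (f i) = third_pow beta (\prod_(i <- s) f i)%N /\
  (\prod_(i <- s) f i %% 3 = 1)%N.
Proof.
move=> b3; elim: s => [|i s IH] f1; first by rewrite !big_nil.
rewrite !big_cons; have [j js|IH1 IH2] := IH; first by rewrite f1 // inE js orbT.
have fi : (f i %% 3 = 1)%N by rewrite f1 ?mem_head.
by rewrite IH1 third_powM // -modnMm fi IH2.
Qed.

Lemma third_powX beta N k : beta ^+ 3 = 1 -> (N %% 3 = 1)%N ->
  third_pow beta (N ^ k) = third_pow beta N ^+ k.
Proof.
move=> b3 N1; elim: k => [|k IH]; first by [].
rewrite expnS exprS third_powM // ?IH // -modnXm N1 exp1n //.
Qed.

Lemma mu3_neq beta : beta \in [:: 1; omega; omega ^+ 2] -> beta \in mu03.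
Proof. by rewrite !inE => /or3P[] /eqP ->. Qed.

Lemma mu3_cube beta : beta \in [:: 1; omega; omega ^+ 2] -> beta ^+ 3 = 1.
Proof. by rewrite !inE => /or3P[] /eqP ->. Qed.

Lemma mu3_norm beta : beta \in [:: 1; omega; omega ^+ 2] -> enorm beta = 1%N.
Proof. by rewrite !inE => /or3P[] /eqP ->. Qed.

Lemma eeqmod_enorm p x y : eeqmod p x y -> (enorm p %| enorm (x - y)%R)%N.
Proof. by case=> q ->; rewrite enormM dvdn_mull. Qed.

(** Distinct elements of 0, 1, omega, omega^2 differ by an element of norm 1 or 3, which p cannot
    divide; so the power of beta, already a cube root of unity, is the value selected. *)
Lemma cubic_prime_root_of_unity beta p : beta \in [:: 1; omega; omega ^+ 2] ->
  (1 < enorm p)%N -> ~~ (3 %| enorm p)%N -> cubic_prime beta p = third_pow beta (enorm p).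
Proof.
move=> hb p1 p3; rewrite /cubic_prime /third_pow.
set c := beta ^+ _; have : c \in [:: 1; omega; omega ^+ 2].
  rewrite /c; elim: (_ %/ _)%N => // m IH; rewrite exprS; move: hb IH.
  by rewrite !inE => /or3P[] /eqP -> /or3P[] /eqP ->.
have N1 x y : enorm (x - y) = 1%N -> `[< eeqmod p x y >] = false.
  move=> xy; apply/asboolP => /eeqmod_enorm; rewrite xy dvdn1 => /eqP h.
  by rewrite h in p1.
have N3 x y : enorm (x - y) = 3%N -> `[< eeqmod p x y >] = false.
  move=> xy; apply/asboolP => /eeqmod_enorm; rewrite xy => h.
  have := primeP (isT : prime 3) => -[_ /(_ _ h)] /orP[] /eqP h'.
    by rewrite h' in p1.
  by rewrite h' in p3.
have E0 x : `[< eeqmod p x x >] = true.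
  by apply/asboolP; exists 0; rewrite subrr mul0r.
rewrite !inE => /or3P[] /eqP ->.
- by rewrite N1 // E0.
- by rewrite N1 // N3 // E0.
- by rewrite N1 // N3 // N3.
Qed.

(** The symbol at each prime factor depends only on its norm, multiplicatively, so every
    factorization of alpha gives the value at the norm alpha^2. *)
Lemma cubic_root_of_unity beta alpha : beta \in [:: 1; omega; omega ^+ 2] ->
  (0 < alpha)%N -> ~~ (3 %| alpha)%N ->
  cubic beta alpha%:R = third_pow beta (alpha ^ 2).
Proof.
move=> hb a0 a3; rewrite /cubic /efactors.
have al0 : alpha%:R != 0 :> eis by rewrite -enorm_eq0 enorm_natr expn_eq0 andbT -lt0n.
case: xgetP => [s _ [sp [u u1 su]]|none]; last first.
  have [s sp su] := eis_factorization al0.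
  by have := none s; case; split.
have N2 : (alpha ^ 2 = \prod_(p <- s) enorm p)%N.
  have -> : (\prod_(p <- s) enorm p)%N = enorm (\prod_(p <- s) p).
    by elim: (s) => [|p t IH]; rewrite ?big_nil // !big_cons enormM IH.
  have := congr1 enorm su; rewrite enorm_natr enormM.
  by have /eunitE -> := u1; rewrite mul1n.
have p3 p : p \in s -> ~~ (3 %| enorm p)%N.
  move=> ps; apply: contra a3 => p3.
  have : (3 %| alpha ^ 2)%N by rewrite N2 (big_rem p) //= dvdn_mulr.
  by rewrite Euclid_dvdX // => /andP[].
have p1 p : p \in s -> (enorm p %% 3 = 1)%N.
  move=> ps; have := p3 p ps; rewrite /dvdn; have := enorm_mod3 p.
  have : (enorm p %% 3 < 3)%N by rewrite ltn_mod.
  by case: (_ %% _)%N => [|[|[|]]].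
rewrite N2; have [<- _] := third_pow_prod (mu3_cube hb) p1.
apply: eq_big_seq => p ps; rewrite cubic_prime_root_of_unity ?p3 //.
have [pz pu _] := sp p ps.
have : enorm p <> 1%N by move/eunitE.
have : enorm p <> 0%N by move/eqP; rewrite enorm_eq0 => /eqP.
by case: (enorm p) => [|[|]].
Qed.

Lemma cubic_dual_root_of_unity beta q : beta \in [:: 1; omega; omega ^+ 2] ->
  prime q -> q != 3%N -> cubic_dual q beta = third_pow beta (q ^ 2).
Proof.
move=> hb q_pr q3; have wr := Fpbar_omega_root q.
rewrite /cubic_dual -ev_norm // mu3_norm // mulr1 -evX // ev_lift3K //.
  by rewrite -(dvdn_pcharf (pchar_Fpbar q_pr)) dvdn_prime2.
exact/mu03X/mu3_neq.
Qed.

Lemma prod_primes_logn n : (0 < n)%N -> n = (\prod_(q <- primes n) q ^ logn q n)%N.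
Proof. by move=> n0; rewrite {1}(prod_prime_decomp n0) prime_decompE big_map. Qed.

Lemma cubic_prime_prod pi (s : seq nat) (f : nat -> nat) :
  prime (enorm pi) -> primary pi ->
  cubic_prime (\prod_(q <- s) q ^ f q)%N%:R pi =
  \prod_(q <- s) cubic_prime q%:R pi ^+ f q.
Proof.
move=> p_pr pip; have cM x y : cubic_prime (x * y) pi = cubic_prime x pi * cubic_prime y pi.
  have wr := res_omega_root p_pr.
  rewrite !cubic_primeE // evM // exprMn lift3M //; try exact: Fp_pow_mu3.
  rewrite -(dvdn_pcharf (pchar_Fp p_pr)) dvdn_prime2 //.
  by apply/negP => /eqP p3; have := enorm_primary pip; rewrite p3.
have c1 : cubic_prime 1 pi = 1 by rewrite cubic_primeE // ev1 expr1n lift31.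
have cX x n : cubic_prime (x ^+ n) pi = cubic_prime x pi ^+ n.
  by elim: n => [|n IH]; rewrite ?expr0 // !exprS cM IH.
elim: s => [|q s IH]; first by rewrite !big_nil.
by rewrite !big_cons natrM cM IH natrX cX.
Qed.

(** * The symbols of alpha as functions of B *)

Section Symbols.
Variables (alpha : nat) (r A B : int) (beta : eis).
Let pi' := Eis A B.
Let pi := beta ^+ 2 * pi'.
Let p := enorm pi.
Hypotheses (alpha_gt0 : (0 < alpha)%N) (alpha6 : coprime alpha 6)
  (hA : r + B = 2 * A) (hb : beta \in [:: 1; omega; omega ^+ 2])
  (p_pr : prime p) (pi_primary : primary pi) (p_alpha : ~~ (p %| alpha)%N).

Let lattice_pointE : lattice_point r B = 2%:~R * pi'.
Proof. by rewrite eis_intr; apply: eisP; rewrite !eisE /= ?hA; ring. Qed.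

Let two_unit q : odd q -> prime q -> ~~ (q%:Z %| 2)%Z.
Proof.
move=> q_odd q_pr; rewrite dvdzE /=; apply/negP => /(@dvdn_leq q 2 isT).
by rewrite leqNgt odd_prime_gt2.
Qed.

Let neq_p q : q \in primes alpha -> q != p.
Proof.
rewrite mem_primes => /and3P[_ _ qa]; apply: contraNneq p_alpha => <-.
exact: qa.
Qed.

(** Each (q / pi)_3 is the dual symbol of pi = beta^2 pi', where 2 pi' = r + B sqrt(-3). The integer
    2 has dual symbol 1, and beta^2 gives the square of the symbol of beta. *)
Lemma cubic_prime_alpha :
  cubic_prime alpha%:R pi = cubic beta alpha%:R ^+ 2 * lattice_cub alpha r B.
Proof.
have a3 : ~~ (3 %| alpha)%N.
  have := alpha6; rewrite -[6%N]/(2 * 3)%N coprimeMr => /andP[_].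
  by rewrite coprime_sym prime_coprime.
rewrite cubic_root_of_unity // {1}(prod_primes_logn alpha_gt0) cubic_prime_prod //.
have -> : third_pow beta (alpha ^ 2) =
    \prod_(q <- primes alpha) third_pow beta (q ^ 2) ^+ logn q alpha.
  have q21 q : q \in primes alpha -> (q ^ 2 %% 3 = 1)%N.
    case/(prime_factor6 alpha_gt0 alpha6) => q_pr _ q3.
    have : (q %% 3 != 0)%N by rewrite -/(3 %| q)%N dvdn_prime2 // eq_sym.
    have : (q %% 3 < 3)%N by rewrite ltn_mod.
    by rewrite -modnXm; case: (q %% 3)%N => [|[|[|]]].
  have q1 q : q \in primes alpha -> ((q ^ 2) ^ logn q alpha %% 3 = 1)%N.
    by move=> /q21 q2; rewrite -modnXm q2 exp1n.
  have [E _] := third_pow_prod (mu3_cube hb) q1.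
  have -> : (alpha ^ 2 = \prod_(q <- primes alpha) (q ^ 2) ^ logn q alpha)%N.
    rewrite {1}(prod_primes_logn alpha_gt0).
    by elim: (primes _) => [|q t IH]; rewrite ?big_nil // !big_cons expnMn IH expnAC.
  by rewrite -E; apply: eq_big_seq => q qs; rewrite third_powX ?mu3_cube ?q21.
rewrite -prodrXl /lattice_cub -big_split; apply: eq_big_seq => q qs /=.
have [q_pr q_odd q3] := prime_factor6 alpha_gt0 alpha6 qs.
rewrite (cubic_prime_reciprocity p_pr pi_primary q_pr q3 (neq_p qs) (Fpbar_omega_root q)).
rewrite -/(cubic_dual q pi) /pi !cubic_dualM // lattice_pointE cubic_dualM //.
rewrite cubic_dual_int // ?two_unit // mul1r -(cubic_dual_root_of_unity hb q_pr q3).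
by rewrite -exprM [(_ * 2)%N]mulnC exprM exprMn.
Qed.

Lemma legendre_alpha : odd p ->
  legendre alpha%:Z p = (-1) ^+ (p.-1./2 * alpha.-1./2) * lattice_sgn alpha r B.
Proof.
move=> p_odd.
(* For odd a and b, (a b - 1) / 2 and (a - 1) / 2 + (b - 1) / 2 have the same parity; oddness of the
   partial products is carried along so that the signs multiply. *)
have E (s : seq nat) : {subset s <= primes alpha} ->
   legendre (\prod_(q <- s) q ^ logn q alpha)%N%:Z p =
   (-1) ^+ (p.-1./2 * (\prod_(q <- s) q ^ logn q alpha)%N.-1./2) *
   \prod_(q <- s) legendre_norm q (lattice_point r B) ^+ logn q alpha /\
   odd (\prod_(q <- s) q ^ logn q alpha)%N.
  elim: s => [|q s IH] sub; first by rewrite !big_nil legendre1 // muln0.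
  have qs : q \in primes alpha by rewrite sub ?mem_head.
  have [q_pr q_odd q3] := prime_factor6 alpha_gt0 alpha6 qs.
  have [|IH1 IH2] := IH; first by move=> t ts; rewrite sub // inE ts orbT.
  have qp : p != q by rewrite eq_sym neq_p.
  rewrite !big_cons; set m := (\prod_(q <- s) _)%N in IH1 IH2 *.
  set k := logn q alpha.
  have ln : legendre_norm q (lattice_point r B) = legendre p%:Z q.
    rewrite lattice_pointE legendre_normM // /legendre_norm enorm_intr.
    rewrite -mulnn PoszM -expr2 legendreX // legendre_sqr ?two_unit // mul1r.
    by rewrite /p /pi enormM enormX (mu3_norm hb) exp1n mul1n.
  have sgnM a b : odd a -> odd b -> (-1) ^+ (p.-1./2 * (a * b).-1./2) =
     (-1) ^+ (p.-1./2 * a.-1./2) * (-1) ^+ (p.-1./2 * b.-1./2) :> int.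
    move=> ao bo; rewrite -exprD -mulnDr -signr_odd -[in RHS]signr_odd !oddM.
    congr (_ ^+ nat_of_bool (_ && _)).
    have [x ->] : exists x, a = (2 * x).+1 by exists a./2; lia.
    have [y ->] : exists y, b = (2 * y).+1 by exists b./2; lia.
    have -> : (((2 * x).+1 * (2 * y).+1).-1./2 = 2 * (x * y) + x + y)%N by lia.
    by rewrite -![_.+1.-1]/(2 * _)%N !mul2n !doubleK -!muln2 !oddD oddM andbF.
  have sgnX a n : odd a -> (-1) ^+ (p.-1./2 * (a ^ n).-1./2) =
     ((-1) ^+ (p.-1./2 * a.-1./2)) ^+ n :> int.
    move=> ao; elim: n => [|n IHn]; first by rewrite muln0.
    by rewrite expnS sgnM ?oddX ?ao ?orbT // IHn exprS.
  split; last by rewrite oddM oddX q_odd orbT.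
  rewrite PoszM legendreM // IH1 sgnM ?oddX ?q_odd ?orbT // sgnX //.
  have -> : (q ^ k)%N%:Z = q%:Z ^+ k by rewrite -!natz natrX.
  rewrite legendreX // (quadratic_reciprocity p_pr p_odd q_pr q_odd qp) ln exprMn.
  by rewrite mulrACA.
by have [] := E (primes alpha) (fun _ h => h); rewrite -prod_primes_logn.
Qed.

End Symbols.

(** * Congruence conditions *)

Lemma edvd_natr n z : edvd n%:R z <-> (n%:Z %| ere z)%Z /\ (n%:Z %| eim z)%Z.
Proof.
rewrite eis_natr; split=> [[q ->]|[/dvdzP[x hx] /dvdzP[y hy]]].
  rewrite !eisE /= !mulr0 subr0 add0r subr0; split; exact: dvdz_mull.
by exists (Eis x y); apply: eisP; rewrite !eisE /= ?hx ?hy; ring.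
Qed.

Lemma eeqmod_natr n x y : eeqmod n%:R x y <->
  (n%:Z %| ere x - ere y)%Z /\ (n%:Z %| eim x - eim y)%Z.
Proof. by rewrite /eeqmod edvd_natr. Qed.

Lemma eeqmod_mulr m u x y : eeqmod m x y -> eeqmod m (u * x) (u * y).
Proof. by case=> q h; exists (u * q); rewrite -mulrBr h mulrA. Qed.

Lemma eeqmod_unit m u v x y : v * u = 1 -> eeqmod m (u * x) (u * y) <-> eeqmod m x y.
Proof.
move=> vu; split=> [h|]; last exact: eeqmod_mulr.
by rewrite -[x]mul1r -[y]mul1r -vu -!mulrA; exact: eeqmod_mulr.
Qed.

(* The element p with beta p of trace r and omega-coordinate B (r + B even). *)
Definition eis_point (beta : eis) (r B : int) : eis :=
  beta ^+ 2 * Eis ((r + B) %/ 2)%Z B.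

Section Classes.
Variables (r : int) (k : nat) (a0 b0 A0 B0 : int).

(* The conditions on p = eis_point beta r B modulo 2 and on N(p) modulo 8, when
   beta gamma = a0 + b0 omega, as 4 N(p) = r^2 + 3 B^2. *)
Definition class16 (B : int) : bool :=
  [&& (4 %| r + B - 2 * a0)%Z, (2 %| B - b0)%Z
    & (32 %| r ^+ 2 + 3 * B ^+ 2 - (8 * k + 4)%N%:Z)%Z].

(* The condition on p modulo 9, when beta (2 + 3 eta) = A0 + B0 omega. *)
Definition class9 (B : int) : bool := (9 %| r + B - 2 * A0)%Z && (9 %| B - B0)%Z.

Lemma class16_parity B : class16 B -> (2 %| r + B)%Z.
Proof. by case/and3P => h _ _; move: h; lia. Qed.

(** The shift changes 3 B^2 by 96 B t + 768 t^2, a multiple of 32. *)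
Lemma class16_periodic B t : class16 (B + 16 * t) = class16 B.
Proof.
rewrite /class16; congr [&& _, _ & _].
- by rewrite [LHS](_ : _ = (4 %| (r + B - 2 * a0) + 4 * (4 * t))%Z); [lia|congr (_ %| _)%Z; ring].
- by rewrite [LHS](_ : _ = (2 %| (B - b0) + 2 * (8 * t))%Z); [lia|congr (_ %| _)%Z; ring].
rewrite [LHS](_ : _ = (32 %| (r ^+ 2 + 3 * B ^+ 2 - (8 * k + 4)%N%:Z) +
  32 * (3 * B * t + 24 * t ^+ 2))%Z); [lia|congr (_ %| _)%Z; ring].
Qed.

Lemma class9_periodic B t : class9 (B + 9 * t) = class9 B.
Proof. by rewrite /class9; congr (_ && _); lia. Qed.

(** The second condition fixes B modulo 9; the first one then says that r has the prescribed trace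
    modulo 9. *)
Lemma sum_class9 : (\sum_(i < 9) class9 i%:Z = (9 %| (r - (2 * A0 - B0))%R)%Z)%N.
Proof.
have B9 : 0 <= (B0 %% 9)%Z < 9 by lia.
have j9 : (`|(B0 %% 9)%Z| < 9)%N by lia.
rewrite (bigD1 (Ordinal j9)) //= big1.
  rewrite addn0.
  have Ej : (`|(B0 %% 9)%Z|%N)%:Z = (B0 %% 9)%Z by lia.
  rewrite /class9 /= Ej; have := divz_eq B0 9.
  move: (_ %/ _)%Z (_ %% _)%Z => b j ->; congr nat_of_bool.
  have -> : (9 %| j - (b * 9 + j))%Z by lia.
  by rewrite andbT; lia.
move=> i /eqP ij; rewrite /class9; case: andP => // -[_ h]; case: ij.
by apply: val_inj => /=; have := ltn_ord i; lia.
Qed.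
End Classes.

(* The 2-adic part of Delta, in terms of beta gamma = a0 + b0 omega. *)
Definition Delta2 (r : int) (k : nat) (a0 b0 : int) : nat :=
  if [&& (8 %| r)%Z, k == 1%N & ~~ (2 %| a0)%Z && (2 %| b0)%Z] then 8
  else if [&& (8 %| r - 4)%Z, k == 3%N & ~~ (2 %| a0)%Z && (2 %| b0)%Z] then 8
  else if [&& (4 %| r - 2)%Z, (2 %| k)%N & ~~ (2 %| a0)%Z && (2 %| b0)%Z] then 4
  else if ~~ (2 %| r)%Z && ~~ (2 %| b0)%Z then 1 else 0.

Definition xi2 (r : int) : nat := if (2 %| r)%Z then 1 else 2.

Lemma class16_mod r k a0 b0 B :
  class16 r k a0 b0 B = class16 (r %% 16)%Z k (a0 %% 2)%Z (b0 %% 2)%Z B.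
Proof.
have hr := divz_eq r 16; have ha := divz_eq a0 2; have hb := divz_eq b0 2.
move: (_ %/ _)%Z (_ %% _)%Z hr => r' r1 ->.
move: (_ %/ _)%Z (_ %% _)%Z ha => a' a1 ->.
move: (_ %/ _)%Z (_ %% _)%Z hb => b' b1 ->.
rewrite /class16; congr [&& _, _ & _].
- by lia.
- by lia.
rewrite [LHS](_ : _ = (32 %| (r1 ^+ 2 + 3 * B ^+ 2 - (8 * k + 4)%N%:Z) +
  32 * (8 * r' ^+ 2 + r' * r1))%Z); [lia|congr (_ %| _)%Z; ring].
Qed.

Lemma Delta2_mod r k a0 b0 :
  Delta2 r k a0 b0 = Delta2 (r %% 16)%Z k (a0 %% 2)%Z (b0 %% 2)%Z.
Proof.
rewrite /Delta2.
have -> : (8 %| r)%Z = (8 %| (r %% 16)%Z)%Z by lia.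
have -> : (8 %| r - 4)%Z = (8 %| (r %% 16)%Z - 4)%Z by lia.
have -> : (4 %| r - 2)%Z = (4 %| (r %% 16)%Z - 2)%Z by lia.
have -> : (2 %| r)%Z = (2 %| (r %% 16)%Z)%Z by lia.
have -> : (2 %| a0)%Z = (2 %| (a0 %% 2)%Z)%Z by lia.
by have -> : (2 %| b0)%Z = (2 %| (b0 %% 2)%Z)%Z by lia.
Qed.

(** Both sides depend only on k, on r modulo 16 and on a0, b0 modulo 2, so the identity is evaluated
    in all cases. The excluded pair is beta gamma = 0 modulo 2. *)
Lemma sum_class16 r k a0 b0 : (k <= 3)%N -> ~~ ((2 %| a0)%Z && (2 %| b0)%Z) ->
  (xi2 r * Delta2 r k a0 b0 = 2 * \sum_(i < 16) class16 r k a0 b0 i%:Z)%N.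
Proof.
move=> k3 ab.
under eq_bigr do rewrite class16_mod.
rewrite Delta2_mod.
have -> : xi2 r = xi2 (r %% 16)%Z by rewrite /xi2; congr (if _ then _ else _); lia.
have {}ab : ~~ ((2 %| (a0 %% 2)%Z)%Z && (2 %| (b0 %% 2)%Z)%Z) by lia.
have [r1 [-> hr]] : exists r1 : nat, (r %% 16)%Z = r1%:Z /\ (r1 < 16)%N.
  by exists `|(r %% 16)%Z|%N; lia.
have [a1 [Ea ha]] : exists a1 : nat, (a0 %% 2)%Z = a1%:Z /\ (a1 < 2)%N.
  by exists `|(a0 %% 2)%Z|%N; lia.
have [b1 [Eb hb]] : exists b1 : nat, (b0 %% 2)%Z = b1%:Z /\ (b1 < 2)%N.
  by exists `|(b0 %% 2)%Z|%N; lia.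
rewrite Ea Eb in ab *; move: ab.
have : all (fun r1 => all (fun k => all (fun a1 => all (fun b1 =>
   ~~ ((2 %| a1%:Z)%Z && (2 %| b1%:Z)%Z) ==>
   (xi2 r1%:Z * Delta2 r1%:Z k a1%:Z b1%:Z ==
    2 * sumn [seq (class16 r1%:Z k a1%:Z b1%:Z i%:Z : nat) | i <- iota 0 16])%N)
   (iota 0 2)) (iota 0 2)) (iota 0 4)) (iota 0 16) by vm_compute.
move/allP/(_ r1); rewrite mem_iota hr => /(_ isT)/allP/(_ k); rewrite mem_iota ltnS k3.
move=> /(_ isT)/allP/(_ a1); rewrite mem_iota ha => /(_ isT)/allP/(_ b1).
rewrite mem_iota hb => /(_ isT)/implyP h ab; rewrite (eqP (h ab)).
by rewrite sumnE big_map -[iota 0 16]/(index_iota 0 16) big_mkord.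
Qed.

Definition xi_nat (r : int) : nat := if (3 %| r)%Z then 0 else xi2 r.

Lemma dvdz_congr (m x y : int) : (m %| x - y)%Z -> (m %| x)%Z = (m %| y)%Z.
Proof. by move=> h; rewrite -{1}[x](subrK y) (rpredDl _ h). Qed.

Lemma odd_dvdz (x : int) : (2 %| x - 1)%Z = ~~ (2 %| x)%Z.
Proof. lia. Qed.

(** The moduli are 9 times 8, 4 or 2. As 24 is -3 modulo 9 and 0 modulo 8, every r_j is Tr(beta (2 +
    3 eta)) modulo 9, while c_1 and c_2 are 0 and 4 modulo 8, c_3 is 2 modulo 4 and c_4 is odd. *)
Lemma Delta_eq (r : int) (k : nat) (beta gamma eta : eis) :
  (k <= 3)%N -> beta \in [:: 1; omega; omega ^+ 2] ->
  let bg := beta * gamma in let bt := beta * (2 + 3 * eta) in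
  Delta r k gamma beta eta =
  if (9 %| r - (2 * ere bt - eim bt))%Z then Delta2 r k (ere bg) (eim bg) else 0.
Proof.
move=> k3 hb bg bt; have b3 := mu3_cube hb.
have bb : beta ^+ 2 * beta = 1 by rewrite -exprSr.
have gE w : `[< eeqmod 2 gamma w >] =
    (2 %| ere bg - ere (beta * w))%Z && (2 %| eim bg - eim (beta * w))%Z.
  by apply/asboolP/andP; rewrite -(eeqmod_unit 2 gamma w bb) (eeqmod_natr 2).
have E1 : beta * beta ^+ 2 = 1 by rewrite -exprS.
have E2 w : beta * (beta ^+ 2 * w) = w by rewrite mulrA E1 mul1r.
have re1 : ere 1 = 1 by [].
have im1 : eim 1 = 0 by [].
have rew : ere omega = 0 by [].
have imw : eim omega = 1 by [].
have re1w : ere (1 + omega) = 1 by [].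
have im1w : eim (1 + omega) = 1 by [].
rewrite /Delta !gE E1 !E2 !eqz_mod_dvd re1 im1 rew imw re1w im1w.
have -> : 2 * ere bt - eim bt = 2 * etr beta + 3 * etr (beta * eta).
  rewrite /bt (eis_natr 2) (eis_natr 3) /etr !eisE /=; ring.
have Ec : (etr beta, Defs.c1 beta, Defs.c2 beta, Defs.c3 beta, Defs.c4 beta) = (2, 40, 4, 22, 13) \/
          (etr beta, Defs.c1 beta, Defs.c2 beta, Defs.c3 beta, Defs.c4 beta) = (-1, 16, 52, 34, 7).
  by move: hb; rewrite !inE => /or3P[] /eqP ->; [left|right|right].
rewrite /rj; move: (etr (beta * eta)) (ere bg) (eim bg) => t a0 b0.
have k1 : (k == 1 %[mod 4])%N = (k == 1)%N by lia.
have k3' : (k == 3 %[mod 4])%N = (k == 3)%N by lia.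
rewrite k1 k3' /Delta2.
have -> : (2 %| a0 - 1)%Z = ~~ (2 %| a0)%Z by lia.
have -> : (2 %| b0 - 1)%Z = ~~ (2 %| b0)%Z by lia.
rewrite !subr0.
have split_mod (m : int) x : coprimez 9 m ->
    (9 * m %| x)%Z = (9 %| x)%Z && (m %| x)%Z.
  by move=> m9; rewrite Gauss_dvdz.
have h9 c : (9 %| 2 * etr beta - c)%Z ->
    (9 %| r - (c - 24 * t))%Z = (9 %| r - (2 * etr beta + 3 * t))%Z.
  move=> h; apply: dvdz_congr.
  have -> : r - (c - 24 * t) - (r - (2 * etr beta + 3 * t)) = 2 * etr beta - c + 9 * (3 * t) by ring.
  by rewrite rpredD // dvdz_mulr.
have hm (m c e : int) : (m %| 24)%Z -> (m %| e - c)%Z ->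
    (m %| r - (c - 24 * t))%Z = (m %| r - e)%Z.
  move=> m24 h; apply: dvdz_congr.
  have -> : r - (c - 24 * t) - (r - e) = e - c + 24 * t by ring.
  by rewrite rpredD // dvdz_mulr.
have h1 : (72 %| r - (Defs.c1 beta - 24 * t))%Z =
  (9 %| r - (2 * etr beta + 3 * t))%Z && (8 %| r)%Z.
  by rewrite (split_mod 8) // h9 ?(hm 8 _ 0) ?subr0 //; case: Ec => -[e1 e2 e3 e4 e5];
    rewrite ?e1 ?e2 ?e3 ?e4 ?e5.
have h2 : (72 %| r - (Defs.c2 beta - 24 * t))%Z =
  (9 %| r - (2 * etr beta + 3 * t))%Z && (8 %| r - 4)%Z.
  by rewrite (split_mod 8) // h9 ?(hm 8 _ 4) //; case: Ec => -[e1 e2 e3 e4 e5];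
    rewrite ?e1 ?e2 ?e3 ?e4 ?e5.
have h3 : (36 %| r - (Defs.c3 beta - 24 * t))%Z =
  (9 %| r - (2 * etr beta + 3 * t))%Z && (4 %| r - 2)%Z.
  by rewrite (split_mod 4) // h9 ?(hm 4 _ 2) //; case: Ec => -[e1 e2 e3 e4 e5];
    rewrite ?e1 ?e2 ?e3 ?e4 ?e5.
have h4 : (18 %| r - (Defs.c4 beta - 24 * t))%Z =
  (9 %| r - (2 * etr beta + 3 * t))%Z && ~~ (2 %| r)%Z.
  rewrite (split_mod 2) // h9 ?(hm 2 _ 1) //; try by case: Ec => -[e1 e2 e3 e4 e5];
    rewrite ?e1 ?e2 ?e3 ?e4 ?e5.
  by congr andb; rewrite odd_dvdz.
rewrite h1 h2 h3 h4; case: (9 %| _)%Z => //=.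
by rewrite -andb_orl; case: (2 %| a0)%Z; rewrite ?andbT.
Qed.

Lemma xi_Delta (r : int) (k : nat) (beta gamma eta : eis) :
  (k <= 3)%N -> beta \in [:: 1; omega; omega ^+ 2] ->
  (exists delta : eis, eeqmod 2 (gamma * delta) 1) ->
  let bg := beta * gamma in let bt := beta * (2 + 3 * eta) in
  (xi_nat r * Delta r k gamma beta eta =
   2 * ((\sum_(i < 16) class16 r k (ere bg) (eim bg) i%:Z) *
        \sum_(i < 9) class9 r (ere bt) (eim bt) i%:Z))%N.
Proof.
move=> k3 hb [delta gd] bg bt.
rewrite Delta_eq // -/bg -/bt sum_class9.
case: ifPn => h; last by rewrite !muln0.
(* Modulo 3, r is 2 Tr(beta) with Tr(beta) = 2 or -1, hence nonzero. *)
have -> : xi_nat r = xi2 r.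
  rewrite /xi_nat ifN //; move: h.
  have -> : 2 * ere bt - eim bt = 2 * etr beta + 3 * etr (beta * eta).
    rewrite /bt (eis_natr 2) (eis_natr 3) /etr !eisE /=; ring.
  have : etr beta = 2 \/ etr beta = -1.
    by move: hb; rewrite !inE => /or3P[] /eqP ->; [left|right|right].
  by case=> ->; lia.
rewrite muln1 sum_class16 //; apply/negP => /andP[h1 h2].
have : edvd 2%:R beta.
  have [q bgq] : edvd 2%:R bg by apply/edvd_natr.
  have [s gds] := gd; exists (q * delta - s * beta).
  have -> : (q * delta - s * beta) * 2%:R = (q * 2%:R) * delta - (s * 2%:R) * beta by ring.
  by rewrite -bgq -gds /bg; ring.
case/edvd_natr; move: hb; rewrite !inE => /or3P[] /eqP -> //=.
Qed.

Lemma enorm_eis_point beta r B : beta \in [:: 1; omega; omega ^+ 2] ->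
  (2 %| r + B)%Z -> 4 * (enorm (eis_point beta r B))%:Z = r ^+ 2 + 3 * B ^+ 2.
Proof.
move=> hb rB; rewrite /eis_point enormM enormX mu3_norm // exp1n mul1n enormZ /=.
have /dvdzP[A hA] := rB; rewrite hA mulzK //.
have -> : r = A * 2 - B by rewrite -hA; ring.
by ring.
Qed.

Lemma mul_beta_eis_point beta r B : beta \in [:: 1; omega; omega ^+ 2] ->
  beta * eis_point beta r B = Eis ((r + B) %/ 2)%Z B.
Proof. by move=> hb; rewrite /eis_point mulrA -exprS mu3_cube // mul1r. Qed.

Lemma etr_eis_point beta r B : beta \in [:: 1; omega; omega ^+ 2] ->
  (2 %| r + B)%Z -> etr (beta * eis_point beta r B) = r.
Proof. by move=> hb rB; rewrite mul_beta_eis_point // /etr /=; lia. Qed.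

Lemma eis_point_surj beta r p : beta \in [:: 1; omega; omega ^+ 2] ->
  etr (beta * p) = r ->
  (2 %| r + eim (beta * p))%Z /\ p = eis_point beta r (eim (beta * p)).
Proof.
move=> hb tp; have rB : r + eim (beta * p) = ere (beta * p) * 2 by rewrite -tp /etr; ring.
split; first by rewrite rB dvdz_mull.
rewrite /eis_point rB mulzK //.
have -> : Eis (ere (beta * p)) (eim (beta * p)) = beta * p by case: (beta * p).
by rewrite mulrA -exprSr mu3_cube // mul1r.
Qed.

Lemma eeqmod9_primary eta p : eeqmod 9 p (2 + 3 * eta) -> primary p.
Proof.
move/(eeqmod_natr 9); rewrite (eis_natr 2) (eis_natr 3) !eisE /= => -[h1 h2].
by split; move: h1 h2; lia.
Qed.

Lemma class16P beta gamma r k B : beta \in [:: 1; omega; omega ^+ 2] -> (2 %| r + B)%Z ->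
  (class16 r k (ere (beta * gamma)) (eim (beta * gamma)) B <->
   (enorm (eis_point beta r B) = (2 * k + 1)%N %[mod 8])%N /\
   eeqmod 2 (eis_point beta r B) gamma).
Proof.
move=> hb rB; have b1 : beta ^+ 2 * beta = 1 by rewrite -exprSr mu3_cube.
rewrite -(eeqmod_unit 2 _ _ b1) mul_beta_eis_point // (eeqmod_natr 2) /=.
have := enorm_eis_point hb rB; move: (enorm _) => n hn.
rewrite /class16 -hn; move: (ere (beta * gamma)) (eim (beta * gamma)) => a b.
split=> [/and3P[h1 h2 h3]|[h1 [h2 h3]]]; last first.
  by apply/and3P; split; [move: rB h2; lia|done|move: h1; lia].
by split; [move: h3; lia|split=> //; move: h1 rB; lia].
Qed.

Lemma class9P beta eta r B : beta \in [:: 1; omega; omega ^+ 2] -> (2 %| r + B)%Z ->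
  (class9 r (ere (beta * (2 + 3 * eta))) (eim (beta * (2 + 3 * eta))) B <-> eeqmod 9 (eis_point beta r B) (2 + 3 * eta)).
Proof.
move=> hb rB; have b1 : beta ^+ 2 * beta = 1 by rewrite -exprSr mu3_cube.
rewrite -(eeqmod_unit 9 _ _ b1) mul_beta_eis_point // (eeqmod_natr 9) /=.
rewrite /class9; move: (ere (beta * (2 + 3 * eta))) (eim (beta * (2 + 3 * eta))) => a b.
split=> [/andP[h1 h2]|[h1 h2]]; last by apply/andP; split; move: rB h1; lia.
by split=> //; move: h1 rB; lia.
Qed.

Section Good.
Variables (alpha : nat) (r : int) (beta gamma eta : eis) (d k : nat) (eps : int).
Hypotheses (alpha_gt0 : (0 < alpha)%N) (alpha6 : coprime alpha 6)
  (hb : beta \in [:: 1; omega; omega ^+ 2]) (heps : eps = 1 \/ eps = -1).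

Let bg := beta * gamma.
Let bt := beta * (2 + 3 * eta).

(** The value of [lattice_sgn] for which the Legendre symbol is eps: the reciprocity sign is
    determined by k because (N(p) - 1) / 2 has the parity of k. *)
Definition target_sgn : int := eps * (-1) ^+ ((k * (alpha - 1)) %/ 2).
(** The solution x of c^2 x = omega^d, where c is the cubic symbol of beta and c^3 = 1. *)
Definition target_cub : eis := omega ^+ d * cubic beta alpha%:R.

Definition good (B : int) : bool :=
  [&& class16 r k (ere bg) (eim bg) B, class9 r (ere bt) (eim bt) B &
      (lattice_sgn alpha r B == target_sgn) && (lattice_cub alpha r B == target_cub)].

Definition Econd (p : eis) : Prop :=
  [/\ etr (beta * p) = r,
      cubic_prime alpha%:R p = omega ^+ d &
      legendre alpha%:Z (enorm p) = eps] /\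
  [/\ enorm p = (2 * k + 1)%N %[mod 8],
      eeqmod 2 p gamma &
      eeqmod 9 p (2 + 3 * eta)].

Lemma good_parity B : good B -> (2 %| r + B)%Z.
Proof. by case/and3P => /class16_parity. Qed.

Lemma cubic_alpha_mu3 : cubic beta alpha%:R \in [:: 1; omega; omega ^+ 2].
Proof.
rewrite cubic_root_of_unity //; last first.
  have := alpha6; rewrite -[6%N]/(2 * 3)%N coprimeMr => /andP[_].
  by rewrite coprime_sym prime_coprime.
rewrite /third_pow; elim: (_ %/ _)%N => // m IH; rewrite exprS; move: hb IH.
by rewrite !inE => /or3P[] /eqP -> /or3P[] /eqP ->.
Qed.

Lemma target_cub_mu3 : target_cub \in mu03 /\ target_cub != 0.
Proof.
have := cubic_alpha_mu3; rewrite /target_cub; move: (cubic _ _) => c.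
have : omega ^+ d \in [:: 1; omega; omega ^+ 2].
  by elim: d => // m; rewrite (exprS _ m); move: (omega ^+ m) => z; rewrite !inE => /or3P[] /eqP ->.
by rewrite !inE => /or3P[] /eqP -> /or3P[] /eqP ->.
Qed.

Lemma target_sgn_range : target_sgn = 1 \/ target_sgn = -1.
Proof.
rewrite /target_sgn -signr_odd; case: odd; case: heps => ->; rewrite /= ?expr0 ?expr1;
  by [left|right].
Qed.

Lemma good_symbols B : (2 %| r + B)%Z -> prime (enorm (eis_point beta r B)) ->
  primary (eis_point beta r B) ->
  (enorm (eis_point beta r B) = (2 * k + 1)%N %[mod 8])%N ->
  ~~ (enorm (eis_point beta r B) %| alpha)%N ->
  (cubic_prime alpha%:R (eis_point beta r B) = omega ^+ d <->
    lattice_cub alpha r B = target_cub) /\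
  (legendre alpha%:Z (enorm (eis_point beta r B)) = eps <->
    lattice_sgn alpha r B = target_sgn).
Proof.
move=> rB p_pr pip pk pa.
have hA : r + B = 2 * ((r + B) %/ 2)%Z by lia.
have p_odd : odd (enorm (eis_point beta r B)) by move: pk; move: (enorm _) => n; lia.
rewrite /eis_point in p_pr pip pk pa p_odd *.
rewrite (cubic_prime_alpha alpha_gt0 alpha6 hA hb p_pr pip pa).
rewrite (legendre_alpha alpha_gt0 alpha6 hA hb p_pr pa p_odd).
split; rewrite ?/target_cub ?/target_sgn.
  have c3 := mu3_cube cubic_alpha_mu3; move: (cubic _ _) c3 => c c3.
  split=> [<-|->]; last by rewrite mulrCA -exprSr c3 mulr1.
  by rewrite mulrAC -exprSr c3 mul1r.
set n := enorm _ in pk p_odd *.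
have a_odd : odd alpha.
  by have := alpha6; rewrite -[6%N]/(2 * 3)%N coprimeMr coprimen2 => /andP[].
have -> : (-1) ^+ (n.-1./2 * alpha.-1./2) = (-1) ^+ (k * (alpha - 1) %/ 2) :> int.
  rewrite -signr_odd -[RHS]signr_odd; congr (_ ^+ nat_of_bool _).
  have -> : (k * (alpha - 1) %/ 2 = k * alpha.-1./2)%N.
    have [m ->] : exists m, alpha = (2 * m).+1 by exists alpha./2; lia.
    by rewrite subn1 -[_.+1.-1]/(2 * m)%N mul2n doubleK -mul2n mulnCA mulKn.
  by rewrite !oddM; congr (_ && _); move: pk; lia.
have s2 : (-1) ^+ (k * (alpha - 1) %/ 2) ^+ 2 = 1 :> int by rewrite sqrr_sign.
move: (_ ^+ (_ %/ 2)) s2 => s s2.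
split=> [<-|->]; last by rewrite mulrCA -expr2 s2 mulr1.
by rewrite mulrAC -expr2 s2 mul1r.
Qed.

(** Excludes good B whose norm is a prime divisor of alpha. On the other side of the correspondence
    such an element has Legendre symbol 0, which is not eps. *)
Lemma lattice_sgn_ramified B p : (2 %| r + B)%Z -> prime p ->
  (p %| enorm (eis_point beta r B))%N -> (p %| alpha)%N -> lattice_sgn alpha r B = 0.
Proof.
move=> rB p_pr pB pa; have ps : p \in primes alpha by rewrite mem_primes p_pr alpha_gt0.
have [_ p_odd p3] := prime_factor6 alpha_gt0 alpha6 ps.
rewrite /lattice_sgn (big_rem p) //=.
have -> : legendre_norm p (lattice_point r B) = 0.
  apply/eqP; rewrite legendre_norm_eq0 //.
  have -> : (p %| enorm (lattice_point r B))%N = (p%:Z %| (enorm (lattice_point r B))%:Z)%Z by [].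
  rewrite enorm_lattice_point -(enorm_eis_point hb rB) dvdz_mull //.
by rewrite expr0n gtn_eqF ?mul0r // logn_gt0.
Qed.

Lemma EcondP p : prime (enorm p) ->
  Econd p <-> exists2 B, p = eis_point beta r B & good B.
Proof.
move=> p_pr; split.
  case=> -[tp cp lp] [pk pg pe].
  have [rB pE] := eis_point_surj hb tp; move: (eim _) rB pE => B rB pE.
  exists B => //; rewrite pE in p_pr cp lp pk pg pe.
  have pa : ~~ (enorm (eis_point beta r B) %| alpha)%N.
    apply/negP => pa; case: heps; rewrite -lp /legendre ifT //.
  have [h1 h2] := good_symbols rB p_pr (eeqmod9_primary pe) pk pa.
  apply/and3P; split; first exact/class16P.
    exact/class9P.
  by apply/andP; split; apply/eqP; [apply/h2|apply/h1].
move=> [B pE gB]; have rB := good_parity gB; rewrite pE in p_pr *.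
case/and3P: gB => /(class16P _ _ hb rB)[pk pg] /(class9P _ hb rB) pe /andP[/eqP hs /eqP hc].
have pa : ~~ (enorm (eis_point beta r B) %| alpha)%N.
  apply/negP => pa; have := lattice_sgn_ramified rB p_pr (dvdnn _) pa.
  by rewrite hs; case: target_sgn_range => ->.
have [h1 h2] := good_symbols rB p_pr (eeqmod9_primary pe) pk pa.
by split; split=> //; [exact: etr_eis_point|apply/h1|apply/h2].
Qed.

Lemma lattice_periodic B t :
  lattice_sgn alpha r (B + (radical alpha)%:Z * t) = lattice_sgn alpha r B /\
  lattice_cub alpha r (B + (radical alpha)%:Z * t) = lattice_cub alpha r B.
Proof.
have E q : q \in primes alpha ->
    (ere (lattice_point r (B + (radical alpha)%:Z * t)))%:~R =
      (ere (lattice_point r B))%:~R :> 'F_q /\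
    (eim (lattice_point r (B + (radical alpha)%:Z * t)))%:~R =
      (eim (lattice_point r B))%:~R :> 'F_q.
  move=> qs; have [q_pr _ _] := prime_factor6 alpha_gt0 alpha6 qs.
  have R0 : ((radical alpha)%:Z)%:~R = 0 :> 'F_q.
    apply/eqP; rewrite Fp_int_eq0 //.
    have -> : (q%:Z %| (radical alpha)%:Z)%Z = (q %| radical alpha)%N by [].
    by rewrite /radical (big_rem q) //= dvdn_mulr.
  by rewrite /= !(rmorphD, rmorphM) /= R0 !mul0r !addr0.
split; apply: eq_big_seq => q qs; have [h1 h2] := E q qs;
  have [q_pr q_odd q3] := prime_factor6 alpha_gt0 alpha6 qs.
  by rewrite (legendre_norm_congr q_pr q_odd h1 h2).
by rewrite (cubic_dual_congr q_pr h1 h2).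
Qed.

Definition modulus : nat := 16 * (9 * radical alpha).

Lemma good_periodic B t : good (B + modulus%:Z * t) = good B.
Proof.
rewrite /good; congr [&& _, _ & _].
- by rewrite -[RHS](class16_periodic _ _ _ _ _ ((9 * radical alpha)%:Z * t)) mulrA -PoszM.
- rewrite -[RHS](class9_periodic _ _ _ _ ((16 * radical alpha)%:Z * t)) mulrA -PoszM.
  by rewrite /modulus mulnCA.
have -> : modulus%:Z * t = (radical alpha)%:Z * ((16 * 9)%:Z * t).
  by rewrite mulrA -PoszM /modulus mulnA mulnC.
by have [-> ->] := lattice_periodic B ((16 * 9)%:Z * t).
Qed.

Lemma radical_gt0 : (0 < radical alpha)%N.
Proof.
rewrite /radical big_seq prodn_cond_gt0 // => q.
by case/(prime_factor6 alpha_gt0 alpha6)=> /prime_gt0.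
Qed.

Lemma radical_coprime6 : coprime (radical alpha) 6.
Proof.
rewrite coprime_sym /radical big_seq; apply: (big_ind (coprime 6)) => // [x y hx hy|q].
  by rewrite coprimeMr hx.
by rewrite mem_primes => /and3P[_ _ qa]; rewrite coprime_sym (coprime_dvdl qa).
Qed.

Lemma sum_good : (\sum_(c < modulus) good c%:Z =
  (\sum_(i < 16) class16 r k (ere bg) (eim bg) i%:Z) *
  ((\sum_(i < 9) class9 r (ere bt) (eim bt) i%:Z) *
   (\sum_(B < radical alpha) ((lattice_sgn alpha r B%:Z == target_sgn)
        && (lattice_cub alpha r B%:Z == target_cub)))))%N.
Proof.
have per (f : int -> bool) (m : nat) : (forall B t, f (B + m%:Z * t) = f B) ->
    forall i, f (i %% m)%N%:Z = f i%:Z :> nat.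
  move=> fper i; congr nat_of_bool.
  by rewrite {2}(divn_eq i m) PoszD addrC PoszM mulrC fper.
have := radical_coprime6; rewrite -[6%N]/(2 * 3)%N coprimeMr => /andP[c2 c3].
have c9 : coprime 9 (radical alpha) by rewrite -[9%N]/(3 ^ 2)%N coprimeXl // coprime_sym.
have c16 : coprime 16 (9 * radical alpha).
  by rewrite coprimeMr -[16%N]/(2 ^ 4)%N !coprimeXl // coprime_sym.
have R0 := radical_gt0.
pose F16 (i : nat) : nat := class16 r k (ere bg) (eim bg) i%:Z.
pose F9 (i : nat) : nat := class9 r (ere bt) (eim bt) i%:Z.
pose G (i : nat) : nat := (lattice_sgn alpha r i%:Z == target_sgn)
  && (lattice_cub alpha r i%:Z == target_cub).
have p16 : forall i, F16 (i %% 16)%N = F16 i := per _ 16 (class16_periodic _ _ _ _).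
have p9 : forall i, F9 (i %% 9)%N = F9 i := per _ 9 (class9_periodic _ _ _).
have pG i : G (i %% radical alpha)%N = G i.
  apply: (per (fun B => (lattice_sgn alpha r B == target_sgn)
    && (lattice_cub alpha r B == target_cub))) => B t.
  by have [-> ->] := lattice_periodic B t.
have p9G i : (F9 (i %% (9 * radical alpha)) * G (i %% (9 * radical alpha)) = F9 i * G i)%N.
  congr (_ * _)%N; first by rewrite -p9 modn_dvdm ?dvdn_mulr.
  by rewrite -pG modn_dvdm ?dvdn_mull.
have R9 : (0 < 9 * radical alpha)%N by rewrite muln_gt0.
have E1 : (\sum_(i < 9 * radical alpha) (F9 i * G i) =
    (\sum_(i < 9) F9 i) * \sum_(i < radical alpha) G i)%N :=
  @sum_crt nat 9 (radical alpha) F9 G c9 isT R0 p9 pG.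
have E2 : (\sum_(i < 16 * (9 * radical alpha)) (F16 i * (F9 i * G i)) =
    (\sum_(i < 16) F16 i) * \sum_(i < 9 * radical alpha) (F9 i * G i))%N :=
  @sum_crt nat 16 (9 * radical alpha) F16 (fun i => F9 i * G i)%N c16 isT R9 p16 p9G.
transitivity (\sum_(i < 16 * (9 * radical alpha)) (F16 i * (F9 i * G i)))%N.
  apply: eq_bigr => i _; rewrite /good /F16 /F9 /G -/bg -/bt.
  by rewrite !mulnb.
by rewrite E2 E1.
Qed.

Lemma sum_good_opp : (\sum_(c < modulus) good (- c%:Z) = \sum_(c < modulus) good c%:Z)%N.
Proof.
have M0 : (0 < modulus)%N by rewrite !muln_gt0 radical_gt0.
have [m mE] : exists m, modulus = m.+1 by exists modulus.-1; rewrite prednK.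
have gp B t : good (B + m.+1%:Z * t) = good B by rewrite -mE good_periodic.
rewrite mE [RHS](reindex_inj (@oppr_inj 'I_m.+1)) /=.
apply: eq_bigr => c _; congr nat_of_bool.
have cm := ltn_ord c.
(* Zero is its own opposite in ['I_m.+1]; otherwise the opposite of c is m + 1 - c, one period away
   from -c. *)
case: (val c) cm => [|i] cm; first by rewrite subn0 modnn oppr0.
rewrite modn_small ?ltn_subrL // -(gp (- _) 1) mulr1; congr good; lia.
Qed.
End Good.

(** * Asymptotics of finite sums *)

Section AsymptoticSum.
Variable R : realType.
Let g (x : R) : R := Num.sqrt x / ln x.

(* ln x = 4 ln y <= 4 y for y = x^(1/4) *)
Lemma sqrt_ln_ge (x : R) : 1 < x -> Num.sqrt (Num.sqrt x) <= 4 * g x.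
Proof.
move=> x1; have x0 : 0 < x by lra.
set y := Num.sqrt (Num.sqrt x).
have sx0 : 0 < Num.sqrt x by rewrite sqrtr_gt0.
have y0 : 0 < y by rewrite sqrtr_gt0.
have yy : Num.sqrt x = y ^+ 2 by rewrite sqr_sqrtr // ltW.
have xy : x = y ^+ 4 by rewrite -[4%N]/(2 * 2)%N exprM -yy sqr_sqrtr // ltW.
have lx0 : 0 < ln x by rewrite ln_gt0.
have lxy : ln x = 4 * ln y by rewrite xy lnXn // mulr_natl.
have ly : ln y <= y by have := expR_ge1Dx (ln y); rewrite lnK ?posrE //; lra.
rewrite /g yy mulrA ler_pdivlMr // lxy expr2; nra.
Qed.

Lemma bounded_div_growth (K M : R) (e : R -> R) : K != 0 ->
  (forall x, `|e x| <= M) -> (e x / (K * g x) @[x --> +oo] --> (0 : R))%classic.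
Proof.
move=> K0 eM; apply/cvgrPdist_le => eps eps0.
have M0 : 0 <= M by apply: le_trans (eM 0).
near=> x.
have x1 : 1 < x by near: x; apply: nbhs_pinfty_gt; rewrite num_real.
have K1 : 0 < `|K| by rewrite normr_gt0.
(* Chosen so that x^(1/4) >= T gives M <= eps |K| g(x), by 4 g(x) >= x^(1/4). *)
pose T := 4 * M / (eps * `|K|).
have T0 : 0 <= T by rewrite divr_ge0 ?mulr_ge0 // ltW.
have xT : T ^+ 4 <= x by near: x; apply: nbhs_pinfty_ge; rewrite num_real.
have y_ge : T <= Num.sqrt (Num.sqrt x).
  have -> : T = Num.sqrt (Num.sqrt (T ^+ 4)).
    by rewrite (exprM T 2 2) sqrtr_sqr ger0_norm ?sqr_ge0 // sqrtr_sqr ger0_norm.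
  by rewrite !ler_wsqrtr.
have gy := sqrt_ln_ge x1.
have y0 : 0 < Num.sqrt (Num.sqrt x) by rewrite !sqrtr_gt0; lra.
have g0 : 0 < g x by lra.
rewrite sub0r normrN normrM normfV normrM (gtr0_norm g0).
have Kg : 0 < `|K| * g x by exact: mulr_gt0.
rewrite ler_pdivrMr //; apply: le_trans (eM x) _.
have : T * (eps * `|K|) = 4 * M by rewrite /T divfK // mulf_neq0 // gt_eqF.
have ek : 0 < eps * `|K| by rewrite mulr_gt0.
have : T * (eps * `|K|) <= (4 * g x) * (eps * `|K|).
  by rewrite ler_pM2r //; lra.
move: (g x) => G; rewrite [eps * (`|K| * G)]mulrA; move: (eps * `|K|) => E; lra.
Unshelve. all: by end_near.
Qed.

(** The constant is zero either because K = 0, when every term is bounded, or because S is empty,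
    when only the error e remains. Otherwise every quotient by K g tends to 1 and e / (K g) tends to
    0. *)
Lemma asymp_sum (I : Type) (P : pred I) (S : seq I) (N : I -> R -> R)
    (e : R -> R) (K M : R) :
  all P S -> (forall i, P i -> asymp (N i) K g) -> (forall x, `|e x| <= M) ->
  asymp (fun x => \sum_(i <- S) N i x + e x) (K * (size S)%:R) g.
Proof.
move=> PS NK eM; rewrite /asymp; case: ifPn => [|KS0].
  rewrite mulf_eq0 pnatr_eq0 => /orP[K0|/eqP/size0nil ->]; last first.
    by exists M; near=> x; rewrite big_nil add0r.
  suff [B hB] : exists B, (\forall x \near +oo, `|\sum_(i <- S) N i x| <= B)%classic.
    exists (B + M); near=> x; apply: le_trans (ler_normD _ _) _.
    by apply: lerD => //; near: x.
  elim: S PS => [_|i S IH /= /andP[Pi /IH[B hB]]].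
    by exists 0; near=> x; rewrite big_nil normr0.
  have := NK i Pi; rewrite /asymp K0 => -[B' hB'].
  exists (B' + B); near=> x; rewrite big_cons; apply: le_trans (ler_normD _ _) _.
  by apply: lerD; near: x.
have [K0 S0] : K != 0 /\ (size S)%:R != 0 :> R.
  by move: KS0; rewrite mulf_eq0 negb_or => /andP.
have -> : (fun x => (\sum_(i <- S) N i x + e x) / (K * (size S)%:R * g x)) =
   (fun x => (\sum_(i <- S) (N i x / (K * g x)) + e x / (K * g x)) / (size S)%:R).
  apply: funext => x; rewrite -mulr_suml -mulrDl.
  have -> : K * (size S)%:R * g x = K * g x * (size S)%:R by rewrite mulrAC.
  by rewrite invfM mulrA.
suff : ((\sum_(i <- S) (N i x / (K * g x)) + e x / (K * g x)) / (size S)%:R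
    @[x --> +oo] --> (((size S)%:R + 0) / (size S)%:R : R))%classic.
  by rewrite addr0 divff.
apply: cvgM; last exact: cvg_cst.
apply: cvgD; last exact: bounded_div_growth.
elim: S PS {KS0 S0} => [_|i S IH /= /andP[Pi PS]].
  by rewrite (_ : (fun x => _) = cst 0); [exact: cvg_cst|apply: funext => x; rewrite big_nil].
rewrite (_ : (fun x => _) = (fun x => N i x / (K * g x) + \sum_(j <- S) (N j x / (K * g x)))); last first.
  by apply: funext => x; rewrite big_cons.
rewrite -add1n natrD; apply: cvgD; last exact: IH.
by have := NK i Pi; rewrite /asymp (negPf K0).
Unshelve. all: by end_near.
Qed.
End AsymptoticSum.

(** * Primes in residue classes *)

Lemma dvd2_sign (s : bool) (x y : int) :
  (2 %| x + (-1) ^+ s * y)%Z -> (2 %| x + y)%Z.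
Proof. by rewrite mulr_sign; case: s => //; lia. Qed.

Section Fibers.
Variable R : realType.
Variables (alpha : nat) (r : int) (beta gamma eta : eis) (d k : nat) (eps : int).
Hypotheses (alpha_gt0 : (0 < alpha)%N) (alpha6 : coprime alpha 6)
  (hb : beta \in [:: 1; omega; omega ^+ 2]) (heps : eps = 1 \/ eps = -1).

Let M := modulus alpha.
Let goodB := good alpha r beta gamma eta d k eps.

(* The norm of eis_point beta r (c + M m), M the modulus, is
   form_a m^2 + form_b c m + form_c c. *)
Definition form_a : int := 3 * (72 * (radical alpha)%:Z) ^+ 2.
Definition form_b (c : nat) : int := 3 * (72 * (radical alpha)%:Z) * c%:Z.
Definition form_c (c : nat) : int := ((r ^+ 2 + 3 * c%:Z ^+ 2) %/ 4)%Z.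

(** The sign is part of the class because B and -B come from different elements, possibly with
    different congruences, although their norms are given by the same polynomial. *)
Definition class_ok (t : bool * 'I_(modulus alpha)) : bool :=
  good alpha r beta gamma eta d k eps ((-1) ^+ t.1 * (t.2 : nat)%:Z).

Let M0 : (0 < M)%N.
Proof. by rewrite !muln_gt0 radical_gt0. Qed.

Lemma form_cE (c : nat) : (2 %| r + c%:Z)%Z -> 4 * form_c c = r ^+ 2 + 3 * c%:Z ^+ 2.
Proof.
case/dvdzP=> u hu; rewrite /form_c.
have -> : r ^+ 2 + 3 * c%:Z ^+ 2 = (u ^+ 2 - u * c%:Z + c%:Z ^+ 2) * 4.
  have -> : r = u * 2 - c%:Z by rewrite -hu; ring.
  by ring.
by rewrite mulzK // mulrC.
Qed.

Lemma form_value (c m : nat) : (2 %| r + c%:Z)%Z ->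
  4 * (form_a * m%:Z ^+ 2 + form_b c * m%:Z + form_c c) =
  r ^+ 2 + 3 * (c + M * m)%N%:Z ^+ 2.
Proof.
move=> rc; have -> : (c + M * m)%N%:Z = c%:Z + (16 * (9 * (radical alpha)%:Z)) * m%:Z.
  by rewrite PoszD PoszM.
by rewrite mulrDr form_cE // /form_a /form_b; ring.
Qed.

Lemma class_ok_parity t : class_ok t -> (2 %| r + (t.2 : nat)%:Z)%Z.
Proof. by move=> tok; apply: dvd2_sign (good_parity tok). Qed.

Let B_ (t : bool * 'I_M) (m : nat) : int := (-1) ^+ t.1 * ((t.2 : nat) + M * m)%N%:Z.

Let goodB_ t m : goodB (B_ t m) = class_ok t.
Proof.
rewrite /class_ok -(good_periodic _ _ _ _ _ _ _ alpha_gt0 alpha6 _ ((-1) ^+ t.1 * m%:Z)).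
by congr good; rewrite /B_ PoszD PoszM; ring.
Qed.

Let E (x : R) := Eset d k eps x r alpha beta gamma eta : set eis.

Lemma finite_Eset (x : R) : finite_set (Eset d k eps x r alpha beta gamma eta : set eis).
Proof. by apply: sub_finite_set (finite_Pi3 (R := R) x) => p []. Qed.

Lemma EsetP (x : R) p : Eset d k eps x r alpha beta gamma eta p <->
  [/\ prime (enorm p), (enorm p)%:R <= x &
     exists2 B, p = eis_point beta r B & goodB B].
Proof.
split=> [[[p_pr px] h]|[p_pr px h]].
  by split=> //; apply/(@EcondP alpha r beta gamma eta d k eps alpha_gt0 alpha6 hb heps p p_pr); split; case: h.
split; first by split.
by have /(@EcondP alpha r beta gamma eta d k eps alpha_gt0 alpha6 hb heps p p_pr)[] := h; split.
Qed.

Definition abscissa (p : eis) : int := eim (beta * p).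
(** These are the elements with m = 0, outside the range m >= 1 of (HL). *)
Definition small (p : eis) : bool := (`|abscissa p| < modulus alpha)%N.
Definition label (p : eis) : bool * 'I_(modulus alpha) :=
  (abscissa p < 0, Ordinal (ltn_pmod `|abscissa p| M0)).

Let abscissa_point B : abscissa (eis_point beta r B) = B.
Proof. by rewrite /abscissa mul_beta_eis_point. Qed.

Lemma label_abscissa p : abscissa p = B_ (label p) (`|abscissa p| %/ M).
Proof.
rewrite /B_ /label /=; have := divn_eq `|abscissa p| M; rewrite addnC mulnC => <-.
by case: (ltrP (abscissa p) 0) => h; rewrite /= ?expr1 ?expr0; lia.
Qed.

Let enorm_point t m : class_ok t ->
  (enorm (eis_point beta r (B_ t m)))%:Z =
  form_a * m%:Z ^+ 2 + form_b t.2 * m%:Z + form_c t.2.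
Proof.
move=> tok; have gB : goodB (B_ t m) by rewrite goodB_.
have := enorm_eis_point hb (good_parity gB).
have := form_value m (class_ok_parity tok).
have -> : B_ t m ^+ 2 = ((t.2 : nat) + M * m)%N%:Z ^+ 2.
  by rewrite /B_ exprMn sqrr_sign mul1r.
by move=> <-; lia.
Qed.

Lemma form_c_enorm t : class_ok t ->
  form_c t.2 = (enorm (eis_point beta r ((-1) ^+ t.1 * (t.2 : nat)%:Z)))%:Z.
Proof.
by move=> tok; have := enorm_point 0 tok; rewrite /B_ muln0 addn0 => ->; ring.
Qed.

Lemma form_aE : form_a = (3 * (72 * radical alpha) ^ 2)%N%:Z.
Proof. by rewrite /form_a -mulnn !PoszM expr2. Qed.

(** The constant term is the norm of the member of the class with m = 0: odd by the condition modulo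
    8, 1 modulo 3 by primarity, and prime to alpha because [lattice_sgn] is nonzero there. The gcd
    and parity hypotheses of (HL) follow. *)
Lemma form_c_coprime t p : class_ok t -> prime p ->
  (p%:Z %| form_a)%Z -> ~~ (p%:Z %| form_c t.2)%Z.
Proof.
move=> tok p_pr pa; rewrite (form_c_enorm tok); set B := _ * _.
have gB : good alpha r beta gamma eta d k eps B := tok.
have rB := good_parity gB.
case/and3P: (gB) => h16 h9 /andP[/eqP hs _].
have [n8 _] := (class16P gamma k hb rB).1 h16.
have n3 := enorm_primary (eeqmod9_primary ((class9P eta hb rB).1 h9)).
have pQ : [\/ p = 2%N, p = 3%N | p %| radical alpha]%N.
  move: pa; rewrite form_aE dvdzE /= Euclid_dvdM // Euclid_dvdX //.
  rewrite Euclid_dvdM // andbT -[72%N]/(2 ^ 3 * 3 ^ 2)%N Euclid_dvdM // !Euclid_dvdX //.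
  rewrite !andbT; case/orP => [|/orP[/orP[]|?]]; last by constructor 3.
  - by rewrite dvdn_prime2 // => /eqP ->; constructor 2.
  - by rewrite dvdn_prime2 // => /eqP ->; constructor 1.
  - by rewrite dvdn_prime2 // => /eqP ->; constructor 2.
rewrite dvdzE !absz_nat.
case: pQ => [->|->|pQ].
- by move: n8; move: (enorm _) => n; lia.
- by rewrite /dvdn n3.
apply/negP => pB.
have pal : (p %| alpha)%N.
  move: pQ; rewrite /radical big_seq; apply: (big_ind (fun m => (p %| m -> p %| alpha)%N)).
  - by rewrite dvdn1 => /eqP p1; rewrite p1 in p_pr.
  - by move=> x y hx hy; rewrite Euclid_dvdM // => /orP[].
  by move=> q; rewrite mem_primes => /and3P[q_pr _ qa]; rewrite dvdn_prime2 // => /eqP ->.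
have := lattice_sgn_ramified alpha_gt0 alpha6 hb rB p_pr pB pal.
by rewrite hs; case: (target_sgn_range alpha k heps) => ->.
Qed.

(** On a class the norm is a strictly increasing polynomial in m >= 1, so it maps the fiber
    bijectively onto the primes of that form. *)
Lemma fiber_size (x : R) t : class_ok t ->
  count (fun p => ~~ small p && (label p == t)) (fset_set (E x)) =
  #|` fset_set (quad_primes form_a (form_b t.2) (form_c t.2) x)|.
Proof.
move=> tok; rewrite -size_filter -(size_map enorm).
have Ein p : (p \in fset_set (E x)) = (p \in E x) by rewrite in_fset_set //; exact: finite_Eset.
have pP p : p \in [seq p <- fset_set (E x) | ~~ small p & label p == t] ->
    [/\ prime (enorm p), (enorm p)%:R <= x &
      exists2 m, (1 <= m)%N & p = eis_point beta r (B_ t m)].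
  rewrite mem_filter => /andP[/andP[sp /eqP lp]]; rewrite Ein => /set_mem/EsetP[p_pr px [B pE gB]].
  split=> //; exists (`|abscissa p| %/ M)%N.
    by rewrite divn_gt0 // leqNgt.
  by rewrite -lp -label_abscissa pE abscissa_point.
apply/perm_size/uniq_perm.
- rewrite map_inj_in_uniq ?filter_uniq ?fset_uniq //.
  move=> p p' /pP[_ _ [m m1 ->]] /pP[_ _ [m' m1' ->]] pp.
  congr (eis_point _ _ (B_ _ _)).
  have : (enorm (eis_point beta r (B_ t m)))%:Z = (enorm (eis_point beta r (B_ t m')))%:Z by rewrite pp.
  rewrite !enorm_point // => h.
  have Q0 : 0 < (radical alpha)%:Z by rewrite ltz_nat radical_gt0.
  have h' : (m%:Z - m'%:Z) * (form_a * (m + m')%N%:Z + form_b t.2) = 0.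
    rewrite PoszD; move/eqP: h; rewrite -subr_eq0 => /eqP <-; ring.
  move/eqP: h'; rewrite mulf_eq0 subr_eq0 => /orP[/eqP[]//|/eqP h'].
  exfalso; move: h'; rewrite /form_a /form_b.
  have : 0 < (radical alpha)%:Z ^+ 2 * (m + m')%N%:Z by rewrite mulr_gt0 ?exprn_gt0 // ltz_nat; lia.
  have : 0 <= (radical alpha)%:Z * (t.2 : nat)%:Z by rewrite mulr_ge0 // ltW.
  by nia.
- exact: fset_uniq.
move=> n; rewrite in_fset_set; last exact: finite_quad_primes.
apply/mapP/idP => [[p /pP[p_pr px [m m1 pE]] ->]|].
  apply/mem_set; split=> //; exists m => //.
  by rewrite pE enorm_point.
move/set_mem => -[n_pr nx [m m1 nE]].
have pn : enorm (eis_point beta r (B_ t m)) = n.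
  by apply/eqP; rewrite -eqz_nat enorm_point // nE.
exists (eis_point beta r (B_ t m)) => //.
have aB : `|abscissa (eis_point beta r (B_ t m))|%N = ((t.2 : nat) + M * m)%N.
  by rewrite abscissa_point /B_ abszMsign.
have tM := ltn_ord t.2; rewrite -/M in tM.
have Mm : (M <= M * m)%N by rewrite leq_pmulr.
rewrite mem_filter; apply/andP; split.
  apply/andP; split; first by rewrite /small aB -leqNgt -/M; lia.
  have lt0 : (abscissa (eis_point beta r (B_ t m)) < 0) = t.1.
    rewrite abscissa_point /B_; case: (t.1); rewrite /= ?expr1 ?expr0; lia.
  rewrite /label lt0; apply/eqP; case: (t) tM aB => s c /= tM aB; congr pair.
  by apply: val_inj => /=; rewrite aB -/M addnC mulnC modnMDl modn_small.
rewrite Ein; apply/mem_set/EsetP; rewrite pn; split=> //.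
exists (B_ t m); [reflexivity | by rewrite goodB_].
Qed.

Lemma fiber_empty (x : R) t : ~~ class_ok t ->
  count (fun p => ~~ small p && (label p == t)) (fset_set (E x)) = 0%N.
Proof.
move=> tok; apply/eqP; rewrite -leqn0 leqNgt -has_count; apply: contra tok.
case/hasP=> p; rewrite in_fset_set; last exact: finite_Eset.
move/set_mem/EsetP; case=> p_pr px [B pE gB] /andP[sp /eqP lp].
by rewrite -(goodB_ t (`|abscissa p| %/ M)) -lp -label_abscissa pE abscissa_point.
Qed.

Lemma small_count (x : R) : (count small (fset_set (E x)) <= 2 * M)%N.
Proof.
rewrite -size_filter.
apply: (@leq_trans (size [seq eis_point beta r (i%:Z - M%:Z) | i <- iota 0 (2 * M)])); last first.
  by rewrite size_map size_iota.
apply: uniq_leq_size; first by rewrite filter_uniq ?fset_uniq.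
move=> p; rewrite mem_filter => /andP[sp].
rewrite in_fset_set; last exact: finite_Eset.
move/set_mem/EsetP; case=> p_pr px [B pE gB].
move: sp; rewrite /small pE abscissa_point -/M => sB; apply/mapP.
by exists `|(B + M%:Z)%R|%N; [rewrite mem_iota; lia|congr eis_point; lia].
Qed.

Lemma Ecount_split (x : R) :
  Ecount d k eps x r alpha beta gamma eta =
  (\sum_(t <- enum class_ok)
     #|` fset_set (quad_primes form_a (form_b t.2) (form_c t.2) x)|
   + count small (fset_set (E x)))%N.
Proof.
rewrite /Ecount -/(E x) -sum1_size (bigID small) /= addnC; congr (_ + _)%N; last by rewrite sum1_count.
rewrite (partition_big label predT) //= big_enum_cond /=.
rewrite (bigID class_ok) /= [X in (_ + X)%N]big1 ?addn0.
  by apply: eq_big => [t|t tok]; [rewrite andbT|rewrite sum1_count fiber_size].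
by move=> t tok; rewrite sum1_count fiber_empty.
Qed.

Lemma size_class_ok : size (enum class_ok) =
  (2 * \sum_(c < M) goodB c%:Z)%N.
Proof.
rewrite -cardE -sum1_card big_mkcond /=.
transitivity (\sum_(s : bool) \sum_(c < M) (goodB ((-1) ^+ s * (c : nat)%:Z) : nat))%N.
  rewrite pair_bigA; apply: eq_bigr => t _ /=.
  by rewrite -[t \in _]/(class_ok t) /class_ok -/goodB; case: goodB.
rewrite big_bool mul2n -addnn; congr (_ + _)%N.
  rewrite -(sum_good_opp r gamma eta d k alpha_gt0 alpha6 hb heps).
  by apply: eq_bigr => c _; rewrite expr1 mulN1r.
by apply: eq_bigr => c _; rewrite expr0 mul1r.
Qed.
End Fibers.

(** * Constants *)

Lemma totient_ratio (R : realType) (n : nat) : (0 < n)%N ->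
  n%:R / (totient n)%:R = \prod_(q <- primes n) (q%:R / (q%:R - 1)) :> R.
Proof.
move=> n0; rewrite totientE // {1}(prod_primes_logn n0) !natr_prod -prodf_div.
apply: eq_big_seq => q qs; have q_pr : prime q by move: qs; rewrite mem_primes => /andP[].
have k0 : (0 < logn q n)%N by rewrite logn_gt0.
rewrite -{1}(prednK k0) expnS natrM natrM invfM.
have -> : (q.-1%:R : R) = q%:R - 1 by rewrite -[in RHS](prednK (prime_gt0 q_pr)) -natr1 addrK.
have qk0 : (q ^ (logn q n).-1)%:R != 0 :> R.
  by rewrite pnatr_eq0 expn_eq0 negb_and -lt0n prime_gt0.
by rewrite mulrACA divff // mulr1.
Qed.

(* If u diverges then so does v, and both limits are the default value 0; so
   no convergence of Euler products is needed. *)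
Lemma limn_scale (R : realType) (u v : nat -> R) (c : R) (N : nat) : c != 0 ->
  (forall n, (N <= n)%N -> v n = u n * c) -> limn v = limn u * c.
Proof.
move=> c0 uv.
have vE : {near \oo%classic, (fun n => u n * c) =1 v}.
  by exists N => // n /= Nn; rewrite uv.
have uE : {near \oo%classic, (fun n => v n * c^-1) =1 u}.
  by exists N => // n /= Nn; rewrite uv // mulfK.
have [cu|dcu] := pselect (cvgn u).
  apply/cvg_lim => //.
  apply: cvg_trans; first exact: near_eq_cvg vE.
  by apply: cvgM; [exact: cu | exact: cvg_cst].
rewrite (dvgP dcu) dvgP ?mul0r // => cv; apply: dcu; apply/cvg_ex.
exists (limn v * c^-1); apply: cvg_trans; first exact: near_eq_cvg uE.
by apply: cvgM; [exact: cv | exact: cvg_cst].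
Qed.

Section Constants.
Variable R : realType.
Variables (alpha : nat) (r : int).
Hypotheses (alpha_gt0 : (0 < alpha)%N) (alpha6 : coprime alpha 6) (r0 : r <> 0).

Let F2 (p : nat) : R := 1 - (legendre (-3) p)%:~R / (p%:R - 1).

(** All classes have the discriminant -3 (72 Q r)^2, where Q is the radical, and hence this product
    in (HL). *)
Definition class_euler_product : R :=
  prime_prod (fun p => ~~ (p%:Z %| 2 * form_a alpha)%Z)
    (fun p => 1 - (legendre (- 3 * (72 * (radical alpha)%:Z * r) ^+ 2) p)%:~R / (p%:R - 1)).

Definition class_const : R :=
  2 / (Num.sqrt 3 * (72 * (radical alpha)%:R)) *
  (3 / 2 * \prod_(q <- primes alpha) (q%:R / (q%:R - 1))) * class_euler_product.

Lemma form_a_dvd p : prime p ->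
  (p%:Z %| 2 * form_a alpha)%Z = [|| p == 2%N, p == 3%N | p \in primes alpha].
Proof.
move=> p_pr; have -> : 2 * form_a alpha = (2 * (3 * (72 * radical alpha) ^ 2))%N%:Z.
  by rewrite form_aE PoszM.
rewrite dvdzE !absz_nat Euclid_dvdM // [(p %| 3 * _)%N]Euclid_dvdM // Euclid_dvdX //.
rewrite [(p %| 72 * _)%N]Euclid_dvdM // -[72%N]/(2 ^ 3 * 3 ^ 2)%N.
rewrite [(p %| 2 ^ 3 * _)%N]Euclid_dvdM // !Euclid_dvdX // !andbT.
rewrite (dvdn_prime2 p_pr (isT : prime 2)) (dvdn_prime2 p_pr (isT : prime 3)).
have -> : (p %| radical alpha)%N = (p \in primes alpha).
  apply/idP/idP => [|ps]; last by rewrite /radical (big_rem p) //= dvdn_mulr.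
  rewrite /radical big_seq; apply: (big_ind (fun m => (p %| m)%N -> p \in primes alpha)).
  - by rewrite dvdn1 => /eqP p1; rewrite p1 in p_pr.
  - by move=> x y hx hy; rewrite Euclid_dvdM // => /orP[].
  move=> q qs; have := qs; rewrite mem_primes => /and3P[q_pr _ qa].
  by rewrite dvdn_prime2 // => /eqP ->.
by case: (p == 2%N); case: (p == 3%N).
Qed.

Lemma legendre_neg3 q : q \in primes alpha -> `|legendre (-3) q| <= 1.
Proof. by move=> _; rewrite /legendre; case: ifP => // _; case: ifP. Qed.

Lemma prime_ge5 q : q \in primes alpha -> (5 <= q)%N.
Proof.
case/(prime_factor6 alpha_gt0 alpha6) => q_pr q_odd q3.
have := prime_gt1 q_pr; move: q_odd q3; case: (q) => [|[|[|[|[|]]]]] //.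
Qed.

Lemma F2_neq0 q : q \in primes alpha -> F2 q != 0.
Proof.
move=> qs; have q5 := prime_ge5 qs; have q5' : 5%:R <= q%:R :> R by rewrite ler_nat.
rewrite /F2 subr_eq0 eq_sym; apply/eqP => h.
have : (legendre (-3) q)%:~R = q%:R - 1 :> R by apply: divr1_eq.
have : (legendre (-3) q)%:~R <= 1 :> R.
  by rewrite -[1]/(1%:~R) ler_int; have := legendre_neg3 qs; lia.
lra.
Qed.

Lemma class_factor p : prime p -> ~~ (p%:Z %| 2 * form_a alpha)%Z ->
  (if ~~ (p%:Z %| 2 * r)%Z then F2 p else 1) =
  1 - (legendre (- 3 * (72 * (radical alpha)%:Z * r) ^+ 2) p)%:~R / (p%:R - 1).
Proof.
move=> p_pr pa; have := pa; rewrite form_a_dvd // => /norP[p2 _].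
have p_odd : odd p by have := even_prime p_pr; case=> // p2'; rewrite p2' in p2.
have pE : (p%:Z %| 2 * r)%Z = (p%:Z %| r)%Z.
  rewrite !dvdzE abszM Euclid_dvdM // (dvdn_prime2 p_pr (isT : prime 2)).
  by rewrite (negPf p2).
rewrite pE legendreM // legendreX //; case: ifPn => pr.
  rewrite legendre_sqr ?mulr1 // dvdzE abszM Euclid_dvdM //.
  apply/norP; split; last by rewrite -dvdzE.
  apply: contra pa => pQ; rewrite dvdz_mull // /form_a dvdz_mull // expr2 dvdz_mulr //.
have -> : legendre (72 * (radical alpha)%:Z * r) p = 0.
  by apply/eqP; rewrite legendre_eq0 dvdz_mull //; move: pr; rewrite negbK.
by rewrite expr0n mulr0 mul0r subr0.
Qed.

(** At a prime of r outside 6 alpha the class product has the factor 1, as its discriminant vanishes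
    there; at 3 the left side has the factor 1, as (-3 / 3) = 0. What the class product lacks are
    the primes of alpha that do not divide r. *)
Lemma class_euler_productE :
  prime_prod (fun p => ~~ (p%:Z %| 2 * r)%Z) F2 =
  class_euler_product * \prod_(q <- primes alpha | ~~ (q%:Z %| r)%Z) F2 q.
Proof.
(* From N on, all primes of alpha have entered the partial products. *)
pose N := (\sum_(q <- primes alpha) q.+1)%N.
apply: (@limn_scale R _ _ _ N).
  rewrite prodf_seq_neq0; apply/allP => q qs; apply/implyP => _.
  exact: F2_neq0.
move=> n Nn.
rewrite (bigID (fun p => (p%:Z %| 2 * form_a alpha)%Z)) /= mulrC; congr (_ * _).
  rewrite [LHS]big_mkcond [RHS]big_mkcond; apply: eq_bigr => p _.
  have [p_pr|//] := boolP (prime p).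
  rewrite /=; have [pa|pa] := boolP (p%:Z %| 2 * form_a alpha)%Z.
    by rewrite andbF.
  by rewrite andbT; exact: class_factor.
rewrite [LHS]big_mkcond /=.
rewrite (eq_bigr (fun p => if (p \in primes alpha) && ~~ (p%:Z %| r)%Z then F2 p else 1)).
  rewrite -big_mkcond -big_filter_cond /=; apply: perm_big; apply: uniq_perm.
  - by rewrite filter_uniq ?iota_uniq.
  - exact: primes_uniq.
  move=> q; rewrite mem_filter mem_index_iota /=; case: (boolP (q \in _)) => //= qs.
  by apply: leq_trans Nn; rewrite /N (big_rem q) //= leq_addr.
move=> p _; case: ifP => [/andP[/andP[p_pr p2r]]|].
  rewrite form_a_dvd // => /or3P[/eqP p2|/eqP p3|pal].
  - by move: p2r; rewrite p2 dvdz_mulr.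
  - rewrite p3 ifN; first by rewrite /F2 /legendre /= mul0r subr0.
    by apply/negP => /andP[/(prime_factor6 alpha_gt0 alpha6)[]].
  by rewrite pal ifT //=; apply: contra p2r => pr; rewrite dvdz_mull.
move=> h; case: ifP => // /andP[pal pr]; move: h.
have [p_pr p_odd p3] := prime_factor6 alpha_gt0 alpha6 pal.
rewrite p_pr form_a_dvd // pal !orbT andbT /= => /negbFE.
rewrite dvdzE abszM /= Euclid_dvdM // => /orP[p2|pr'].
  by move: p_odd; rewrite dvdn_prime2 // in p2; rewrite (eqP p2).
by move: pr; rewrite dvdzE pr'.
Qed.

End Constants.

(** * The complex cube root of unity and the trace *)

Lemma cos_2pi3 (R : realType) : cos (2 * pi / 3) = - 1 / 2 :> R.
Proof.
set x : R := 2 * pi / 3; have p0 := pi_gt0 R.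
have s0 : 0 < sin x by apply: sin_gt0_pi; rewrite /x; apply/andP; split; lra.
have E : x + x + x = pi *+ 2 by rewrite /x mulr2n; field.
have c3 : cos (x + x + x) = 1 by rewrite E cos2pi.
have s3 : sin (x + x + x) = 0 by rewrite E sin2pi.
have cs := cos2Dsin2 x.
rewrite !(cosD, sinD) in c3 s3.
move: (cos x) (sin x) s0 c3 s3 cs => c s s0 c3 s3 cs.
have ss : s ^+ 2 = 3 / 4.
  have : s * (3 - 4 * s ^+ 2) = 0.
    have -> : s * (3 - 4 * s ^+ 2) = 3 * s * (c ^+ 2 + s ^+ 2) - 4 * s ^+ 3 by rewrite cs; ring.
    by rewrite -[RHS]s3; ring.
  by move/eqP; rewrite mulf_eq0 gt_eqF //= subr_eq0 => /eqP; lra.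
have cc : c ^+ 2 = 1 / 4 by lra.
have : c * (c ^+ 2 - 3 * s ^+ 2) = 1 by rewrite -[RHS]c3; ring.
by rewrite cc ss; lra.
Qed.

Lemma omegaC_root (R : realType) : omegaC R ^+ 2 = - 1 - omegaC R.
Proof.
have c := cos_2pi3 R; have := cos2Dsin2 (2 * pi / 3 : R); rewrite /omegaC c.
move: (sin _) => s cs; have ss : s ^+ 2 = 3 / 4 by lra.
apply/eqP; rewrite expr2 eq_complex /=; apply/andP; split; apply/eqP.
  by rewrite -[s * s]expr2 ss; field.
by field.
Qed.

Lemma Re_ev_omegaC (R : realType) (z : eis) : 2 * complex.Re (ev (omegaC R) z) = (etr z)%:~R.
Proof.
have intC (n : int) : n%:~R = Complex (n%:~R : R) 0 by rewrite -(rmorph_int (real_complex R) n).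
rewrite /ev !intC /omegaC cos_2pi3; simpc => /=.
by rewrite /etr rmorphB rmorphM /=; field.
Qed.

Section MainConstant.
Variable R : realType.
Variables (alpha : nat) (r : int) (beta gamma eta : eis) (d k : nat) (eps : int).
Hypotheses (alpha_gt0 : (0 < alpha)%N) (alpha6 : coprime alpha 6) (r0 : r <> 0)
  (hb : beta \in [:: 1; omega; omega ^+ 2]) (heps : eps = 1 \/ eps = -1)
  (k3 : (k <= 3)%N) (hgamma : exists delta : eis, eeqmod 2 (gamma * delta) 1).

Let F2 (p : nat) : R := 1 - (legendre (-3) p)%:~R / (p%:R - 1).

Lemma admissibleE q : q \in primes alpha ->
  (admissible q r)%:~R = (q%:R - 1) * (if (q%:Z %| r)%Z then 1 else F2 q) :> R.
Proof.
move=> qs; have q5 := prime_ge5 alpha_gt0 alpha6 qs.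
have q5' : 5%:R <= q%:R :> R by rewrite ler_nat.
rewrite /admissible /F2 !rmorphB rmorph1 /= -pmulrn; case: ifP => _.
  by rewrite rmorph0 subr0 mulr1.
rewrite mulrBr mulr1 mulrC divfK //; lra.
Qed.

Lemma admissible_neq0 q : q \in primes alpha -> (admissible q r)%:~R != 0 :> R.
Proof.
move=> qs; rewrite admissibleE //.
have q5 := prime_ge5 alpha_gt0 alpha6 qs; have q5' : 5%:R <= q%:R :> R by rewrite ler_nat.
rewrite mulf_neq0 //; first by lra.
by case: ifP => _; rewrite ?oner_neq0 //; exact: (F2_neq0 R alpha_gt0 alpha6 r0).
Qed.

(** Each factor of [Omega3] is -1 divided by [admissible], so [Omega3] is the ratio of the weights
    of a character and of the principal one. *)
Lemma Omega3E j : Omega3 R j alpha r * (local_weight 1 alpha r)%:~R =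
  (local_weight j alpha r)%:~R.
Proof.
rewrite /Omega3 /local_weight !rmorph_prod big_mkcond -big_split; apply: eq_big_seq => q qs /=.
rewrite dvd1n orbT; have := admissible_neq0 qs; rewrite /admissible.
case: (q%:Z %| r)%Z => /=; first by rewrite mul1r.
case: (j %| logn q alpha)%N => /=; first by rewrite mul1r.
rewrite !rmorphB rmorph1 rmorphN1 /= -pmulrn => h.
by rewrite divfK.
Qed.

Lemma Econst_count :
  Econst R d k eps r alpha beta * (local_weight 1 alpha r)%:~R =
  6 * (\sum_(B < radical alpha) ((lattice_sgn alpha r B%:Z == target_sgn alpha k eps)
        && (lattice_cub alpha r B%:Z == target_cub alpha beta d)))%N%:R.
Proof.
have [t1 t0] := target_cub_mu3 d alpha_gt0 alpha6 hb.
have := count_good r alpha_gt0 alpha6 (target_sgn_range alpha k heps) t1 t0.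
move/(congr1 (fun n : int => n%:~R : R)); rewrite intrM.
have -> : (\sum_(B < radical alpha) ((lattice_sgn alpha r B%:Z == target_sgn alpha k eps)
        && (lattice_cub alpha r B%:Z == target_cub alpha beta d))%:R : int)%:~R =
   (\sum_(B < radical alpha) ((lattice_sgn alpha r B%:Z == target_sgn alpha k eps)
        && (lattice_cub alpha r B%:Z == target_cub alpha beta d)))%N%:R :> R.
  by rewrite -natr_sum natz -pmulrn.
move=> ->; rewrite /Econst.
have -> : omegaC R ^+ d * eisC R (cubic beta alpha%:R) = ev (omegaC R) (target_cub alpha beta d).
  rewrite /target_cub evM ?evX ?ev_omega //; exact: omegaC_root.
rewrite Re_ev_omegaC; move: (etr _) => T.
rewrite -/(target_sgn alpha k eps); set s := _ * jacobi 3 alpha.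
rewrite !(intrD, intrM) -(Omega3E 2) -(Omega3E 3) -(Omega3E 6).
by ring.
Qed.

(** The principal weight is PI PF: PI cancels the denominators of the totient ratio, and PF
    completes the Euler product of h. The radical cancels between the totient ratio and the leading
    coefficient. *)
Lemma main_constant :
  h3 R r / 216 * (Delta r k gamma beta eta)%:R * Econst R d k eps r alpha beta =
  class_const R alpha r * (size (enum (class_ok (alpha := alpha) r beta gamma eta d k eps)))%:R.
Proof.
rewrite size_class_ok // sum_good // /h3.
have xE : xi3 R r = (xi_nat r)%:R.
  by rewrite /xi3 /xi_nat /xi2; case: ifP => //; case: ifP.
rewrite (class_euler_productE R alpha_gt0 alpha6 r0) xE /class_const.
set PF := \prod_(q <- primes alpha | _) _; set P1 := class_euler_product R alpha r.
have := congr1 (fun n : nat => n%:R : R) (xi_Delta r eta k3 hb hgamma).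
rewrite !natrM; set X := (xi_nat r)%:R; set Dl := (Delta _ _ _ _ _)%:R.
set s16 := (\sum_(i < 16) _)%N%:R; set s9 := (\sum_(i < 9) _)%N%:R => XD.
have := Econst_count; set cQ := (\sum_(B < _) _)%N%:R; set Ec := Econst _ _ _ _ _ _ _.
pose PI : R := \prod_(q <- primes alpha) (q%:R - 1).
have W1 : (local_weight 1 alpha r)%:~R = PI * PF.
  rewrite /local_weight rmorph_prod /PI /PF [X in _ * X]big_mkcond -big_split.
  apply: eq_big_seq => q qs /=; rewrite dvd1n orbT admissibleE //.
  by case: (q%:Z %| r)%Z.
have PI0 : PI != 0.
  rewrite /PI prodf_seq_neq0; apply/allP => q qs; apply/implyP => _.
  have q5 := prime_ge5 alpha_gt0 alpha6 qs.
  have q5' : 5%:R <= q%:R :> R by rewrite ler_nat.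
  by lra.
have PQ : \prod_(q <- primes alpha) (q%:R / (q%:R - 1)) = (radical alpha)%:R / PI.
  by rewrite prodf_div /radical natr_prod.
have Q0 : (radical alpha)%:R != 0 :> R by rewrite pnatr_eq0 -lt0n radical_gt0.
rewrite PQ W1 => EW.
have s30 : Num.sqrt (3 : R) != 0 by rewrite gt_eqF // sqrtr_gt0.
have s33 : Num.sqrt (3 : R) * Num.sqrt 3 = 3 by rewrite -expr2 sqr_sqrtr.
have -> : 2 / (Num.sqrt 3 * (72 * (radical alpha)%:R)) =
   Num.sqrt 3 / (108 * (radical alpha)%:R) :> R.
  apply: (mulfI (mulf_neq0 s30 Q0)).
  have -> : Num.sqrt 3 * (radical alpha)%:R * (Num.sqrt 3 / (108 * (radical alpha)%:R)) =
     Num.sqrt 3 * Num.sqrt 3 / 108 :> R by field.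
  by rewrite s33; field; rewrite Q0 s30.
have EcE : cQ = Ec * PI * PF / 6 by rewrite -[Ec * PI * PF]mulrA EW; field.
rewrite EcE; move: XD; rewrite -/X -/Dl.
have -> : X * (Num.sqrt 3 / 2) * (P1 * PF) / 216 * Dl * Ec =
   (X * Dl) * (Num.sqrt 3 / 432 * P1 * PF * Ec) by field.
by move=> ->; field; rewrite PI0 Q0.
Qed.
End MainConstant.

(** * The Hardy--Littlewood conjecture applied to one class *)

Section ClassAsymptotics.
Variable R : realType.
Variables (alpha : nat) (r : int) (beta gamma eta : eis) (d k : nat) (eps : int).
Hypotheses (alpha_gt0 : (0 < alpha)%N) (alpha6 : coprime alpha 6) (r0 : r <> 0)
  (hb : beta \in [:: 1; omega; omega ^+ 2]) (heps : eps = 1 \/ eps = -1).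

Lemma form_a_gt0 : 0 < form_a alpha.
Proof. by rewrite form_aE ltz_nat muln_gt0 expn_gt0 muln_gt0 radical_gt0. Qed.

Lemma form_disc t : class_ok (alpha := alpha) r beta gamma eta d k eps t ->
  form_b alpha t.2 ^+ 2 - 4 * form_a alpha * form_c r t.2 =
  - 3 * (72 * (radical alpha)%:Z * r) ^+ 2.
Proof.
move=> tok; have h := form_cE (class_ok_parity tok).
rewrite [4 * _ * _]mulrAC h /form_a /form_b.
by ring.
Qed.

(** The gcd of the first two coefficients varies with c, but its odd prime divisors are always 3 and
    the primes of alpha, and the totient ratio depends on nothing else. *)
Lemma hl_const_class t : class_ok (alpha := alpha) r beta gamma eta d k eps t ->
  hl_const R (form_a alpha) (form_b alpha t.2) (form_c r t.2) = class_const R alpha r.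
Proof.
move=> tok; rewrite /hl_const form_disc // /class_const -/(class_euler_product R alpha r).
congr (_ * _); have Q0 := radical_gt0 alpha_gt0 alpha6.
have -> : gcdz 2 (form_a alpha + form_b alpha t.2) = 2.
  rewrite /form_a /form_b.
  have -> : 3 * (72 * (radical alpha)%:Z) ^+ 2 + 3 * (72 * (radical alpha)%:Z) * (t.2 : nat)%:Z =
    2 * (3 * 36 * (radical alpha)%:Z * (72 * (radical alpha)%:Z + (t.2 : nat)%:Z)) by ring.
  by rewrite /gcdz abszM gcdnMr.
have -> : Num.sqrt (form_a alpha)%:~R = Num.sqrt 3 * (72 * (radical alpha)%:R) :> R.
  have q0 : 0 <= 72 * (radical alpha)%:R :> R by rewrite mulr_ge0.
  have -> : (form_a alpha)%:~R = 3 * (72 * (radical alpha)%:R) ^+ 2 :> R.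
    by rewrite /form_a intrM rmorphXn /= intrM.
  by rewrite sqrtrM // sqrtr_sqr ger0_norm.
congr (_ * _).
set G := gcdn _ _; have G0 : (0 < G)%N.
  by rewrite gcdn_gt0 absz_gt0 gt_eqF // form_a_gt0.
rewrite totient_ratio ?part_gt0 //.
have -> : \prod_(q <- primes (G`_2^')%N) (q%:R / (q%:R - 1)) =
    \prod_(q <- 3%N :: primes alpha) (q%:R / (q%:R - 1)) :> R.
  apply: perm_big; apply: uniq_perm; first exact: primes_uniq.
    rewrite /= primes_uniq andbT; apply/negP => /(prime_factor6 alpha_gt0 alpha6)[_ _].
    by rewrite eqxx.
  move=> p; rewrite primes_part mem_filter in_cons.
  apply/andP/orP => [[p2 pG]|].
    have p_pr : prime p by move: pG; rewrite mem_primes => /andP[].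
    have : (p%:Z %| 2 * form_a alpha)%Z.
      rewrite dvdz_mull // dvdzE; move: pG; rewrite mem_primes => /and3P[_ _].
      by move/dvdn_trans; apply; exact: dvdn_gcdl.
    rewrite form_a_dvd // => /or3P[p2'|h|h]; [|by left|by right].
    by move: p2; rewrite (eqP p2').
  have key q : prime q -> q != 2%N -> (q %| 3 * (72 * radical alpha))%N ->
      q \notin (2%N : nat_pred) /\ q \in primes G.
    move=> q_pr q2 qd; split; first by rewrite !inE.
    rewrite mem_primes q_pr G0 /= dvdn_gcd; apply/andP; split.
      rewrite form_aE absz_nat -mulnn mulnA dvdn_mulr //.
    have -> : form_b alpha t.2 = (3 * (72 * radical alpha) * t.2)%N%:Z by [].
    by rewrite absz_nat dvdn_mulr.
  case=> [/eqP ->|ps]; first by apply: key => //; rewrite dvdn_mulr.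
  have [p_pr p_odd _] := prime_factor6 alpha_gt0 alpha6 ps.
  apply: key => //; first by apply: contraTneq p_odd => ->.
  by rewrite mulnA dvdn_mull // /radical (big_rem p) //= dvdn_mulr.
rewrite big_cons; congr (_ * _); congr (_ / _); ring.
Qed.

Lemma asymp_class (HL : HardyLittlewood R) t :
  class_ok (alpha := alpha) r beta gamma eta d k eps t ->
  asymp (fun x => (#|` fset_set (quad_primes (form_a alpha) (form_b alpha t.2) (form_c r t.2) x)|)%:R)
    (class_const R alpha r) (fun x : R => Num.sqrt x / ln x).
Proof.
move=> tok; rewrite -(hl_const_class tok); apply: HL.
- exact: form_a_gt0.
(* The discriminant is negative, since r <> 0. *)
- case=> n; rewrite form_disc // => h.
  have Q0 := radical_gt0 alpha_gt0 alpha6.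
  have : 0 < (72 * (radical alpha)%:Z * r) ^+ 2.
    rewrite lt_neqAle sqr_ge0 andbT eq_sym sqrf_eq0 !mulf_eq0 /= eqz_nat.
    by rewrite gtn_eqF //=; apply/eqP.
  by have := sqr_ge0 n; rewrite -h; move: ((72 * _ * r) ^+ 2) => Y; rewrite mulNr oppr_ge0 pmulr_rle0 // => /le_gtF ->.
- have g0 : (0 < `|gcdz (gcdz (form_a alpha) (form_b alpha t.2)) (form_c r t.2)|)%N.
    by rewrite absz_gt0 !gcdz_eq0 gt_eqF // form_a_gt0.
  rewrite -[LHS]gez0_abs ?lez_nat //; congr Posz; apply/eqP; rewrite eqn_leq g0 andbT leqNgt.
  apply/negP => g1; have p_pr := pdiv_prime g1; have pd := pdiv_dvd `|gcdz (gcdz (form_a alpha) (form_b alpha t.2)) (form_c r t.2)|.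
  move: (pdiv _) p_pr pd => p p_pr pd.
  have [pa pc] : (p%:Z %| form_a alpha)%Z /\ (p%:Z %| form_c r t.2)%Z.
    have : (p%:Z %| gcdz (gcdz (form_a alpha) (form_b alpha t.2)) (form_c r t.2))%Z by rewrite dvdzE.
    by rewrite !dvdz_gcd => /andP[/andP[]].
  by have := form_c_coprime alpha_gt0 alpha6 hb heps tok p_pr pa; rewrite pc.
case=> _ c2; have := form_c_coprime alpha_gt0 alpha6 hb heps tok (isT : prime 2).
rewrite c2 => /(_ _)/negP; apply=> //.
by rewrite /form_a dvdz_mull // expr2 dvdz_mulr // dvdz_mulr.
Qed.

End ClassAsymptotics.

Theorem theorem5p6 (R : realType)
  (HL : HardyLittlewood R)
  (alpha : nat) (halpha0 : (0 < alpha)%N) (halpha : coprime alpha 6)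
  (r : int) (hr : r <> 0)
  (beta : eis) (hbeta : beta \in [:: 1; omega; omega ^+ 2])
  (d : nat) (hd : (d <= 2)%N)
  (k : nat) (hk : (k <= 3)%N)
  (eps : int) (heps : eps = 1 \/ eps = -1)
  (gamma : eis) (hgamma : exists delta : eis, eeqmod 2 (gamma * delta) 1)
  (eta : eis) :
  asymp (fun x : R => (Ecount d k eps x r alpha beta gamma eta)%:R)
    (h3 R r / 216 * (Delta r k gamma beta eta)%:R *
       Econst R d k eps r alpha beta)
    (fun x : R => Num.sqrt x / ln x).
Proof.
rewrite (main_constant R eta d halpha0 halpha hr hbeta heps hk hgamma).
pose N (t : bool * 'I_(modulus alpha)) (x : R) : R :=
  (#|` fset_set (quad_primes (form_a alpha) (form_b alpha t.2) (form_c r t.2) x)|)%:R.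
pose e (x : R) : R := (count (small alpha beta) (fset_set (Eset d k eps x r alpha beta gamma eta)))%:R.
have -> : (fun x : R => (Ecount d k eps x r alpha beta gamma eta)%:R : R) =
    (fun x => \sum_(t <- enum (class_ok (alpha := alpha) r beta gamma eta d k eps)) N t x + e x).
  by apply: funext => x; rewrite Ecount_split // natrD natr_sum.
apply: (@asymp_sum R _ (class_ok (alpha := alpha) r beta gamma eta d k eps) _ _ _ _ (2 * modulus alpha)%:R).
- by apply/allP => t; rewrite mem_enum.
- by move=> t tok; apply: asymp_class tok.
by move=> x; rewrite ger0_norm ?ler0n // ler_nat small_count.
Qed.
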